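(* Let $s,t$ be positive integers. There exists a deterministic pushdown automaton over the finite alphabet $\{\sigma[1],\dots,\sigma[s],\tau[1],\dots,\tau[t]\}$ whose accepted language consists only of reduced well-formed operation sequences and contains exactly one sequence from each equivalence class of well-formed operation sequences all of whose pushes have size at most $s$ and all of whose pops have size at most $t$.
   Context: Operation sequences: $\sigma[a]$ ($a\ge1$) denotes pushing the top $a$ elements of the input stack, as a block with relative order unchanged, onto the top of a working stack; $\tau[b]$ ($b\ge1$) denotes moving the top $b$ elements of the working stack, as a block with relative order unchanged, onto the top of an output stack; $\sigma=\sigma[1]$, $\tau=\tau[1]$. A well-formed operation sequence is a word $\alpha=\alpha_1\cdots\alpha_m$ in these symbols such that in every prefix the total push size is at least the total pop size, with equality for the whole word; its size $n$ is the total push size. Acting on an input stack containing $1,\dots,n$ with $1$ on top, it produces the permutation read from the final output stack top to bottom. Two well-formed sequences are equivalent if they have the same size and produce the same permutation. $\alpha$ is reduced if every consecutive pair $\alpha_i\alpha_{i+1}$ with $\alpha_i$ a push and $\alpha_{i+1}$ a pop equals $\sigma[1]\tau[1]$. *)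

(* Defs.v *)
From mathcomp Require Import all_boot.
Set Implicit Arguments. Unset Strict Implicit. Unset Printing Implicit Defensive.

Inductive op := Push of nat | Pop of nat.

Definition push_size (o : op) : nat := if o is Push a then a else 0.
Definition pop_size (o : op) : nat := if o is Pop b then b else 0.
Definition total_push (w : seq op) : nat := sumn (map push_size w).
Definition total_pop (w : seq op) : nat := sumn (map pop_size w).

Definition op_size (w : seq op) : nat := total_push w.

Definition op_pos (o : op) : bool :=
  match o with Push a => 0 < a | Pop b => 0 < b end.

Definition well_formed (w : seq op) : Prop :=
  [/\ all op_pos w,
      (forall k, total_pop (take k w) <= total_push (take k w)) &
      total_push w = total_pop w].

(* Stacks are lists with the head being the top. Configuration =
   (input stack, working stack, output stack). A block of the top a elements is
   moved keeping relative order. *)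
Definition step (c : seq nat * seq nat * seq nat) (o : op) :=
  let: (inp, wk, out) := c in
  match o with
  | Push a => (drop a inp, take a inp ++ wk, out)
  | Pop b => (inp, drop b wk, take b wk ++ out)
  end.

(* permutation produced: final output stack read top to bottom, starting from
   the input stack 1,...,n with 1 on top *)
Definition output (w : seq op) : seq nat :=
  (foldl step (iota 1 (op_size w), [::], [::]) w).2.

Definition equivalent (w1 w2 : seq op) : Prop :=
  op_size w1 = op_size w2 /\ output w1 = output w2.

Definition reduced (w : seq op) : Prop :=
  forall i a b, i.+1 < size w ->
    nth (Pop 0) w i = Push a -> nth (Pop 0) w i.+1 = Pop b -> a = 1 /\ b = 1.

(* Alphabet {sigma[1..s], tau[1..t]}: inl i = sigma[i+1], inr j = tau[j+1]. *)
Definition sym (s t : nat) : finType := ('I_s + 'I_t)%type.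
Definition to_op (s t : nat) (x : sym s t) : op :=
  match x with inl i => Push i.+1 | inr j => Pop j.+1 end.

Record DPDA (Sigma : finType) := {
  dpda_state : finType;
  dpda_stack : finType;
  dpda_delta : dpda_state -> option Sigma -> dpda_stack ->
               option (dpda_state * seq dpda_stack);
  dpda_start : dpda_state;
  dpda_bottom : dpda_stack;
  dpda_final : {set dpda_state};
  dpda_det : forall q Z, dpda_delta q None Z != None ->
               forall a, dpda_delta q (Some a) Z = None
}.

Section Run.
Variables (Sigma : finType) (M : DPDA Sigma).

Definition config := (dpda_state M * seq Sigma * seq (dpda_stack M))%type.

Inductive move : config -> config -> Prop :=
| move_read q a w Z g q' al :
    dpda_delta q (Some a) Z = Some (q', al) ->
    move (q, a :: w, Z :: g) (q', w, al ++ g)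
| move_eps q w Z g q' al :
    dpda_delta q None Z = Some (q', al) ->
    move (q, w, Z :: g) (q', w, al ++ g).

Inductive moves : config -> config -> Prop :=
| moves_refl c : moves c c
| moves_step c1 c2 c3 : move c1 c2 -> moves c2 c3 -> moves c1 c3.

Definition accepts (w : seq Sigma) : Prop :=
  exists q g, moves (dpda_start M, w, [:: dpda_bottom M]) (q, [::], g)
              /\ q \in dpda_final M.
End Run.

(* Main.v *)
Require Import Defs.
From mathcomp Require Import all_boot zify.
From Stdlib Require Import Classical ClassicalEpsilon.
Set Implicit Arguments. Unset Strict Implicit. Unset Printing Implicit Defensive.

(* Every word is equivalent to a reduced one.  The left-to-right maxima of the
   reversed output of a reduced word are the elements at its peaks, so reduced
   equivalent words share their Dyck path and differ only in how runs are cut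
   into blocks.  If r and r' reverse the push blocks of two such words (as maps
   of the ups), then r' r equals the corresponding product for the pop blocks,
   transported by the matching of the path.  This product preserves each class of
   parallel arcs, hence blocks that cross the boundary of a class are common to
   both words, and inside a class the problem is about two pairs (P, Q), (P', Q')
   of interval partitions of a segment with r_P' r_P = r_Q' r_Q.  Cut the class
   where P and Q are both cut.  On a component that shares its first or last block
   the two pairs agree; otherwise the component is closed under all the blocks
   and has at most 2(s + t) arcs.  So only closed segments of bounded size
   offer a choice, and a word is canonical when each of them is lexicographically
   minimal.  The automaton keeps on its stack how the pushes were cut and in its
   state a bounded description of the segment being popped. *)

(** A class of parallel arcs can be arbitrarily large, whereas finite control can compare only
    bounded pieces; the point is that freedom of choice never spreads. Reversals are involutions, so
    on a block common to [P] and [P'] the reversals of [Q] and [Q'] coincide, and this agreement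
    passes alternately between push and pop blocks until it fills the component. If instead the
    first blocks of both kinds differ, the values near the left end force two consecutive blocks of
    one kind to cover the component: fewer than [2s] or [2t] gaps, and [2(s + t)] bounds both cases.
    The two words have the same components because a common cut of only one word would lie inside a
    segment that the other both pushes and pops as a single block; cutting that segment into units
    has the same effect and is lexicographically smaller, so a canonical word has no such segment.
    Minimality is imposed segment by segment, not on the whole word: the automaton can then test a
    segment once it has been popped, and successive replacements terminate because they keep the
    total size and lower the word lexicographically. *)

(** * Interval partitions and their block reversals *)

(** A partition of the naturals into intervals is given by its gaps: [u c] means that [c] and [c.+1]
    are in the same block. Restricting a partition is then a conjunction, and the components of two
    partitions are the blocks of a disjunction. *)
Definition block (u : nat -> bool) (x y : nat) :=
  [/\ x <= y, (x == 0) || ~~ u x.-1, ~~ u y & forall c, x <= c < y -> u c].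

(** A specification, because three different functions satisfy it: [brev] on lists of sizes,
    [block_rev] on restricted partitions, and [conj_rev] on pop blocks carried to the ups. Positions
    from [n] on are singletons, so [r] is an involution of all naturals. *)
Definition reversal (n b : nat) (u : nat -> bool) (r : nat -> nat) :=
  [/\ forall c, n <= c.+1 -> u c = false,
      forall x y k, block u x y -> x <= k <= y -> r k = x + y - k
    & forall x y, block u x y -> y - x < b].

(* [lia] case-splits on every Boolean hypothesis it sees; drop those that are
   not comparisons. *)
Ltac qlia :=
  repeat match goal with
    | H : is_true (~~ ?f _) |- _ => is_var f; clear H
    | H : is_true (_ || _) |- _ => clear H
    | H : block _ _ _ |- _ => clear H
    | H : reversal _ _ _ _ |- _ => clear H
    | H : forall _, _ |- _ => clear H
    | H : is_true (?f _) |- _ => is_var f; clear H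
    | H : ?f _ = ?g _ :> bool |- _ => is_var f; clear H
  end; lia.

Lemma block_end u n i : (forall c, n <= c.+1 -> u c = false) ->
  exists y, [/\ i <= y, ~~ u y & forall c, i <= c < y -> u c].
Proof.
move=> un.
have ex : exists y, (i <= y) && ~~ u y.
  by exists (i + n); rewrite un ?leq_addr //; lia.
have [y /andP[iy uy] miny] := ex_minnP ex.
exists y; split=> // c /andP[ic cy]; case E: (u c) => //.
by have := miny c; rewrite ic E => /(_ isT); lia.
Qed.

Lemma block_begin (u : nat -> bool) i :
  exists x, [/\ x <= i, (x == 0) || ~~ u x.-1 & forall c, x <= c < i -> u c].
Proof.
elim: i => [|i [x [xi ux cu]]]; first by exists 0; split=> //; lia.
case E: (u i).
  exists x; split=> // [|c /andP[xc ci]]; first lia.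
  have [->//|ci'] := eqVneq c i.
  by apply: cu; lia.
by exists i.+1; split=> //=; [rewrite E | lia].
Qed.

Lemma block_ex u n i : (forall c, n <= c.+1 -> u c = false) ->
  exists x y, block u x y /\ x <= i <= y.
Proof.
move=> un; have [x [xi ux cx]] := block_begin u i.
have [y [iy uy cy]] := block_end i un.
exists x, y; split; last by rewrite xi.
split=> // [|c /andP[xc ycy]]; first lia.
by case: (leqP i c) => ic; [apply: cy | apply: cx]; lia.
Qed.

Lemma block_from u n x : (forall c, n <= c.+1 -> u c = false) ->
  (x == 0) || ~~ u x.-1 -> exists y, block u x y.
Proof. by move=> un ux; have [y [? ? ?]] := block_end x un; exists y. Qed.

Lemma block_upto u y : ~~ u y -> exists x, block u x y.
Proof. by move=> uy; have [x [? ? ?]] := block_begin u y; exists x. Qed.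

Lemma eq_block u v x y : u =1 v -> block u x y -> block v x y.
Proof.
by move=> uv [xy cx cy cu]; split=> // [||c xc]; rewrite -?uv //; apply: cu.
Qed.

Lemma block_uniq u x y x' y' i : block u x y -> block u x' y' ->
  x <= i <= y -> x' <= i <= y' -> x = x' /\ y = y'.
Proof.
move=> [xy ux uy cu] [xy' ux' uy' cu'] xi xi'; split.
  case: (ltngtP x x') => // lt.
    by move: ux'; rewrite cu; lia.
  by move: ux; rewrite cu'; lia.
case: (ltngtP y y') => // lt.
  by move: uy; rewrite cu'; lia.
by move: uy'; rewrite cu; lia.
Qed.

Lemma block_uniq_end u x y y' : block u x y -> block u x y' -> y = y'.
Proof.
move=> b1 b2; have [h1 _ _ _] := b1; have [h2 _ _ _] := b2.
by case: (block_uniq b1 b2 (i := x)); rewrite ?leqnn.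
Qed.

Lemma block_uniq_begin u x x' y : block u x y -> block u x' y -> x = x'.
Proof.
move=> b1 b2; have [h1 _ _ _] := b1; have [h2 _ _ _] := b2.
by case: (block_uniq b1 b2 (i := y)); rewrite ?leqnn ?andbT.
Qed.

Lemma block_le u x y i : block u x y -> x <= i -> ~~ u i -> y <= i.
Proof.
move=> [_ _ _ cu] xi; apply: contraNleq => iy; apply: cu; lia.
Qed.

Lemma block_ge u x y i : block u x y -> i <= y -> (i == 0) || ~~ u i.-1 -> i <= x.
Proof.
move=> [_ _ _ cu] iy ui; rewrite leqNgt; apply/negP => xi.
by move: ui; rewrite cu; lia.
Qed.

Lemma reversal_in n b u r i : reversal n b u r ->
  exists x y, [/\ block u x y, x <= i <= y, x <= r i <= y & r i = x + y - i].
Proof.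
case=> un ru _; have [x [y [bl xi]]] := block_ex i un.
by exists x, y; split=> //; rewrite (ru x y) //; lia.
Qed.

Lemma reversalK n b u r i : reversal n b u r -> r (r i) = i.
Proof.
move=> ru; have [x [y [bl xi xr e]]] := reversal_in i ru.
by case: ru => _ /(_ x y (r i) bl xr) -> _; lia.
Qed.

Lemma reversal_cut n b u r c i : reversal n b u r -> ~~ u c ->
  (r i <= c) = (i <= c).
Proof.
move=> ru uc; have [x [y [bl xi xr e]]] := reversal_in i ru.
have [xc|cx] := leqP x c; last lia.
by have := block_le bl xc uc; lia.
Qed.

(* [rB \o rA] preserves the initial segment ending at [c] only if [A] and [B]
   treat the block across [c] identically. *)
Lemma shared_block_across n b b' A B rA rB c :
  reversal n b A rA -> reversal n b' B rB ->
  (forall i, (rB (rA i) <= c) = (i <= c)) -> A c ->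
  exists x y, [/\ x <= c < y, block A x y & block B x y].
Proof.
move=> HA HB pres Ac.
have [x [y [bA xc _ _]]] := reversal_in c HA.
have cy : c < y.
  case: bA => _ _ uy _; rewrite ltn_neqAle; apply/andP; split; last lia.
  by apply: contraNneq uy => <-.
have [x' [y' [bB xc' _ _]]] := reversal_in c HB.
have rx : rA x = y by case: HA => _ /(_ x y x bA) -> //; lia.
have ry : rA y = x by case: HA => _ /(_ x y y bA) -> //; lia.
(* [rA] swaps the ends [x] and [y], which lie on both sides of [c], so [rB] has to carry each of
   them back across [c]. Hence both are in the block of [B] across [c]; exchanging the roles gives
   the other inclusion. *)
have := pres x; rewrite rx => px.
have := pres y; rewrite ry => py.
have [x1 [y1 [b1 i1 j1 e1]]] := reversal_in y HB.
have [x2 [y2 [b2 i2 j2 e2]]] := reversal_in x HB.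
have [E1 E2] : x1 = x' /\ y1 = y' by apply: (block_uniq b1 bB (i := c)); lia.
have [E3 E4] : x2 = x' /\ y2 = y' by apply: (block_uniq b2 bB (i := c)); lia.
subst x1 y1 x2 y2.
have rx' : rB x' = y' by case: HB => _ /(_ x' y' x' bB) -> //; lia.
have ry' : rB y' = x' by case: HB => _ /(_ x' y' y' bB) -> //; lia.
have := pres (rA x'); rewrite (reversalK _ HA) rx' => px'.
have := pres (rA y'); rewrite (reversalK _ HA) ry' => py'.
have [x3 [y3 [b3 i3 j3 e3]]] := reversal_in x' HA.
have [x4 [y4 [b4 i4 j4 e4]]] := reversal_in y' HA.
have [E5 E6] : x3 = x /\ y3 = y by apply: (block_uniq b3 bA (i := c)); lia.
have [E7 E8] : x4 = x /\ y4 = y by apply: (block_uniq b4 bA (i := c)); lia.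
subst x3 y3 x4 y4.
have ex : x = x' by lia.
have ey : y = y' by lia.
exists x, y; split=> //; first lia.
by rewrite ex ey.
Qed.

(** * Two pairs of interval partitions with the same product of reversals *)

Lemma shared_block_fix n b b' c c' A A' B B' rA rA' rB rB' x y i :
  reversal n b A rA -> reversal n b' A' rA' ->
  reversal n c B rB -> reversal n c' B' rB' ->
  (forall i, rA' (rA i) = rB' (rB i)) ->
  block A x y -> block A' x y -> x <= i <= y -> rB i = rB' i.
Proof.
move=> HA HA' HB HB' E bA bA' xi.
have Ei : rA i = x + y - i by case: HA => _ /(_ x y i bA xi).
have : rA' (rA i) = i.
  by rewrite Ei; case: HA' => _ /(_ x y (x + y - i) bA') -> //; lia.
by rewrite E => /(congr1 rB'); rewrite (reversalK _ HB').
Qed.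

(** On the shared block [[a..e]] the reversals [rB] and [rB'] agree ([shared_block_fix]), so blocks
    of [B] and [B'] that both start at [f] in it have the same end [g]. If [g < e], the next ones
    start in the same shared block; if [g > e], [[f..g]] becomes the shared block and the two
    families exchange roles; if [g = e], a common cut is reached and connectedness gives [y <= e].
    [k] bounds the distance from [f] to [y]. *)
Lemma agree_right k : forall n b b' c c' A A' B B' rA rA' rB rB' x y a e f,
  reversal n b A rA -> reversal n b' A' rA' ->
  reversal n c B rB -> reversal n c' B' rB' ->
  (forall i, rA' (rA i) = rB' (rB i)) ->
  (forall i, x <= i < y -> A i || B i) ->
  block A a e -> block A' a e -> x <= f -> a <= f <= e ->
  (f == 0) || ~~ B f.-1 -> (f == 0) || ~~ B' f.-1 ->
  (forall i, x <= i < e -> A i = A' i) ->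
  (forall i, x <= i < f -> B i = B' i) -> y <= f + k ->
  forall i, x <= i < y -> A i = A' i /\ B i = B' i.
Proof.
elim: k => [|k IH] n b b' c c' A A' B B' rA rA' rB rB' x y a e f
  HA HA' HB HB' E ncc bA bA' xf afe Bf Bf' agA agB yfk i xi.
  by rewrite agA ?agB //; qlia.
have [ya|fy] := leqP y f; first by rewrite agA ?agB //; qlia.
have [g bB] := block_from (n := n) (fun c => let: And3 h _ _ := HB in h c) Bf.
have [g' bB'] := block_from (n := n) (fun c => let: And3 h _ _ := HB' in h c) Bf'.
have r1 : rB f = g by case: HB => _ /(_ f g f bB) -> //; case: bB; lia.
have r2 : rB' f = g' by case: HB' => _ /(_ f g' f bB') -> //; case: bB'; lia.
have := shared_block_fix HA HA' HB HB' E bA bA' afe; rewrite r1 r2 => eg.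
rewrite -eg in bB'; have [fg _ Bg cB] := bB; have [_ _ Bg' cB'] := bB'.
have [ae _ Ae _] := bA; have [_ _ Ae' _] := bA'.
have agB1 : forall j, x <= j < g.+1 -> B j = B' j.
  move=> j xj; have [jf|fj] := ltnP j f; first by apply: agB; qlia.
  have [->|jg] := eqVneq j g; first by rewrite (negbTE Bg) (negbTE Bg').
  by rewrite cB ?cB' //; qlia.
have agA1 : forall j, x <= j < e.+1 -> A j = A' j.
  move=> j xj; have [->|je] := eqVneq j e; first by rewrite (negbTE Ae) (negbTE Ae').
  by rewrite agA //; qlia.
case: (ltngtP g e) => ge.
- by apply: (IH _ _ _ _ _ _ _ _ _ _ _ _ _ x y a e g.+1 HA HA' HB HB' E) => //; qlia.
- suff: B i = B' i /\ A i = A' i by case.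
  apply: (IH _ _ _ _ _ _ _ _ _ _ _ _ _ x y f g e.+1 HB HB' HA HA') => //; try qlia; try lia.
  + by move=> j xj; rewrite orbC ncc.
  + by move=> j xj; apply: agB1; qlia.
- have Be : ~~ B e by rewrite -ge.
  have ye : y <= e.
    by rewrite leqNgt; apply/negP => ey; move: (ncc e); rewrite (negbTE Ae) (negbTE Be); lia.
  by split; [apply: agA1 | apply: agB1]; qlia.
Qed.

(** Mirror image of [agree_right]: the agreement spreads from a shared block to the left, through
    blocks that end at the common point [f]. *)
Lemma agree_left k : forall n b b' c c' A A' B B' rA rA' rB rB' x y a e f,
  reversal n b A rA -> reversal n b' A' rA' ->
  reversal n c B rB -> reversal n c' B' rB' ->
  (forall i, rA' (rA i) = rB' (rB i)) ->
  (forall i, x <= i < y -> A i || B i) ->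
  block A a e -> block A' a e -> f <= y -> a <= f <= e ->
  ~~ B f -> ~~ B' f ->
  (forall i, a <= i < y -> A i = A' i) ->
  (forall i, f <= i < y -> B i = B' i) -> f <= x + k ->
  forall i, x <= i < y -> A i = A' i /\ B i = B' i.
Proof.
elim: k => [|k IH] n b b' c c' A A' B B' rA rA' rB rB' x y a e f
  HA HA' HB HB' E ncc bA bA' fley afe Bf Bf' agA agB yfk i xi.
  by rewrite agA ?agB //; qlia.
have [ya|fy] := leqP f x; first by rewrite agA ?agB //; qlia.
have [g bB] := block_upto Bf.
have [g' bB'] := block_upto Bf'.
have r1 : rB f = g by case: HB => _ /(_ g f f bB) -> //; case: bB; lia.
have r2 : rB' f = g' by case: HB' => _ /(_ g' f f bB') -> //; case: bB'; lia.
have := shared_block_fix HA HA' HB HB' E bA bA' afe; rewrite r1 r2 => eg.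
rewrite -eg in bB'; have [fg Bg _ cB] := bB; have [_ Bg' _ cB'] := bB'.
have [ae Ae _ _] := bA; have [_ Ae' _ _] := bA'.
have agB1 : forall j, g <= j < y -> B j = B' j.
  move=> j xj; have [jf|fj] := leqP f j; first by apply: agB; qlia.
  by rewrite cB ?cB' //; qlia.
case: (ltngtP g a) => ga.
- suff: B i = B' i /\ A i = A' i by case.
  apply: (IH _ _ _ _ _ _ _ _ _ _ _ _ _ x y g f a.-1 HB HB' HA HA') => //; try qlia; try lia.
  + by move=> j xj; rewrite orbC ncc.
  + by move=> j xj; have [->|ja] := eqVneq j a.-1; [lia|apply: agA; qlia].
- apply: (IH _ _ _ _ _ _ _ _ _ _ _ _ _ x y a e g.-1 HA HA' HB HB' E) => //; try qlia; try lia.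
  by move=> j xj; have [->|ja] := eqVneq j g.-1; [lia|apply: agB1; qlia].
- rewrite ga in Bg; have xa : a <= x.
    by rewrite leqNgt; apply/negP => xa; move: (ncc a.-1); lia.
  by split; [apply: agA | apply: agB1]; qlia.
Qed.

Section Component.

Variables (n s t : nat) (P P' Q Q' : nat -> bool) (rP rP' rQ rQ' : nat -> nat).
Hypotheses (HP : reversal n s P rP) (HP' : reversal n s P' rP').
Hypotheses (HQ : reversal n t Q rQ) (HQ' : reversal n t Q' rQ').
Hypothesis E : forall i, rP' (rP i) = rQ' (rQ i).

(** Since reversals are involutions, the equation says that both pairs define the same map from
    labels to output ranks, a push reversal followed by a pop reversal; [rank_to_label] is the
    inverse map. *)
Lemma label_to_rank k : rQ (rP k) = rQ' (rP' k).
Proof.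
have := E (rP k); rewrite (reversalK _ HP) => /(congr1 rQ').
by rewrite (reversalK _ HQ').
Qed.

Lemma rank_to_label j : rP (rQ j) = rP' (rQ' j).
Proof.
have := label_to_rank (rP (rQ j)); rewrite (reversalK _ HP) (reversalK _ HQ).
by move=> h; rewrite [in RHS]h (reversalK _ HQ') (reversalK _ HP').
Qed.

End Component.

(** In both words the first push block is the longer one. Comparing labels at rank [x] gives
    [p - q = p' - q']; at rank [q.+1] it then gives [rP q2 = p.+1], so the second blocks of [P] and
    [Q] end at the same point. This is a common cut, hence two push blocks cover the component. *)
Lemma component_bound_parallel n s t P P' Q Q' rP rP' rQ rQ' x y p p' q q' :
  reversal n s P rP -> reversal n s P' rP' ->
  reversal n t Q rQ -> reversal n t Q' rQ' ->
  (forall i, rP' (rP i) = rQ' (rQ i)) ->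
  block P x p -> block P' x p' -> block Q x q -> block Q' x q' ->
  (forall i, x <= i < y -> P i || Q i) -> ~~ P y ->
  p < y -> q < p -> q' < p' -> q < q' -> y - x < s + s.
Proof.
move=> HP HP' HQ HQ' E bP bP' bQ bQ' ncc Py py qp qp' qq.
have R2 := rank_to_label HP HP' HQ HQ' E.
have [xp _ Pp _] := bP; have [xp' _ _ _] := bP'.
have [xq _ Qq _] := bQ; have [xq' _ _ _] := bQ'.
have vP := let: And3 _ h _ := HP in h; have vP' := let: And3 _ h _ := HP' in h.
have vQ := let: And3 _ h _ := HQ in h; have vQ' := let: And3 _ h _ := HQ' in h.
have e1 : x + p - q = x + p' - q'.
  have := R2 x.
  rewrite (vQ x q x bQ) ?(vQ' x q' x bQ'); try qlia.
  by rewrite (vP x p _ bP) ?(vP' x p' _ bP'); qlia.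
have [q2 bQ2] : exists q2, block Q q.+1 q2.
  by apply: block_from; [case: HQ => h _ _; exact: h | rewrite /= Qq].
have [p2 bP2] : exists p2, block P p.+1 p2.
  by apply: block_from; [case: HP => h _ _; exact: h | rewrite /= Pp].
have [qq2 _ Qq2 _] := bQ2; have [pp2 _ Pp2 _] := bP2.
have e2 : rP q2 = p.+1.
  have := R2 q.+1.
  rewrite (vQ _ _ _ bQ2) ?(vQ' x q' _ bQ'); try qlia.
  rewrite (vP' x p' _ bP'); last qlia.
  by rewrite (_ : q.+1 + q2 - q.+1 = q2); [move=> ->; qlia|qlia].
have e3 : q2 = p2.
  by rewrite -(reversalK q2 HP) e2 (vP _ _ _ bP2); qlia.
rewrite {}e3 in Qq2.
have le : y <= p2.
  rewrite leqNgt; apply/negP => lt.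
  have xp2 : x <= p2 < y by qlia.
  by have := ncc p2 xp2; rewrite (negbTE Qq2) (negbTE Pp2).
by case: HP => _ _ sz; have := sz _ _ bP; have := sz _ _ bP2; qlia.
Qed.

(** The longer first block is a push block in one word and a pop block in the other. The second push
    blocks of the two words end together ([g1]), and so do the second pop blocks ([g2]); the values
    [f1] and [f2] then identify the two ends, and again two push blocks reach a common cut. *)
Lemma component_bound_crossed n s t P P' Q Q' rP rP' rQ rQ' x y p p' q q' :
  reversal n s P rP -> reversal n s P' rP' ->
  reversal n t Q rQ -> reversal n t Q' rQ' ->
  (forall i, rP' (rP i) = rQ' (rQ i)) ->
  block P x p -> block P' x p' -> block Q x q -> block Q' x q' ->
  (forall i, x <= i < y -> P i || Q i) -> (forall i, x <= i < y -> P' i || Q' i) ->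
  ~~ P y ->
  p < y -> q' < y -> q < p -> p' < q' -> y - x < s + s.
Proof.
move=> HP HP' HQ HQ' E bP bP' bQ bQ' ncc ncc' Py py qy qp pq.
have R2 := rank_to_label HP HP' HQ HQ' E.
have R3 := label_to_rank HP HQ' E.
have [xp _ Pp _] := bP; have [xp' _ Pp' _] := bP'.
have [xq _ Qq _] := bQ; have [xq' _ Qq' _] := bQ'.
have vP := let: And3 _ h _ := HP in h; have vP' := let: And3 _ h _ := HP' in h.
have vQ := let: And3 _ h _ := HQ in h; have vQ' := let: And3 _ h _ := HQ' in h.
have [q2 bQ2] : exists q2, block Q q.+1 q2.
  by apply: block_from; [case: HQ => h _ _; exact: h | rewrite /= Qq].
have [p2 bP2] : exists p2, block P p.+1 p2.
  by apply: block_from; [case: HP => h _ _; exact: h | rewrite /= Pp].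
have [q2' bQ2'] : exists q2, block Q' q'.+1 q2.
  by apply: block_from; [case: HQ' => h _ _; exact: h | rewrite /= Qq'].
have [p2' bP2'] : exists p2, block P' p'.+1 p2.
  by apply: block_from; [case: HP' => h _ _; exact: h | rewrite /= Pp'].
have [qq2 _ Qq2 _] := bQ2; have [pp2 _ Pp2 _] := bP2.
have [qq2' _ Qq2' _] := bQ2'; have [pp2' _ Pp2' _] := bP2'.
have Qp : Q p by have := ncc p; rewrite (negbTE Pp); apply; qlia.
have Pq : P' q' by have := ncc' q'; rewrite (negbTE Qq') orbF; apply; qlia.
have f1 : rQ p = x + q' - p'.
  have := R3 x; rewrite (vP x p x bP) ?(vP' x p' x bP'); try qlia.
  rewrite !addKn.
  by rewrite (vQ' x q' _ bQ'); qlia.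
have f2 : rP' q' = x + p - q.
  have := R2 x; rewrite (vQ x q x bQ) ?(vQ' x q' x bQ'); try qlia.
  rewrite !addKn.
  by rewrite (vP x p _ bP); qlia.
(* A cut of [P] inside the component is not a cut of [Q], so [p] and [p.+1] have consecutive ranks.
   The same holds for [p'] and [p'.+1] in the other word, whence [p.+1] and [p'.+1] have the same
   rank and therefore the same label. *)
have g1 : p2 = p2'.
  have [a [e [bl i1 i2 i3]]] := reversal_in p HQ.
  have [_ _ ue _] := bl.
  have pe : p < e.
    by rewrite ltn_neqAle; apply/andP; split; [apply: contraNneq ue => <- | qlia].
  have k1 : rQ p.+1 = (rQ p).-1 by rewrite (vQ _ _ _ bl); qlia.
  have k2 : rQ' p'.+1 = (rQ p).-1 by rewrite f1 (vQ' x q' _ bQ'); qlia.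
  have := R2 (rQ p).-1; rewrite -{1}k1 -k2 (reversalK _ HQ) (reversalK _ HQ').
  by rewrite (vP _ _ _ bP2) ?(vP' _ _ _ bP2'); qlia.
have g2 : q2 = q2'.
  have [a [e [bl i1 i2 i3]]] := reversal_in q' HP'.
  have [_ _ ue _] := bl.
  have pe : q' < e.
    by rewrite ltn_neqAle; apply/andP; split; [apply: contraNneq ue => <- | qlia].
  have k1 : rP' q'.+1 = (rP' q').-1 by rewrite (vP' _ _ _ bl); qlia.
  have k2 : rP q.+1 = (rP' q').-1 by rewrite f2 (vP x p _ bP); qlia.
  have := R3 (rP' q').-1; rewrite -{1}k2 -k1 (reversalK _ HP) (reversalK _ HP').
  by rewrite (vQ _ _ _ bQ2) ?(vQ' _ _ _ bQ2'); qlia.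
rewrite -g1 in bP2' Pp2' pp2'; rewrite -g2 in bQ2' Qq2' qq2'.
have h1 : q' <= p2.
  rewrite leqNgt; apply/negP => lt.
  have := reversal_cut q' HP' Pp2'; rewrite f2; qlia.
have h2 : p <= q2.
  rewrite leqNgt; apply/negP => lt.
  have := reversal_cut p HQ Qq2; rewrite f1; qlia.
move: f1 f2; rewrite (vQ _ _ _ bQ2) ?(vP' _ _ _ bP2'); try qlia.
move=> f1 f2; have pq2 : p2 = q2 by qlia.
rewrite -pq2 in Qq2.
have le : y <= p2.
  rewrite leqNgt; apply/negP => lt.
  have xp2 : x <= p2 < y by qlia.
  by have := ncc p2 xp2; rewrite (negbTE Qq2) (negbTE Pp2).
by case: HP => _ _ sz; have := sz _ _ bP; have := sz _ _ bP2; qlia.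
Qed.

(** When no first block fills the component, the order of [p, q] and of [p', q'] decides between the
    parallel and the crossed case; the remaining orders follow by exchanging the two words or by
    exchanging pushes and pops, which turns [2s] into [2t]. *)
Lemma component_bound n s t P P' Q Q' rP rP' rQ rQ' x y :
  reversal n s P rP -> reversal n s P' rP' ->
  reversal n t Q rQ -> reversal n t Q' rQ' ->
  (forall i, rP' (rP i) = rQ' (rQ i)) ->
  block (fun i => P i || Q i) x y -> block (fun i => P' i || Q' i) x y ->
  (forall z, block P x z -> ~ block P' x z) ->
  (forall z, block Q x z -> ~ block Q' x z) ->
  y - x < (s + t).*2.
Proof.
move=> HP HP' HQ HQ' E [xy cx cy ncc] [_ cx' cy' ncc'] nP nQ.
have [Py Qy] : ~~ P y /\ ~~ Q y by apply/andP; rewrite -negb_or.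
have [Py' Qy'] : ~~ P' y /\ ~~ Q' y by apply/andP; rewrite -negb_or.
have [Px Qx] : ((x == 0) || ~~ P x.-1) /\ ((x == 0) || ~~ Q x.-1).
  by move: cx; case: (x == 0) => //=; rewrite negb_or => /andP.
have [Px' Qx'] : ((x == 0) || ~~ P' x.-1) /\ ((x == 0) || ~~ Q' x.-1).
  by move: cx'; case: (x == 0) => //=; rewrite negb_or => /andP.
have [p bP] : exists p, block P x p by apply: block_from Px; case: HP => h _ _; exact: h.
have [p' bP'] : exists p, block P' x p by apply: block_from Px'; case: HP' => h _ _; exact: h.
have [q bQ] : exists q, block Q x q by apply: block_from Qx; case: HQ => h _ _; exact: h.
have [q' bQ'] : exists q, block Q' x q by apply: block_from Qx'; case: HQ' => h _ _; exact: h.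
have pp : p <> p' by move=> e; apply: (nP p) => //; rewrite e.
have qq : q <> q' by move=> e; apply: (nQ q) => //; rewrite e.
have szP : p - x < s by case: HP => _ _; apply.
have szP' : p' - x < s by case: HP' => _ _; apply.
have szQ : q - x < t by case: HQ => _ _; apply.
have szQ' : q' - x < t by case: HQ' => _ _; apply.
have py := block_le bP xy Py; have py' := block_le bP' xy Py'.
have qy := block_le bQ xy Qy; have qy' := block_le bQ' xy Qy'.
have [ep|{}py] : p = y \/ p < y by qlia.
  by qlia.
have [ep|{}py'] : p' = y \/ p' < y by qlia.
  by qlia.
have [ep|{}qy] : q = y \/ q < y by qlia.
  by qlia.
have [ep|{}qy'] : q' = y \/ q' < y by qlia.
  by qlia.
have pq : p <> q.
  move=> e; have [xp _ Pp _] := bP; have [_ _ Qq _] := bQ; rewrite -e in Qq.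
  have := ncc p; rewrite (negbTE Pp) (negbTE Qq) xp py => /(_ isT); done.
have pq' : p' <> q'.
  move=> e; have [xp _ Pp _] := bP'; have [_ _ Qq _] := bQ'; rewrite -e in Qq.
  have := ncc' p'; rewrite (negbTE Pp) (negbTE Qq) xp py' => /(_ isT); done.
have nccQ : forall i, x <= i < y -> Q i || P i by move=> i /ncc; rewrite orbC.
have nccQ' : forall i, x <= i < y -> Q' i || P' i by move=> i /ncc'; rewrite orbC.
have E1 : forall i, rQ' (rQ i) = rP' (rP i) by [].
have E2 : forall i, rP (rP' i) = rQ (rQ' i).
  move=> i; have := E (rP (rP' i)).
  rewrite (reversalK _ HP) (reversalK _ HP') => /(congr1 rQ') /(congr1 rQ).
  by rewrite (reversalK _ HQ') (reversalK _ HQ) => ->.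
have E3 : forall i, rQ (rQ' i) = rP (rP' i) by [].
suff: y - x < s + s \/ y - x < t + t by qlia.
have [lt|lt] : q < p \/ p < q by qlia.
- have [lt'|lt'] : q' < p' \/ p' < q' by qlia.
  + have [l|l] : q < q' \/ q' < q by qlia.
      by left; exact: (component_bound_parallel HP HP' HQ HQ' E bP bP' bQ bQ' ncc Py py).
    by left; exact: (component_bound_parallel HP' HP HQ' HQ E2 bP' bP bQ' bQ ncc' Py' py').
  + by left; exact: (component_bound_crossed HP HP' HQ HQ' E bP bP' bQ bQ' ncc ncc' Py py qy').
- have [lt'|lt'] : q' < p' \/ p' < q' by qlia.
  + by left; exact: (component_bound_crossed HP' HP HQ' HQ E2 bP' bP bQ' bQ ncc' ncc Py' py' qy).
  + have [l|l] : p < p' \/ p' < p by qlia.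
      by right; exact: (component_bound_parallel HQ HQ' HP HP' E1 bQ bQ' bP bP' nccQ Qy qy).
    by right; exact: (component_bound_parallel HQ' HQ HP' HP E3 bQ' bQ bP' bP nccQ' Qy' qy').
Qed.

(** A common cut of [P] and [Q] is respected by the map from labels to ranks, so by
    [shared_block_across] the other pair can pass over it only with a push block that is also a pop
    block. *)
Lemma double_block_of_common_cut n s t P P' Q Q' rP rP' rQ rQ' c :
  reversal n s P rP -> reversal n s P' rP' ->
  reversal n t Q rQ -> reversal n t Q' rQ' ->
  (forall i, rP' (rP i) = rQ' (rQ i)) ->
  ~~ P c -> ~~ Q c -> P' c || Q' c ->
  exists a b, [/\ a <= c < b, block P' a b & block Q' a b].
Proof.
move=> HP HP' HQ HQ' E Pc Qc /orP[Pc'|Qc'].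
  apply: (shared_block_across HP' HQ') => // i.
  by rewrite -(label_to_rank HP HQ' E) (reversal_cut _ HQ Qc) (reversal_cut _ HP Pc).
have [|a [b [? ? ?]]] := shared_block_across HQ' HP' (c := c) _ Qc'.
  by move=> i; rewrite -(rank_to_label HP HP' HQ HQ' E) (reversal_cut _ HP Pc) (reversal_cut _ HQ Qc).
by exists a, b; split.
Qed.

(* If a component starts or ends with a block common to [P] and [P'], the
   equation forces agreement on all of it. *)
Lemma component_agree n s t P P' Q Q' rP rP' rQ rQ' x y z :
  reversal n s P rP -> reversal n s P' rP' ->
  reversal n t Q rQ -> reversal n t Q' rQ' ->
  (forall i, rP' (rP i) = rQ' (rQ i)) ->
  block (fun i => P i || Q i) x y -> block (fun i => P' i || Q' i) x y ->
  (block P x z /\ block P' x z) \/ (block P z y /\ block P' z y) ->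
  forall i, x <= i < y -> P i = P' i /\ Q i = Q' i.
Proof.
move=> HP HP' HQ HQ' E [xy cx cy ncc] [_ cx' cy' ncc'].
case=> [[bP bP']|[bP bP']].
- have [_ Qx] : ((x == 0) || ~~ P x.-1) /\ ((x == 0) || ~~ Q x.-1).
    by move: cx; case: (x == 0) => //=; rewrite negb_or => /andP.
  have [_ Qx'] : ((x == 0) || ~~ P' x.-1) /\ ((x == 0) || ~~ Q' x.-1).
    by move: cx'; case: (x == 0) => //=; rewrite negb_or => /andP.
  have [xz _ _ cP] := bP; have [_ _ _ cP'] := bP'.
  apply: (agree_right (k := y) HP HP' HQ HQ' E ncc bP bP' (f := x)) => //; try qlia.
  by move=> i xi; rewrite cP ?cP'.
- have [_ Qy] : ~~ P y /\ ~~ Q y by apply/andP; rewrite -negb_or.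
  have [_ Qy'] : ~~ P' y /\ ~~ Q' y by apply/andP; rewrite -negb_or.
  have [xz _ _ cP] := bP; have [_ _ _ cP'] := bP'.
  apply: (agree_left (k := y) HP HP' HQ HQ' E ncc bP bP' (f := y)) => //; try qlia.
  by move=> i xi; rewrite cP ?cP'.
Qed.

(** * Block reversal along a list of block sizes *)

Fixpoint brev (sz : seq nat) (i : nat) : nat :=
  if sz is a :: sz' then
    if i < a then a.-1 - i else a + brev sz' (i - a)
  else i.

(* Entry [i] tells whether [i - 1] and [i] lie in the same block. *)
Definition uflags (sz : seq nat) : seq bool :=
  flatten [seq false :: nseq a.-1 true | a <- sz].

Definition unc (sz : seq nat) (c : nat) : bool := nth false (uflags sz) c.+1.

Definition sizes_in (b : nat) (sz : seq nat) : bool := all (fun a => 0 < a <= b) sz.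

Lemma size_uflags b sz : sizes_in b sz -> size (uflags sz) = sumn sz.
Proof.
rewrite /sizes_in /uflags; elim: sz => //= a sz IH /andP[a0 /IH e].
by rewrite size_cat size_nseq e; lia.
Qed.

Lemma unc_cons a sz c : 0 < a ->
  unc (a :: sz) c =
  if c.+1 < a then true else if c.+1 == a then false else unc sz (c - a).
Proof.
move=> a0; rewrite /unc /uflags /= -/(uflags sz) nth_cat size_nseq nth_nseq.
have -> : (c < a.-1) = (c.+1 < a) by lia.
case: (ltnP c.+1 a) => h //=; case: (eqVneq c.+1 a) => [e|ne].
  rewrite (_ : c - a.-1 = 0); last lia.
  by case: sz => //= b sz.
by congr nth; lia.
Qed.

Lemma unc_ge b sz c : sizes_in b sz -> sumn sz <= c.+1 -> unc sz c = false.
Proof. by move=> h; rewrite -(size_uflags h) => le; rewrite /unc nth_default. Qed.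

Lemma block_unc_cons a sz x y : 0 < a -> block (unc (a :: sz)) x y ->
  (x = 0 /\ y = a.-1) \/ [/\ a <= x, a <= y & block (unc sz) (x - a) (y - a)].
Proof.
move=> a0 [xy cx cy cu]; have [xa|ax] := ltnP x a.
  left.
  have x0 : x = 0.
    case: x xy cx cu xa => // x xy /= cx cu xa.
    by move: cx; rewrite unc_cons // xa.
  subst x; split=> //.
  have h1 : a.-1 <= y.
    rewrite leqNgt; apply/negP => lt.
    by move: cy; rewrite unc_cons // (_ : y.+1 < a) //; lia.
  case: (ltngtP y a.-1) => // lt; first lia.
  have := cu a.-1; rewrite unc_cons // prednK // ltnn eqxx /= => H; by have : false by apply: H; lia.
right; split=> //; first lia.
split=> [|||c h].
- lia.
- case: eqP => //= ne.
  move: cx; rewrite (_ : (x == 0) = false) /=; last lia.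
  rewrite unc_cons // (_ : x.-1.+1 < a = false); last lia.
  rewrite (_ : x.-1.+1 == a = false); last lia.
  by rewrite (_ : (x - a).-1 = x.-1 - a) //; lia.
- move: cy; rewrite unc_cons // (_ : y.+1 < a = false); last lia.
  by rewrite (_ : y.+1 == a = false) //; lia.
- have := cu (a + c); rewrite unc_cons // (_ : (a + c).+1 < a = false); last lia.
  rewrite (_ : (a + c).+1 == a = false); last lia.
  by rewrite addKn => -> //; lia.
Qed.

Lemma reversal_brev b sz : 0 < b -> sizes_in b sz ->
  reversal (sumn sz) b (unc sz) (brev sz).
Proof.
move=> b0 h; split=> [c|x y k|x y]; first exact: (unc_ge h).
- elim: sz h x y k => [|a sz IH] h x y k.
    move=> [xy _ _ cu] xk; case: (ltngtP x y) => e; [|lia|subst; rewrite /=; lia].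
    by have := cu x; rewrite /unc /= => /(_ _); lia.
  case/andP: h => /andP[a0 ab] h /(block_unc_cons a0) [[-> ->] xk|[ax ay bl] xk].
    by rewrite /= (_ : k < a = true); lia.
  rewrite /= (_ : k < a = false); last lia.
  by rewrite (IH h _ _ (k - a) bl); lia.
- elim: sz h x y => [|a sz IH] h x y.
    move=> [xy _ _ cu]; case: (ltngtP x y) => e; [|lia|lia].
    by have := cu x; rewrite /unc /= => /(_ _); lia.
  case/andP: h => /andP[a0 ab] h /(block_unc_cons a0) [[-> ->]|[ax ay bl]]; first lia.
  by have := IH h _ _ bl; lia.
Qed.

(** A window cut at both ends is a union of blocks, so the reversal inside it can be computed from
    the window alone. *)
Lemma reversal_shift n b u r m b' v r' x i :
  reversal n b u r -> reversal m b' v r' ->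
  (x == 0) || ~~ u x.-1 -> ~~ u (x + m.-1) ->
  (forall i, i.+1 < m -> v i = u (x + i)) -> i < m -> r (x + i) = x + r' i.
Proof.
move=> Hu Hv cx cm vu im.
have [a [e [bl ai _ ->]]] := reversal_in i Hv.
have vm : ~~ v m.-1 by case: Hv => -> //; lia.
have em : e <= m.-1 by apply: (block_le bl) => //; lia.
have [ae ca ce cu] := bl.
have bl' : block u (x + a) (x + e).
  split=> [|||c h].
  - lia.
  - case: a ai ae ca {bl cu} => [|a] ai ae ca; first by rewrite addn0.
    by rewrite addnS /= -vu //; lia.
  - have [->//|ne] := eqVneq e m.-1; rewrite -vu //; lia.
  - rewrite (_ : c = x + (c - x)); last lia.
    by rewrite -vu; [apply: cu|]; lia.
by case: Hu => _ /(_ _ _ (x + i) bl') -> //; lia.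
Qed.

Definition incr_head (s : seq nat) := if s is a :: s' then a.+1 :: s' else [::].

(** Inverse of [uflags] on nonempty lists, applied to the inner gaps only: the leading [false] of
    [uflags] has been dropped. *)
Fixpoint block_sizes (bs : seq bool) : seq nat :=
  match bs with
  | [::] => [:: 1]
  | true :: bs' => incr_head (block_sizes bs')
  | false :: bs' => 1 :: block_sizes bs'
  end.

Lemma uflagsK b sz : sizes_in b sz -> sz != [::] ->
  block_sizes (behead (uflags sz)) = sz.
Proof.
elim: sz => // a sz IH /andP[/andP[a0 _] h] _.
rewrite /= -/(uflags sz); case: a a0 => // a _ /=.
elim: a => [|a IHa] /=; last by rewrite IHa.
by case: sz h IH => //= c sz h IH; rewrite -[in RHS]IH.
Qed.

Lemma head_uflags sz : head false (uflags sz) = false.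
Proof. by case: sz. Qed.

Lemma uflags_inj b b' sz sz' : sizes_in b sz -> sizes_in b' sz' ->
  uflags sz = uflags sz' -> sz = sz'.
Proof.
move=> h h' e.
case: sz h e => [|a sz] h e; case: sz' h' e => [|a' sz'] h' e //=.
by rewrite -(uflagsK h) // -(uflagsK h') // e.
Qed.

Lemma unc_inj b b' sz sz' : sizes_in b sz -> sizes_in b' sz' ->
  sumn sz = sumn sz' -> (forall c, c.+1 < sumn sz -> unc sz c = unc sz' c) -> sz = sz'.
Proof.
move=> h h' e u; apply: (uflags_inj h h').
apply: (@eq_from_nth _ false); first by rewrite (size_uflags h) (size_uflags h').
move=> [|i]; rewrite (size_uflags h) => lt; last exact: u.
by rewrite !nth0 !head_uflags.
Qed.

Lemma brev_lt sz i : i < sumn sz -> brev sz i < sumn sz.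
Proof.
elim: sz i => //= a sz IH i lt; case: (ltnP i a) => h; first lia.
have lt' : i - a < sumn sz by lia.
by have := IH _ lt'; lia.
Qed.

Lemma brev_cat sz1 sz2 i : brev (sz1 ++ sz2) i =
  if i < sumn sz1 then brev sz1 i else sumn sz1 + brev sz2 (i - sumn sz1).
Proof.
elim: sz1 i => [|a sz1 IH] i /=; first by rewrite subn0.
have [ia|ai] := ltnP i a; first by rewrite (_ : i < a + _ = true) //; lia.
rewrite IH (_ : (i - a < _) = (i < a + sumn sz1)); last lia.
by case: ifP => // h; rewrite addnA subnDA.
Qed.

(** * Words, heights and the matching of a Dyck path *)

Fixpoint hrun (h : nat) (w : seq op) : option nat :=
  match w with
  | [::] => Some h
  | Push a :: w' => hrun (h + a) w'
  | Pop b :: w' => if b <= h then hrun (h - b) w' else None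
  end.

Definition push_sizes (w : seq op) : seq nat :=
  pmap (fun o => if o is Push a then Some a else None) w.
Definition pop_sizes (w : seq op) : seq nat :=
  pmap (fun o => if o is Pop b then Some b else None) w.

Definition op_in (s t : nat) (o : op) : bool :=
  match o with Push a => 0 < a <= s | Pop b => 0 < b <= t end.

Lemma total_pushE w : total_push w = sumn (push_sizes w).
Proof. by rewrite /total_push; elim: w => //= -[a|b] w /= ->. Qed.

Lemma total_popE w : total_pop w = sumn (pop_sizes w).
Proof. by rewrite /total_pop; elim: w => //= -[a|b] w /= ->. Qed.

Lemma push_sizes_cat w1 w2 : push_sizes (w1 ++ w2) = push_sizes w1 ++ push_sizes w2.
Proof. exact: pmap_cat. Qed.

Lemma pop_sizes_cat w1 w2 : pop_sizes (w1 ++ w2) = pop_sizes w1 ++ pop_sizes w2.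
Proof. exact: pmap_cat. Qed.

Lemma sizes_in_push s t w : all (op_in s t) w -> sizes_in s (push_sizes w).
Proof. by elim: w => //= -[a|b] w IH /= /andP[h /IH]; rewrite /sizes_in /= ?h. Qed.

Lemma sizes_in_pop s t w : all (op_in s t) w -> sizes_in t (pop_sizes w).
Proof. by elim: w => //= -[a|b] w IH /= /andP[h /IH]; rewrite /sizes_in /= ?h. Qed.

Lemma hrun_cat h w1 w2 : hrun h (w1 ++ w2) = obind (hrun^~ w2) (hrun h w1).
Proof. by elim: w1 h => //= -[a|b] w1 IH h //=; case: ifP. Qed.

Lemma hrun_total h w k : hrun h w = Some k ->
  h + sumn (push_sizes w) = k + sumn (pop_sizes w).
Proof.
elim: w h => [|[a|b] w IH] h /=; first by case=> ->.
  by move/IH; lia.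
by case: ifP => // bh /IH; lia.
Qed.

Lemma hrun_add h w k d : hrun h w = Some k -> hrun (h + d) w = Some (k + d).
Proof.
elim: w h => [|[a|b] w IH] h /=; first by case=> ->.
  by move/IH; rewrite addnAC.
case: ifP => // bh /IH e; rewrite (_ : b <= h + d); last lia.
by rewrite -addnBAC.
Qed.

Lemma well_formedP s t w : all (op_in s t) w ->
  (well_formed w <-> hrun 0 w = Some 0).
Proof.
move=> al.
have pos : all op_pos w by apply: sub_all al => -[a|b] /= /andP[].
have prefix h : (exists k, hrun h w = Some k) <->
    forall k, total_pop (take k w) <= h + total_push (take k w).
  rewrite /total_pop /total_push.
  elim: w h {al pos} => [|[a|b] w IH] h /=.
  - by split=> _ // ; exists h.
  - split=> [/IH H [|k] //=|H]; first by have := H k; rewrite add0n addnA.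
    by apply/IH => k; have := H k.+1; rewrite /= add0n addnA.
  - split=> [|H].
      case: ifP => [bh /IH H [|k] //=|_ []//].
      by have := H k; lia.
    have := H 1; rewrite /= take0 /= !addn0 => bh; rewrite bh.
    by apply/IH => k; have := H k.+1 => /=; lia.
split=> [[_ H e]|e].
  have [k hk] : exists k, hrun 0 w = Some k by apply/prefix.
  by have := hrun_total hk; move: e; rewrite hk total_pushE total_popE => ->; rewrite add0n => ?; congr Some; lia.
split=> //; first by apply/(prefix 0); exists 0.
by rewrite total_pushE total_popE; have := hrun_total e.
Qed.

Definition shape (w : seq op) : seq bool :=
  flatten [seq match o with Push a => nseq a true | Pop b => nseq b false end | o <- w].

Definition ustate := (seq nat * seq nat * seq nat * seq nat)%type.

(* [(st, dl, ru, rd)]: open ups, matched ups in the order of their downs, the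
   number of downs before each up, and the number of ups before each down. *)
Definition ustep (c : ustate) (b : bool) : ustate :=
  let: (st, dl, ru, rd) := c in
  if b then (size ru :: st, dl, rcons ru (size dl), rd)
  else if st is z :: st' then (st', rcons dl z, ru, rcons rd (size ru)) else c.

Definition match_run (S : seq bool) : ustate := foldl ustep ([::], [::], [::], [::]) S.

(** Both sides of [(nth 0 ru c <= j) = (c < nth 0 rd j)] say that up [c] comes before down [j] on
    the path. The last two clauses say that an up precedes its down, and that two arcs are disjoint
    or nested. *)
Definition uinv (c : ustate) : Prop :=
  let: (st, dl, ru, rd) := c in
  [/\ [/\ size rd = size dl, uniq (st ++ dl), sorted gtn st
        & forall x, (x \in st ++ dl) = (x < size ru)],
      [/\ all (fun k => k <= size dl) ru, all (fun k => k <= size ru) rd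
        & forall c j, c < size ru -> j < size dl ->
          (nth 0 ru c <= j) = (c < nth 0 rd j)],
      forall x, x \in dl -> nth 0 ru x <= index x dl
    & forall c c', c < c' -> c' < size ru -> c \in dl ->
        index c dl < nth 0 ru c' \/ (c' \in dl /\ index c' dl < index c dl)].

Lemma uinv_step c b : uinv c -> uinv (ustep c b).
Proof.
case: c => [[[st dl] ru] rd] /= [[I1 I2 I3 I4] [G1 G2 G3] O NC].
case: b.
- have nst : size ru \notin st ++ dl by rewrite I4 ltnn.
  rewrite /uinv /=; split; first split=> //=.
  + by rewrite nst.
  + rewrite path_sortedE; last by move=> x y z /=; lia.
    rewrite I3 andbT; apply/allP => x xs /=.
    by have := I4 x; rewrite mem_cat xs /= => <-.
  + by move=> x; rewrite size_rcons inE I4; lia.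
  + split=> [||c j]; rewrite ?all_rcons ?leqnn //= ?size_rcons.
      by apply: sub_all G2 => x; lia.
    rewrite ltnS nth_rcons => cu jd; case: (ltngtP c (size ru)) cu => // [lt _|->]; first exact: G3.
    symmetry; rewrite (leqNgt (size dl)) jd /=; apply: negbTE; rewrite -leqNgt.
    by move/all_nthP: G2; apply; rewrite I1.
  + move=> x xd; have xu : x < size ru by rewrite -I4 mem_cat xd orbT.
    by rewrite nth_rcons xu O.
  + move=> c c' cc; rewrite size_rcons ltnS => cu cd.
    rewrite nth_rcons; case: (ltngtP c' (size ru)) cu => // [lt _|-> _]; first exact: NC.
    by left; rewrite index_mem.
- case: st I2 I3 I4 => [//|z st] I2 I3 I4; rewrite /uinv.
  have zst : z \notin st ++ dl by case/andP: I2.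
  have zdl : z \notin dl by move: zst; rewrite mem_cat negb_or => /andP[].
  have zu : z < size ru by rewrite -I4 inE eqxx.
  have mst x : (x \in st ++ rcons dl z) = (x < size ru).
    by rewrite -I4 mem_cat mem_rcons inE /= in_cons mem_cat; do !case: (_ \in _); rewrite ?orbT.
  have idx x : index x (rcons dl z) = if x \in dl then index x dl
      else if x == z then size dl else (size dl).+1.
    by rewrite -cats1 index_cat /= eq_sym; case: ifP => // _; case: ifP; rewrite ?addn0 ?addn1.
  split; first split=> //=.
  + by rewrite !size_rcons I1.
  + by rewrite -cats1 catA cats1 rcons_uniq zst; case/andP: I2.
  + exact: path_sorted I3.
  + split=> [||c j]; rewrite ?all_rcons ?size_rcons //=.
    * by apply: sub_all G1 => x; lia.
    * by rewrite leqnn.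
    rewrite nth_rcons I1 ltnS => cu jd; case: (ltngtP j (size dl)) jd => // [lt _|-> _]; first exact: G3.
    by rewrite cu; move/all_nthP: G1; apply.
  + move=> x; rewrite mem_rcons inE idx => /orP[/eqP->|xd]; last by rewrite xd O.
    by rewrite (negbTE zdl) eqxx; move/all_nthP: G1; apply.
  + move=> c c' cc cu; rewrite mem_rcons inE !idx => /orP[/eqP e|cd]; last first.
      rewrite cd; case: (NC c c' cc cu cd) => [|[cd' lt]]; first by left.
      by right; rewrite mem_rcons inE cd' orbT.
    subst c; right.
    (* The up [z] being matched is the largest open one, because the stack is decreasing; so a later
       up [c'] is matched already. *)
    have cd' : c' \in dl.
      have := mst c'; rewrite cu mem_cat mem_rcons inE => /or3P[cs|/eqP|//]; last lia.
      move: I3; rewrite /= path_sortedE; last by move=> x y w /=; lia.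
      by case/andP => /allP/(_ _ cs) /=; lia.
    by rewrite mem_rcons inE cd' orbT (negbTE zdl) eqxx index_mem.
Qed.

Lemma uinv_run S : uinv (match_run S).
Proof.
rewrite /match_run.
have : uinv ([::], [::], [::], [::]) by split.
move: (([::], _, _, _) : ustate) => c.
by elim: S c => //= b S IH c /(uinv_step b) /IH.
Qed.

Lemma ustep_pushes a st dl ru rd :
  foldl ustep (st, dl, ru, rd) (nseq a true) =
  (rev (iota (size ru) a) ++ st, dl, ru ++ nseq a (size dl), rd).
Proof.
elim: a st ru => [|a IH] st ru /=; first by rewrite cats0.
by rewrite IH size_rcons rev_cons cat_rcons cat_rcons.
Qed.

Lemma ustep_pops b st dl ru rd : b <= size st ->
  foldl ustep (st, dl, ru, rd) (nseq b false) =
  (drop b st, dl ++ take b st, ru, rd ++ nseq b (size ru)).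
Proof.
elim: b st dl rd => [|b IH] [|z st] dl rd //= h; rewrite ?cats0 // ?take0 ?drop0 ?cats0 //.
by rewrite IH // !cat_rcons.
Qed.

Fixpoint downs_before (k : nat) (w : seq op) : seq nat :=
  match w with
  | [::] => [::]
  | Push a :: w' => nseq a k ++ downs_before k w'
  | Pop b :: w' => downs_before (k + b) w'
  end.

Fixpoint ups_before (k : nat) (w : seq op) : seq nat :=
  match w with
  | [::] => [::]
  | Push a :: w' => ups_before (k + a) w'
  | Pop b :: w' => nseq b k ++ ups_before k w'
  end.

Lemma size_downs_before k w : size (downs_before k w) = sumn (push_sizes w).
Proof. by elim: w k => //= -[a|b] w IH k //=; rewrite size_cat size_nseq IH. Qed.

Lemma size_ups_before k w : size (ups_before k w) = sumn (pop_sizes w).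
Proof. by elim: w k => //= -[a|b] w IH k //=; rewrite size_cat size_nseq IH. Qed.

Lemma downs_before_cat k w1 w2 : downs_before k (w1 ++ w2) =
  downs_before k w1 ++ downs_before (k + sumn (pop_sizes w1)) w2.
Proof.
elim: w1 k => [|[a|b] w1 IH] k /=; first by rewrite addn0.
  by rewrite IH catA.
by rewrite IH addnA.
Qed.

Lemma ups_before_cat k w1 w2 : ups_before k (w1 ++ w2) =
  ups_before k w1 ++ ups_before (k + sumn (push_sizes w1)) w2.
Proof.
elim: w1 k => [|[a|b] w1 IH] k /=; first by rewrite addn0.
  by rewrite IH addnA.
by rewrite IH catA.
Qed.

Lemma unc_downs_before b k w c : sizes_in b (push_sizes w) -> unc (push_sizes w) c ->
  nth 0 (downs_before k w) c = nth 0 (downs_before k w) c.+1.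
Proof.
elim: w k c => [|[a|a] w IH] k c //=; last exact: IH.
move=> /andP[/andP[a0 _] h]; rewrite unc_cons // !nth_cat !size_nseq !nth_nseq.
have [lt|le] := ltnP c.+1 a; first by rewrite (_ : c < a) //; lia.
case: eqVneq => // ne u; rewrite (_ : c < a = false); last lia.
by rewrite (IH _ _ h u); congr nth; lia.
Qed.

Lemma unc_ups_before b k w c : sizes_in b (pop_sizes w) -> unc (pop_sizes w) c ->
  nth 0 (ups_before k w) c = nth 0 (ups_before k w) c.+1.
Proof.
elim: w k c => [|[a|a] w IH] k c //=; first exact: IH.
move=> /andP[/andP[a0 _] h]; rewrite unc_cons // !nth_cat !size_nseq !nth_nseq.
have [lt|le] := ltnP c.+1 a; first by rewrite (_ : c < a) //; lia.
case: eqVneq => // ne u; rewrite (_ : c < a = false); last lia.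
by rewrite (IH _ _ h u); congr nth; lia.
Qed.

Definition open_ups (c : ustate) := c.1.1.1.
Definition matched_ups (c : ustate) := c.1.1.2.
Definition run (w : seq op) : ustate := match_run (shape w).

Lemma match_run_cat S1 S2 : match_run (S1 ++ S2) = foldl ustep (match_run S1) S2.
Proof. exact: foldl_cat. Qed.

Lemma shape_cat w1 w2 : shape (w1 ++ w2) = shape w1 ++ shape w2.
Proof. by rewrite /shape map_cat flatten_cat. Qed.

Lemma foldl_shape w st dl ru rd h : hrun (size st) w = Some h ->
  exists st' e, [/\ foldl ustep (st, dl, ru, rd) (shape w) =
      (st', dl ++ e, ru ++ downs_before (size dl) w, rd ++ ups_before (size ru) w),
    size st' = h & size e = sumn (pop_sizes w)].
Proof.
elim: w st dl ru rd => [|[a|b] w IH] st dl ru rd /=.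
- by case=> <-; exists st, [::]; rewrite !cats0.
- move=> hr; rewrite foldl_cat ustep_pushes.
  have [|st' [e [E h1 h2]]] := IH (rev (iota (size ru) a) ++ st) dl (ru ++ nseq a (size dl)) rd.
    by rewrite size_cat size_rev size_iota addnC.
  by exists st', e; rewrite E -catA size_cat size_nseq.
- case: ifP => // bs hr; rewrite foldl_cat ustep_pops //.
  have [|st' [e [E h1 h2]]] := IH (drop b st) (dl ++ take b st) ru (rd ++ nseq b (size ru)).
    by rewrite size_drop.
  exists st', (take b st ++ e); rewrite E -!catA !size_cat size_takel //.
  by split=> //; rewrite h2.
Qed.

Lemma run_ok w h : hrun 0 w = Some h -> exists st dl,
  [/\ run w = (st, dl, downs_before 0 w, ups_before 0 w), size st = h
    & size dl = sumn (pop_sizes w)].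
Proof. by move=> /(@foldl_shape w [::] [::] [::] [::] h) [st [dl H]]; exists st, dl. Qed.

(* The word acts on slots (positions of the Dyck path); the label of a slot is
   its image under the reversal of the push blocks, and the output order is the
   order of the downs up to the reversal of the pop blocks. *)
Lemma output_slots s t W : all (op_in s t) W -> hrun 0 W = Some 0 ->
  rev (output W) = [seq (brev (push_sizes W) (nth 0 (matched_ups (run W)) (brev (pop_sizes W) j))).+1
                   | j <- iota 0 (op_size W)].
Proof.
move=> al hW; set n := op_size W; set lab := fun c => (brev (push_sizes W) c).+1.
(* Labels are determined by the push blocks of all of [W], so the induction is over the prefixes of
   a fixed [W]. *)
suff main w1 w2 : W = w1 ++ w2 ->
  foldl step (iota 1 n, [::], [::]) w1 =
  (iota (sumn (push_sizes w1)).+1 (n - sumn (push_sizes w1)),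
   [seq lab c | c <- open_ups (run w1)],
   rev [seq lab (nth 0 (matched_ups (run w1)) (brev (pop_sizes w1) j))
       | j <- iota 0 (sumn (pop_sizes w1))]).
  have := main W [::]; rewrite cats0 /output => -> //=.
  rewrite revK; congr (map _ (iota 0 _)).
  by have := hrun_total hW; rewrite /n /op_size total_pushE.
elim/last_ind: w1 w2 => [|w1 o IH] w2 eW; first by rewrite /= subn0.
have eW' : W = w1 ++ o :: w2 by rewrite eW cat_rcons.
rewrite foldl_rcons (IH _ eW') {IH}.
have [h hr] : exists h, hrun 0 w1 = Some h.
  by move: hW; rewrite eW' hrun_cat; case: (hrun 0 w1) => // h _; exists h.
have [st [dl [E hs hd]]] := run_ok hr.
have tot : sumn (push_sizes W) = n by rewrite /n /op_size total_pushE.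
have ru_rcons : run (rcons w1 o) = foldl ustep (run w1)
    (match o with Push a => nseq a true | Pop b => nseq b false end).
  by rewrite /run -cats1 shape_cat match_run_cat /shape /= cats0.
have ho : all (op_in s t) [:: o] by move: al; rewrite eW' all_cat /= => /and3P[_ ->].
case: o eW eW' ru_rcons ho => [a|b] eW eW' ru_rcons /= /andP[/andP[p0 ps] _].
- rewrite ru_rcons E ustep_pushes -cats1 push_sizes_cat pop_sizes_cat /open_ups /matched_ups /= cats0 sumn_cat /= addn0.
  have an : sumn (push_sizes w1) + a <= n.
    by rewrite -tot eW' push_sizes_cat sumn_cat /=; lia.
  congr (_, _, _).
  + by rewrite drop_iota subnDA addSn.
  + rewrite take_iota (_ : minn a _ = a); last lia.
    rewrite map_cat; congr (_ ++ _).
    rewrite size_downs_before.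
    apply: (@eq_from_nth _ 0); first by rewrite size_map size_rev !size_iota.
    move=> i; rewrite size_iota => ia; rewrite nth_iota //.
    rewrite (nth_map 0) ?size_rev ?size_iota // nth_rev size_iota // nth_iota; last lia.
    rewrite /lab eW' push_sizes_cat brev_cat (_ : _ < _ = false) /=; last lia.
    by rewrite (_ : _ - _ < a); lia.
- have hb : b <= size st.
    move: hW; rewrite eW' hrun_cat hr /= hs; case: ifP => //.
  rewrite ru_rcons E ustep_pops // -cats1 push_sizes_cat pop_sizes_cat /open_ups /matched_ups /= cats0 sumn_cat /= addn0.
  congr (_, _, _); first by rewrite map_drop.
  rewrite iotaD map_cat rev_cat; congr (_ ++ _).
    apply: (@eq_from_nth _ 0).
      by rewrite size_takel ?size_map // size_rev size_map size_iota.
    move=> i; rewrite size_takel ?size_map // => ib.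
    rewrite nth_take // (nth_map 0); last lia.
    rewrite nth_rev ?size_map ?size_iota // (nth_map 0) ?size_iota; last lia.
    rewrite nth_iota; last lia.
    rewrite brev_cat (_ : _ < _ = false) /=; last lia.
    rewrite (_ : _ - _ < b); last lia.
    rewrite nth_cat hd (_ : _ < _ = false); last lia.
    rewrite nth_take; last lia.
    by congr (lab (nth _ _ _)); lia.
  congr rev; apply/eq_in_map => j; rewrite mem_iota => jd.
  rewrite brev_cat (_ : j < _) //= nth_cat hd brev_lt //.
Qed.

(** * The Dyck path of a reduced word is determined by its output *)

Definition red2 (o1 o2 : op) : bool :=
  if (o1, o2) is (Push a, Pop b) then (a == 1) && (b == 1) else true.

Lemma reducedP w : reduced w <-> sorted red2 w.
Proof.
split=> [h|/(sortedP (Pop 0)) h i a b iw ea eb].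
  apply/(sortedP (Pop 0)) => i iw; rewrite /red2.
  case ea: (nth _ w i) => [a|//]; case eb: (nth _ w i.+1) => [//|b].
  by have [-> ->] := h i a b iw ea eb.
by have := h i iw; rewrite ea eb /= => /andP[/eqP-> /eqP->].
Qed.

(* A peak of a reduced word is a single push followed by a single pop, so the
   left-to-right maxima of the reversed output are the elements at the peaks. *)
Fixpoint decode (M : nat) (l : seq nat) : seq bool :=
  if l is v :: l' then nseq (v - M) true ++ false :: decode (maxn v M) l' else [::].

Lemma decode_small M l1 l2 : all (fun v => v <= M) l1 ->
  decode M (l1 ++ l2) = nseq (size l1) false ++ decode M l2.
Proof.
elim: l1 => //= v l1 IH /andP[vM h].
have -> : v - M = 0 by lia.
have -> : maxn v M = M by lia.
by rewrite IH.
Qed.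

(** [u] elements have been pushed and [M] is the largest one in the output; [decode] emits the
    pending [u - M] ups only at the next maximum. If [M < u], the previous operation is a push, so
    by reducedness a pop that comes now has size 1, follows a push of size 1, and outputs exactly
    [u]. If [M = u], a pop outputs only smaller elements. *)
Lemma decode_run s t w u k wk out M prev : all (op_in s t) w -> path red2 prev w ->
  hrun (size wk) w = Some 0 -> sumn (push_sizes w) = k -> all (fun v => v <= u) wk ->
  M = u \/ [/\ M < u, wk != [::]
      & exists2 a, prev = Push a & (a = 1 -> head 0 wk = u)] ->
  exists2 l, rev (foldl step (iota u.+1 k, wk, out) w).2 = rev out ++ l
    & nseq (u - M) true ++ shape w = decode M l.
Proof.
elim: w u k wk out M prev => [|o w IH] u k wk out M prev.
  move=> _ _ /= [sz] _ _ H; exists [::]; rewrite ?cats0 //=.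
  by case: H => [->|[_]]; [rewrite subnn | case: wk sz].
move=> /= /andP[ho al] /andP[hp hpath].
case: o ho hp hpath => [a|b] /= /andP[p0 _] hp hpath hr hk wku H.
- have -> : foldl step (drop a (iota u.+1 k), take a (iota u.+1 k) ++ wk, out) w =
    foldl step (iota (u + a).+1 (k - a), iota u.+1 a ++ wk, out) w.
    rewrite drop_iota take_iota (_ : minn a k = a); last lia.
    by rewrite addSn.
  have [||||l e1 e2] := IH (u + a) (k - a) (iota u.+1 a ++ wk) out M (Push a) al hpath.
  + by rewrite size_cat size_iota addnC.
  + lia.
  + rewrite all_cat; apply/andP; split; first by apply/allP => v; rewrite mem_iota; lia.
    by apply: sub_all wku => v; lia.
  + right; split; first by case: H => [->|[]]; lia.
      by case: a p0 {hp hpath hr hk}.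
    by exists a => // -> /=; rewrite addn1.
  exists l => //; rewrite -e2 /shape /= catA; congr (_ ++ _).
  have -> : u + a - M = u - M + a by case: H => [->|[]]; lia.
  by rewrite nseqD.
- case: ifP hr => // bw hr.
  case: H => [->|[Mu wk0 [a ep ehd]]].
    have [||||l e1 e2] := IH u k (drop b wk) (take b wk ++ out) u (Pop b) al hpath.
    + by rewrite size_drop.
    + by [].
    + by apply/allP => v /mem_drop; move/allP: wku; apply.
    + by left.
    exists (rev (take b wk) ++ l); first by rewrite e1 rev_cat catA.
    rewrite subnn decode_small; last first.
      by rewrite all_rev; apply/allP => v /mem_take; move/allP: wku; apply.
    by rewrite size_rev size_takel // -e2 subnn.
  move: hp; rewrite ep /= => /andP[/eqP /ehd hd /eqP b1]; subst b.
  case: wk wk0 hd wku hr bw {ehd} => //= v wk _ -> /andP[_ wku] hr _.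
  have [||||l e1 e2] := IH u k wk (u :: out) u (Pop 1) al hpath => //.
  + by move: hr; rewrite subn1.
  + by left.
  exists (u :: l); first by rewrite drop0 take0 e1 rev_cons cat_rcons.
  rewrite /= (_ : maxn u M = u); last lia.
  by rewrite -e2 subnn.
Qed.

Lemma shape_output s t w : all (op_in s t) w -> sorted red2 w -> hrun 0 w = Some 0 ->
  shape w = decode 0 (rev (output w)).
Proof.
move=> al so hr.
have pth : path red2 (Pop 0) w by case: w so {al hr}.
have [|||l] := @decode_run s t w 0 (op_size w) [::] [::] 0 (Pop 0) al pth hr.
- by rewrite /op_size total_pushE.
- by [].
- by left.
by rewrite /output => -> /= <-.
Qed.

Lemma word_of_shape s t w w' : all (op_in s t) w -> all (op_in s t) w' ->
  shape w = shape w' -> push_sizes w = push_sizes w' -> pop_sizes w = pop_sizes w' -> w = w'.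
Proof.
elim: w w' => [|o w IH] [|o' w'] //=.
- by case: o' => -[|n].
- by case: o => -[|n].
case: o => [[|a]|[|a]]; case: o' => [[|a']|[|a']] //= al al'.
- rewrite /shape /= -!/(shape _) => -[e] -[ea] eP eQ; subst a'.
  congr (_ :: _); case/andP: al => _ al; case/andP: al' => _ al'.
  by apply: IH => //; move/eqP: e; rewrite eqseq_cat // eqxx => /eqP.
- rewrite /shape /= -!/(shape _) => -[e] eP [ea] eQ; subst a'.
  congr (_ :: _); case/andP: al => _ al; case/andP: al' => _ al'.
  by apply: IH => //; move/eqP: e; rewrite eqseq_cat // eqxx => /eqP.
Qed.

(** * Restriction of interval partitions to classes *)

Fixpoint block_lo (u : nat -> bool) (i : nat) : nat :=
  if i is i'.+1 then if u i' then block_lo u i' else i else 0.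

Fixpoint block_hi (u : nat -> bool) (f i : nat) : nat :=
  if f is f'.+1 then if u i then block_hi u f' i.+1 else i else i.

(** Reversal computed from the gaps alone: a partition restricted to the classes is not presented by
    a list of sizes. [n] is the fuel for finding the right end of the block. *)
Definition block_rev (n : nat) (u : nat -> bool) (i : nat) : nat :=
  block_lo u i + block_hi u n i - i.

Lemma reversal_block_rev n b u : (forall c, n <= c.+1 -> u c = false) ->
  (forall x y, block u x y -> y - x < b) -> reversal n b u (block_rev n u).
Proof.
move=> un ub; split=> // x y k bl xk; have [xy cx cy cu] := bl.
have lo : block_lo u k = x.
  elim: k xk => [|k IH] xk /=; first lia.
  have [e|ne] := eqVneq x k.+1; first by move: cx; rewrite e /= => /negbTE ->.
  by rewrite cu ?IH //; lia.
have yn : y <= k + n.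
  have [kn|nk] := leqP k n; last first.
    by apply: leq_trans (leq_addr _ _); apply: (block_le bl); rewrite ?un; lia.
  by apply: leq_trans (leq_addl _ _); apply: (block_le bl); rewrite ?un; lia.
suff hi : forall f i, x <= i <= y -> y <= i + f -> block_hi u f i = y.
  by rewrite /block_rev lo hi //; lia.
elim=> [|f IH] i xi yi /=; first lia.
have [->|ne] := eqVneq i y; first by rewrite (negbTE cy).
by rewrite cu ?IH //; lia.
Qed.

Lemma reversal_id n b u r i : reversal n b u r -> n <= i -> r i = i.
Proof.
move=> [un ru _] ni; rewrite (ru i i) //; first lia.
  split=> // [||c]; try lia.
    by case: i ni => //= i ni; rewrite un.
  by rewrite un //; lia.
by rewrite leqnn.
Qed.

Lemma reversal_lt n b u r i : reversal n b u r -> i < n -> r i < n.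
Proof.
move=> ru i_n; have [un _ _] := ru; rewrite -ltnS -(prednK (leq_ltn_trans (leq0n i) i_n)) ltnS.
by rewrite ltnS (reversal_cut _ ru) ?un //; lia.
Qed.

Lemma reversal_const (T : Type) n b u r (f : nat -> T) i : reversal n b u r ->
  (forall c, u c -> f c = f c.+1) -> f (r i) = f i.
Proof.
move=> ru fu; have [x [y [[xy _ _ cu] xi xr _]]] := reversal_in i ru.
have fx k : x <= k <= y -> f k = f x.
  elim: k => [|k IH] xk; first by rewrite (_ : x = 0) //; lia.
  have [->//|ne] := eqVneq x k.+1.
  by rewrite -fu ?IH //; [lia | apply: cu; lia].
by rewrite !fx.
Qed.

Section Restriction.

Variables (n b : nat) (u u' K : nat -> bool) (r r' : nat -> nat).
Hypotheses (Hu : reversal n b u r) (Hu' : reversal n b u' r').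
Hypothesis shared : forall c, ~~ K c -> u c || u' c ->
  exists x y, [/\ x <= c < y, block u x y & block u' x y].

Lemma block_restrict (v : nat -> bool) x y : block v x y ->
  all K (iota x (y - x)) -> block (fun c => v c && K c) x y.
Proof.
move=> [xy cx cy cv] /allP aK; split=> // [||c xc].
- by move: cx; case: (x == 0) => //=; rewrite negb_and => ->.
- by rewrite negb_and cy.
- by rewrite cv // aK // mem_iota; lia.
Qed.

Lemma restrict_agree x y : block u x y -> block u' x y ->
  forall c, x <= c <= y -> (u c && K c) = (u' c && K c).
Proof.
move=> [xy _ cy cu] [_ _ cy' cu'] c xc.
have [->|ne] := eqVneq c y; first by rewrite (negbTE cy) (negbTE cy').
by rewrite cu ?cu' //; lia.
Qed.

Lemma block_transfer (v v' : nat -> bool) x y a e : x <= a -> e <= y ->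
  (forall c, x <= c <= y -> v c = v' c) -> (a == 0) || (x < a) || ~~ v' a.-1 ->
  block v a e -> block v' a e.
Proof.
move=> xa ey vv ca [ae ca' ce cv]; split=> // [||c ac].
- case/orP: ca => [/orP[->//|xa']|->]; last by rewrite orbT.
  by rewrite -vv //; lia.
- by rewrite -vv //; lia.
- by rewrite -vv ?cv //; lia.
Qed.

Lemma restrict_blocks_inside (v : nat -> bool) x y a e i : block v x y ->
  block (fun c => v c && K c) a e -> x <= i <= y -> a <= i <= e -> x <= a /\ e <= y.
Proof.
move=> [xy cx cy _] bl xi ai; split.
  by apply: (block_ge bl); [lia|move: cx; case: (x == 0) => //=; rewrite negb_and => ->].
by apply: (block_le bl); [lia|rewrite negb_and cy].
Qed.

Lemma restrict_reversal (v : nat -> bool) rv : reversal n b v rv ->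
  reversal n b (fun c => v c && K c) (block_rev n (fun c => v c && K c)).
Proof.
move=> Hv; have [vn _ sz] := Hv; apply: reversal_block_rev => [c nc|a e bl]; first by rewrite vn.
have [x [y [bx xa _ _]]] := reversal_in a Hv.
have [ae _ _ _] := bl.
have [||xa' ey] := restrict_blocks_inside bx bl (i := a); try lia.
by have := sz _ _ bx; lia.
Qed.

(** A block damaged by the restriction is common to [u] and [u']. Both products are then the
    identity on it, as its pieces are common as well; elsewhere the blocks met by [i] and by [r i]
    survive unchanged. *)
Lemma restrict_equation i :
  block_rev n (fun c => u' c && K c) (block_rev n (fun c => u c && K c) i) = r' (r i).
Proof.
have R := restrict_reversal Hu; have R' := restrict_reversal Hu'.
have [x [y [bx xi xr er]]] := reversal_in i Hu.
have [aK|/allPn[c]] := boolP (all K (iota x (y - x))); last first.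
  rewrite mem_iota => xc Kc.
  have uc : u c by case: bx => _ _ _; apply; lia.
  have [|x1 [y1 [xc1 b1 b1']]] := shared Kc; first by rewrite uc.
  have [e1 e2] : x1 = x /\ y1 = y by apply: (block_uniq b1 bx (i := c)); lia.
  rewrite {}e1 {}e2 in xc1 b1 b1'.
  have [a [e [bl ai ar era]]] := reversal_in i R.
  have [xa ey] := restrict_blocks_inside bx bl xi ai.
  have bl' : block (fun c => u' c && K c) a e.
    apply: (block_transfer xa ey _ _ bl) => [|]; first exact: restrict_agree.
    have [xa'|xa'] := ltnP x a; first by rewrite orbT.
    have -> : a = x by lia.
    case: b1' => _ + _ _; case: (x == 0) => //= h.
    by rewrite (negbTE h) /= ?orbT.
  rewrite er; case: Hu' => _ /(_ _ _ (x + y - i) b1') -> //; last lia.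
  rewrite era; case: R' => _ /(_ _ _ (a + e - i) bl') -> //; lia.
have bK := block_restrict bx aK.
have -> : block_rev n (fun c => u c && K c) i = r i.
  by case: R => _ /(_ _ _ i bK xi) -> _; rewrite er.
have [x' [y' [bx' xi' xr' er']]] := reversal_in (r i) Hu'.
have [aK'|/allPn[c]] := boolP (all K (iota x' (y' - x'))).
  have bK' := block_restrict bx' aK'.
  by case: R' => _ /(_ _ _ (r i) bK' xi') -> _; rewrite er'.
rewrite mem_iota => xc Kc.
have uc : u' c by case: bx' => _ _ _; apply; lia.
have [|x1 [y1 [xc1 b1 b1']]] := shared Kc; first by rewrite uc orbT.
have [e1 e2] : x1 = x' /\ y1 = y' by apply: (block_uniq b1' bx' (i := c)); lia.
have [e3 e4] : x1 = x /\ y1 = y by apply: (block_uniq b1 bx (i := r i)); lia.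
by case/negP: Kc; move/allP: aK; apply; rewrite mem_iota; lia.
Qed.

(** A block across a class boundary is common to both words, hence so is its piece after the
    boundary: a component that starts there shares its first block. [shared_upto] is the analogue
    for its end. *)
Lemma shared_from x : 0 < x -> ~~ K x.-1 -> u x.-1 || u' x.-1 ->
  exists z, block (fun c => u c && K c) x z /\ block (fun c => u' c && K c) x z.
Proof.
move=> x0 Kx /(shared Kx) [a [e [ae ba be]]].
have [z bz] : exists z, block (fun c => u c && K c) x z.
  apply: (block_from (n := n)); last by rewrite (negbTE Kx) andbF orbT.
  by move=> c nc; case: Hu => ->.
have ze : z <= e.
  by apply: (block_le bz); [lia | case: ba => _ _ h _; rewrite negb_and h].
exists z; split=> //; apply: (block_transfer (x := a) _ ze _ _ bz); first lia.
  exact: restrict_agree.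
by rewrite (negbTE Kx) andbF orbT.
Qed.

Lemma shared_upto y : ~~ K y -> u y || u' y ->
  exists z, block (fun c => u c && K c) z y /\ block (fun c => u' c && K c) z y.
Proof.
move=> Ky /(shared Ky) [a [e [ae ba be]]].
have [z bz] : exists z, block (fun c => u c && K c) z y.
  by apply: block_upto; rewrite (negbTE Ky) andbF.
have za : a <= z.
  apply: (block_ge bz); [lia | case: ba => _ h _ _; move: h].
  by case: (a == 0) => //= h; rewrite negb_and h.
exists z; split=> //; apply: (block_transfer (x := a) za _ _ _ bz (y := e)); first lia.
  exact: restrict_agree.
have [xa'|xa'] := ltnP a z; first by rewrite orbT.
have -> : z = a by lia.
case: be => _ + _ _; case: (a == 0) => //= h.
by rewrite (negbTE h) /= ?orbT.
Qed.

End Restriction.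

(** * Classes of parallel arcs *)

Section Matching.

(* [e] sends an up to its down and [d] is the inverse; [ru c] counts the downs
   before the up [c] and [rd j] the ups before the down [j], so they number the
   up-runs and down-runs. *)
Variables (n : nat) (ru rd d e : nat -> nat).
Hypothesis dlt : forall j, j < n -> d j < n.
Hypothesis elt : forall i, i < n -> e i < n.
Hypothesis dK : forall j, j < n -> e (d j) = j.
Hypothesis eK : forall i, i < n -> d (e i) = i.
Hypothesis rd_le : forall j, j < n -> rd j <= n.
Hypothesis gal : forall c j, c < n -> j < n -> (ru c <= j) = (c < rd j).
Hypothesis own : forall c, c < n -> ru c <= e c.
Hypothesis nc : forall c c', c < c' -> c' < n -> e c < ru c' \/ e c' < e c.

Lemma ru_mono c c' : c <= c' -> c' < n -> ru c <= ru c'.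
Proof.
move=> cc cn; have := elt cn; have := own cn => h1 h2.
have jn : ru c' < n by lia.
have := gal cn jn; rewrite leqnn => h.
by rewrite gal //; lia.
Qed.

Lemma rd_mono j j' : j <= j' -> j' < n -> rd j <= rd j'.
Proof.
move=> jj jn; case E: (rd j) => [//|c].
have jn' : j < n by lia.
have := rd_le jn'; rewrite E => cn.
by rewrite -gal //; have := gal cn jn'; rewrite E; lia.
Qed.

Lemma e_decreasing c c' : c < c' -> c' < n -> ru c = ru c' -> e c' < e c.
Proof.
move=> cc cn er; have cn' : c < n by lia.
by have := own cn'; case: (nc cc cn) => //; lia.
Qed.

Lemma d_decreasing j j' : j < j' -> j' < n -> rd j = rd j' -> d j' < d j.
Proof.
move=> jj jn er; have jn' : j < n by lia.
have h1 := dlt jn; have h2 := dlt jn'.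
case: (ltngtP (d j) (d j')) => // [lt|eq]; last first.
  by have := dK jn; have := dK jn'; rewrite eq; lia.
have := nc lt h1; rewrite !dK // => -[lt'|]; last lia.
by have := gal h1 jn'; have := gal h1 jn; have := own h1; rewrite dK //; lia.
Qed.

Definition up_class c := [&& c.+1 < n, ru c == ru c.+1 & rd (e c) == rd (e c.+1)].
Definition down_class j := [&& j.+1 < n, rd j == rd j.+1 & ru (d j) == ru (d j.+1)].

(** Along a down-run the matched ups decrease strictly, so a down strictly between those of [c.+1]
    and [c] would match an up strictly between [c] and [c.+1]. *)
Lemma up_class_adj c : up_class c -> e c = (e c.+1).+1.
Proof.
case/and3P=> cn /eqP er /eqP ed; have cn' : c < n by lia.
have lt := e_decreasing (ltnSn c) cn er.
have h1 := elt cn; have h2 := elt cn'.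
case: (ltngtP (e c) (e c.+1).+1) => // lt'; first lia.
set j := (e c.+1).+1 in lt'.
have m1 : rd (e c.+1) <= rd j by apply: rd_mono; lia.
have m2 : rd j <= rd (e c) by apply: rd_mono; lia.
have := @d_decreasing j (e c); have := @d_decreasing (e c.+1) j.
rewrite !eK //; lia.
Qed.

Lemma down_class_adj j : down_class j -> d j = (d j.+1).+1.
Proof.
case/and3P=> jn /eqP ed /eqP er; have jn' : j < n by lia.
have lt := d_decreasing (ltnSn j) jn ed.
have h1 := dlt jn; have h2 := dlt jn'.
case: (ltngtP (d j) (d j.+1).+1) => // lt'; first lia.
set c := (d j.+1).+1 in lt'.
have m1 : ru (d j.+1) <= ru c by apply: ru_mono; lia.
have m2 : ru c <= ru (d j) by apply: ru_mono; lia.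
have := @e_decreasing c (d j); have := @e_decreasing (d j.+1) c.
rewrite !dK //; lia.
Qed.

Lemma up_class_down c : up_class c -> down_class (e c.+1).
Proof.
move=> K; have ec := up_class_adj K; case/and3P: K => cn er ed.
by rewrite /down_class -ec !eK ?elt // 1?eq_sym ?er 1?eq_sym ?ed //; lia.
Qed.

Lemma down_class_up j : down_class j -> up_class (d j.+1) /\ e (d j.+1).+1 = j.
Proof.
move=> K; have ec := down_class_adj K; case/and3P: K => cn er ed.
rewrite /up_class -ec !dK; try lia.
by rewrite dlt; [rewrite 1?eq_sym ed eq_sym er | lia].
Qed.

(** The matching reverses order: the ups [c] and [c.+1] of a class have the downs [(e c.+1).+1] and
    [e c.+1], so the gap between them has index [e c.+1]. Outside the classes adjacent ups may have
    distant downs, and the gap is declared cut. *)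
Definition to_ups (Q : nat -> bool) c := up_class c && Q (e c.+1).

Definition conj_rev (r : nat -> nat) i := if i < n then d (r (e i)) else i.

Lemma to_ups_block (Q : nat -> bool) x y : y < n -> block (to_ups Q) x y ->
  block (fun j => Q j && down_class j) (e y) (e x) /\
  (forall k, x <= k <= y -> e k = e y + (y - k)).
Proof.
move=> yn [xy cx cy cu].
have ek k : x <= k <= y -> e k = e y + (y - k).
  move=> /andP[xk ky]; rewrite -{1}(subKn ky).
  have : y - k <= y - x by lia.
  elim: (y - k) => [|i IH] iy; first by rewrite subn0 addn0.
  have /andP[/up_class_adj K _] : to_ups Q (y - i.+1) by apply: cu; lia.
  by rewrite K (_ : (y - i.+1).+1 = y - i) ?IH ?addnS; lia.
split=> //; have xn : x < n by lia.
split=> [|||j jx].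
- by rewrite (ek x); lia.
- case E: (e y) => [//|j] /=; apply/negP => /andP[Qj Kj].
  have [K ej] := down_class_up Kj.
  rewrite -E eK // in K ej.
  by move: cy; rewrite /to_ups K ej Qj.
- apply/negP => /andP[Qx Kx]; have [K ej] := down_class_up Kx.
  have := down_class_adj Kx; rewrite eK // => xd.
  by move: cx; rewrite xd /= /to_ups K ej Qx.
- have yj : j = e (y - (j - e y)) by rewrite ek; have := ek x; lia.
  set c := (y - (j - e y)).-1.
  have ex := ek x.
  have c1 : c.+1 = y - (j - e y) by rewrite /c; lia.
  have /andP[K Qc] : to_ups Q c by apply: cu; rewrite /c; lia.
  by rewrite yj -c1 Qc up_class_down.
Qed.

Lemma reversal_to_ups t Q rQ : 0 < t ->
  reversal n t (fun j => Q j && down_class j) rQ ->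
  reversal n t (to_ups Q) (conj_rev rQ).
Proof.
move=> t0 HQ; have [_ vQ sQ] := HQ.
have un c : n <= c.+1 -> to_ups Q c = false by rewrite /to_ups /up_class; lia.
have big x y : n <= y -> block (to_ups Q) x y -> x = y.
  move=> ny [xy _ _ cu]; case: (ltngtP x y) => // lt; last lia.
  have : to_ups Q y.-1 by apply: cu; lia.
  by rewrite un //; lia.
split=> // [x y k bl xk|x y bl].
  have [yn|ny] := ltnP y n; last first.
    by have xy := big _ _ ny bl; rewrite /conj_rev (_ : k < n = false); lia.
  have [bQ ek] := to_ups_block yn bl.
  rewrite /conj_rev (_ : k < n); last lia.
  have ex := ek x; have ekk := ek k xk.
  rewrite (vQ _ _ _ bQ); last lia.
  rewrite (_ : e y + e x - e k = e (x + y - k)); last by rewrite (ek (x + y - k)); lia.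
  by rewrite eK; lia.
have [yn|ny] := ltnP y n; last by rewrite (big _ _ ny bl) subnn.
have [bQ ek] := to_ups_block yn bl.
by have := sQ _ _ bQ; have := ek x; case: bl => xy _ _ _; lia.
Qed.

(** Classes are convex: [ru] is monotone, and within an up-run so is [rd] along the decreasing
    downs, so both are constant between [a] and [b]. *)
Lemma up_between a c b : a <= c -> c < b -> b < n -> ru a = ru b ->
  rd (e a) = rd (e b) -> up_class c.
Proof.
move=> ac cb bn er ed; have cn : c.+1 < n by lia.
have r1 : ru a <= ru c by apply: ru_mono; lia.
have r2 : ru c <= ru c.+1 by apply: ru_mono; lia.
have r3 : ru c.+1 <= ru b by apply: ru_mono; lia.
have d1 : e c <= e a.
  have [<-//|ne] := eqVneq a c; apply/ltnW/e_decreasing; lia.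
have d2 : e b <= e c.+1.
  have [<-//|ne] := eqVneq c.+1 b; apply/ltnW/e_decreasing; lia.
have d3 : e c.+1 < e c by apply: e_decreasing; lia.
have an : e a < n by apply: elt; lia.
have m1 : rd (e c) <= rd (e a) by apply: rd_mono; lia.
have m2 : rd (e c.+1) <= rd (e c) by apply: rd_mono; lia.
have m3 : rd (e b) <= rd (e c.+1) by apply: rd_mono; lia.
by rewrite /up_class cn /=; lia.
Qed.

Lemma down_between a c b : a <= c -> c < b -> b < n -> rd a = rd b ->
  ru (d a) = ru (d b) -> down_class c.
Proof.
move=> ac cb bn er ed; have cn : c.+1 < n by lia.
have r1 : rd a <= rd c by apply: rd_mono; lia.
have r2 : rd c <= rd c.+1 by apply: rd_mono; lia.
have r3 : rd c.+1 <= rd b by apply: rd_mono; lia.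
have d1 : d c <= d a.
  have [<-//|ne] := eqVneq a c; apply/ltnW/d_decreasing; lia.
have d2 : d b <= d c.+1.
  have [<-//|ne] := eqVneq c.+1 b; apply/ltnW/d_decreasing; lia.
have d3 : d c.+1 < d c by apply: d_decreasing; lia.
have an : d a < n by apply: dlt; lia.
have m1 : ru (d c) <= ru (d a) by apply: ru_mono; lia.
have m2 : ru (d c.+1) <= ru (d c) by apply: ru_mono; lia.
have m3 : ru (d b) <= ru (d c.+1) by apply: ru_mono; lia.
by rewrite /down_class cn /=; lia.
Qed.

Variables (s t : nat) (P P' Q Q' : nat -> bool) (rP rP' rQ rQ' : nat -> nat).
Hypothesis t0 : 0 < t.
Hypotheses (HP : reversal n s P rP) (HP' : reversal n s P' rP').
Hypotheses (HQ : reversal n t Q rQ) (HQ' : reversal n t Q' rQ').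
Hypotheses (PU : forall c, P c -> ru c = ru c.+1) (PU' : forall c, P' c -> ru c = ru c.+1).
Hypotheses (QD : forall j, Q j -> rd j = rd j.+1) (QD' : forall j, Q' j -> rd j = rd j.+1).
Hypothesis E : forall i, i < n -> rP' (rP i) = d (rQ' (rQ (e i))).

(** Push blocks stay inside up-runs and pop blocks inside down-runs; the two sides of [E] thus show
    that the product keeps the up-run and the down-run of an arc, which together determine its
    class. *)
Lemma ups_invariant i : i < n ->
  [/\ rP' (rP i) < n, ru (rP' (rP i)) = ru i & rd (e (rP' (rP i))) = rd (e i)].
Proof.
move=> i_n; split.
- exact: (reversal_lt HP' (reversal_lt HP i_n)).
- by rewrite (reversal_const _ HP' PU') (reversal_const _ HP PU).
- rewrite E // dK; last exact: (reversal_lt HQ' (reversal_lt HQ (elt i_n))).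
  by rewrite (reversal_const _ HQ' QD') (reversal_const _ HQ QD).
Qed.

Lemma downs_invariant j : j < n ->
  [/\ rQ' (rQ j) < n, rd (rQ' (rQ j)) = rd j & ru (d (rQ' (rQ j))) = ru (d j)].
Proof.
move=> jn; split.
- exact: (reversal_lt HQ' (reversal_lt HQ jn)).
- by rewrite (reversal_const _ HQ' QD') (reversal_const _ HQ QD).
- have := E (dlt jn); rewrite dK // => <-.
  by rewrite (reversal_const _ HP' PU') (reversal_const _ HP PU).
Qed.

Lemma ups_shared c : ~~ up_class c -> P c || P' c ->
  exists x y, [/\ x <= c < y, block P x y & block P' x y].
Proof.
move=> K Pc.
(* An index carried across [c] would remain in its class, and by convexity [c] would be a gap inside
   that class. *)
have pres i : (rP' (rP i) <= c) = (i <= c).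
  have [i_n|ni] := ltnP i n; last by rewrite (reversal_id HP ni) (reversal_id HP' ni).
  have [i1 i2 i3] := ups_invariant i_n.
  apply/idP/idP => h; rewrite leqNgt; apply: contraNN K => lt.
    by apply: (up_between h lt).
  by apply: (up_between h lt).
case/orP: Pc => Pc; first exact: (shared_block_across HP HP').
have [|x [y [h1 h2 h3]]] := shared_block_across HP' HP (c := c) _ Pc; last by exists x, y.
move=> i; rewrite -(pres (rP (rP' i))) (reversalK _ HP) (reversalK _ HP') //.
Qed.

Lemma downs_shared c : ~~ down_class c -> Q c || Q' c ->
  exists x y, [/\ x <= c < y, block Q x y & block Q' x y].
Proof.
move=> K Qc.
have pres i : (rQ' (rQ i) <= c) = (i <= c).
  have [i_n|ni] := ltnP i n; last by rewrite (reversal_id HQ ni) (reversal_id HQ' ni).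
  have [i1 i2 i3] := downs_invariant i_n.
  apply/idP/idP => h; rewrite leqNgt; apply: contraNN K => lt.
    by apply: (down_between h lt).
  by apply: (down_between h lt).
case/orP: Qc => Qc; first exact: (shared_block_across HQ HQ').
have [|x [y [h1 h2 h3]]] := shared_block_across HQ' HQ (c := c) _ Qc; last by exists x, y.
move=> i; rewrite -(pres (rQ (rQ' i))) (reversalK _ HQ) (reversalK _ HQ') //.
Qed.

Definition upP c := P c && up_class c.
Definition upP' c := P' c && up_class c.
Definition downQ c := Q c && down_class c.
Definition downQ' c := Q' c && down_class c.

Lemma shared_to_ups_from x : x < n -> ~~ down_class (e x) -> Q (e x) || Q' (e x) ->
  exists z, block (to_ups Q) x z /\ block (to_ups Q') x z.
Proof.
move=> xn K Qx.
have [z [bz bz']] := shared_upto downs_shared K Qx.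
have xcut (R : nat -> bool) : (x == 0) || ~~ to_ups R x.-1.
  case: x xn K {Qx bz bz'} => //= x xn K; apply: contraNN K => /andP[K _].
  exact: up_class_down.
have un (R : nat -> bool) c : n <= c.+1 -> to_ups R c = false by rewrite /to_ups /up_class; lia.
have [a ba] := block_from (@un Q) (xcut Q).
have [a' ba'] := block_from (@un Q') (xcut Q').
have lt (R : nat -> bool) b : block (to_ups R) x b -> b < n.
  move=> bl; have : b <= n.-1 by apply: (block_le bl); rewrite ?un; lia.
  by lia.
have [h1 h2] := to_ups_block (lt _ _ ba) ba; have [h1' h2'] := to_ups_block (lt _ _ ba') ba'.
have [xa _ _ _] := ba; have [xa' _ _ _] := ba'.
have [e1 _] : e a = z /\ e x = e x.
  by apply: (block_uniq h1 bz (i := e x)); case: bz => ? _ _ _; rewrite ?leqnn ?andbT //; have := h2 x; lia.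
have [e1' _] : e a' = z /\ e x = e x.
  by apply: (block_uniq h1' bz' (i := e x)); case: bz => ? _ _ _; rewrite ?leqnn ?andbT //; have := h2' x; lia.
exists a; split=> //; suff -> : a = a' by [].
by rewrite -(eK (lt _ _ ba)) -(eK (lt _ _ ba')) e1 e1'.
Qed.

Lemma shared_to_ups_upto y : y < n -> 0 < e y -> ~~ down_class (e y).-1 ->
  Q (e y).-1 || Q' (e y).-1 ->
  exists z, block (to_ups Q) z y /\ block (to_ups Q') z y.
Proof.
move=> yn ey K Qy.
have [z [bz bz']] := shared_from HQ downs_shared ey K Qy.
have ycut (R : nat -> bool) : ~~ to_ups R y.
  by apply: contraNN K => /andP[K _]; have := up_class_down K; rewrite (up_class_adj K).
have [a ba] := block_upto (ycut Q).
have [a' ba'] := block_upto (ycut Q').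
have [h1 h2] := to_ups_block yn ba; have [h1' h2'] := to_ups_block yn ba'.
have [xa _ _ _] := ba; have [xa' _ _ _] := ba'.
have [_ e1] : e y = e y /\ e a = z.
  by apply: (block_uniq h1 bz (i := e y)); case: bz => ? _ _ _; rewrite ?leqnn ?andbT //=; have := h2 a; lia.
have [_ e1'] : e y = e y /\ e a' = z.
  by apply: (block_uniq h1' bz' (i := e y)); case: bz => ? _ _ _; rewrite ?leqnn ?andbT //=; have := h2' a'; lia.
exists a; split=> //; suff -> : a = a' by [].
have an : a < n by lia.
have an' : a' < n by lia.
by rewrite -(eK an) -(eK an') e1 e1'.
Qed.

(* The segment of arcs [x..y] is a union of push blocks and of pop blocks. *)
Definition closed_seg (A B : nat -> bool) x y :=
  [/\ x <= y < n, forall c, x <= c < y -> up_class c,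
      (x == 0) || ~~ A x.-1, ~~ A y
    & ~~ B (e x) && ((e y == 0) || ~~ B (e y).-1)].

(** If an unrestricted block passed over an end of the component, that end would be a class
    boundary, and the block, being common to both words, would leave a shared piece at this end of
    the component. [A] and [B] are left general so that the statement serves either word. *)
Lemma closed_of_unshared (A B : nat -> bool) x y :
  (forall c, A c -> P c || P' c) -> (forall c, B c -> Q c || Q' c) ->
  x <= y < n -> (forall c, x <= c < y -> up_class c) ->
  (x == 0) || ~~ (A x.-1 && up_class x.-1) -> ~~ (A y && up_class y) ->
  (x == 0) || ~~ to_ups B x.-1 -> ~~ to_ups B y ->
  (forall z, block upP x z -> ~ block upP' x z) ->
  (forall z, block upP z y -> ~ block upP' z y) ->
  (forall z, block (to_ups Q) x z -> ~ block (to_ups Q') x z) ->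
  (forall z, block (to_ups Q) z y -> ~ block (to_ups Q') z y) ->
  closed_seg A B x y.
Proof.
move=> AP BQ xyn K cAx cAy cBx cBy nPx nPy nQx nQy.
have xn : x < n by lia.
have yn : y < n by lia.
split=> //.
- case: x xyn K cAx nPx {cBx nQx xn} => //= x xyn K; rewrite negb_and => /orP[//|Kx] nPx.
  apply/negP => /AP Ax; have [z [b1 b2]] := shared_from HP ups_shared (ltn0Sn x) Kx Ax.
  exact: (nPx z).
- move: cAy; rewrite negb_and => /orP[//|Ky].
  apply/negP => /AP Ay; have [z [b1 b2]] := shared_upto ups_shared Ky Ay.
  exact: (nPy z).
apply/andP; split.
  apply/negP => Bx; have [Kx|Kx] := boolP (down_class (e x)).
    have [K1 K2] := down_class_up Kx; have := down_class_adj Kx; rewrite eK // => xd.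
    by move: cBx; rewrite xd /= /to_ups K1 K2 Bx.
  by have [z [b1 b2]] := shared_to_ups_from xn Kx (BQ _ Bx); apply: (nQx z).
case: (posnP (e y)) => [->//|ey] /=.
apply/negP => By; have [Ky|Ky] := boolP (down_class (e y).-1).
  have [] := down_class_up Ky; rewrite prednK // eK // => K1 K2.
  by move: cBy; rewrite /to_ups K1 K2 By.
by have [z [b1 b2]] := shared_to_ups_upto yn ey Ky (BQ _ By); apply: (nQy z).
Qed.

Lemma upsE i : block_rev n upP' (block_rev n upP i) =
  conj_rev (block_rev n downQ') (conj_rev (block_rev n downQ) i).
Proof.
have R := restrict_reversal down_class HQ; have R' := restrict_reversal down_class HQ'.
rewrite (restrict_equation HP HP' ups_shared) /conj_rev.
have [i_n|ni] := ltnP i n; last first.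
  by rewrite (reversal_id HP ni) (reversal_id HP' ni) ltnNge ni.
have lt : block_rev n downQ (e i) < n by apply: (reversal_lt R); exact: elt.
by rewrite dlt // dK // (restrict_equation HQ HQ' downs_shared) E.
Qed.

Lemma index_uniqueness :
  (forall x y, x < y -> closed_seg P Q x y ->
     ~ (forall c, x <= c < y -> P c && Q (e c.+1))) ->
  (forall x y, x < y -> closed_seg P' Q' x y ->
     ~ (forall c, x <= c < y -> P' c && Q' (e c.+1))) ->
  (forall x y, x < y -> y - x < (s + t).*2 -> closed_seg P Q x y -> closed_seg P' Q' x y ->
     (forall c, x <= c < y -> P c || Q (e c.+1)) ->
     (forall c, x <= c < y -> P' c || Q' (e c.+1)) ->
     forall c, x <= c < y -> P c = P' c /\ Q (e c.+1) = Q' (e c.+1)) ->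
  (forall c, P c = P' c) /\ (forall j, Q j = Q' j).
Proof.
move=> H1 H1' H2.
have RP := restrict_reversal up_class HP; have RP' := restrict_reversal up_class HP'.
have RQ := reversal_to_ups t0 (restrict_reversal down_class HQ).
have RQ' := reversal_to_ups t0 (restrict_reversal down_class HQ').
rewrite -/upP -/upP' -/downQ -/downQ' in RP RP' RQ RQ'.
have EE := upsE.
have EE' i : block_rev n upP (block_rev n upP' i) =
    conj_rev (block_rev n downQ) (conj_rev (block_rev n downQ') i).
  have := EE (block_rev n upP (block_rev n upP' i)).
  rewrite (reversalK _ RP) (reversalK _ RP') => /(congr1 (conj_rev (block_rev n downQ'))).
  move=> /(congr1 (conj_rev (block_rev n downQ))).
  by rewrite (reversalK _ RQ') (reversalK _ RQ) => ->.
have AP i : P i -> P i || P' i by move->.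
have AP' i : P' i -> P i || P' i by move->; rewrite orbT.
have BQ i : Q i -> Q i || Q' i by move->.
have BQ' i : Q' i -> Q i || Q' i by move->; rewrite orbT.
have Kof (A B : nat -> bool) c : A c && up_class c || to_ups B c -> up_class c.
  by rewrite /to_ups => /orP[/andP[]|/andP[]].
have Klt c : up_class c -> c.+1 < n by case/and3P.
(* The components of the two words coincide: otherwise one word has a double block around [c]. It
   shares neither end with the other word, which is cut at [c], so it is closed and contradicts [H1]
   or [H1']. *)
have mism c : (upP c || to_ups Q c) = (upP' c || to_ups Q' c).
  apply/idP/idP => h; apply: contraT; rewrite negb_or => /andP[nP nQ].
  - have [a [b [acb bP bQ]]] := double_block_of_common_cut RP' RP RQ' RQ EE' nP nQ h.
    have [ab cPa cPb cP] := bP; have [_ cQa cQb cQ] := bQ.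
    have K i : a <= i < b -> up_class i by move=> /cQ /andP[].
    have bn : b < n.
      have /K/Klt : a <= b.-1 < b by qlia.
      by qlia.
    have : closed_seg P Q a b.
      apply: (closed_of_unshared AP BQ _ K cPa cPb cQa cQb); first qlia.
      + move=> z b1 b2; have ez := block_uniq_end b1 bP.
        by case: b2 => _ _ _ h2; move: nP; rewrite h2 // ez.
      + move=> z b1 b2; have ez := block_uniq_begin b1 bP.
        by case: b2 => _ _ _ h2; move: nP; rewrite h2 // ez.
      + move=> z b1 b2; have ez := block_uniq_end b1 bQ.
        by case: b2 => _ _ _ h2; move: nQ; rewrite h2 // ez.
      + move=> z b1 b2; have ez := block_uniq_begin b1 bQ.
        by case: b2 => _ _ _ h2; move: nQ; rewrite h2 // ez.
    move/H1 => []; first qlia.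
    by move=> i ai; have /andP[-> _] := cP i ai; have /andP[_ ->] := cQ i ai.
  - have [a [b [acb bP bQ]]] := double_block_of_common_cut RP RP' RQ RQ' EE nP nQ h.
    have [ab cPa cPb cP] := bP; have [_ cQa cQb cQ] := bQ.
    have K i : a <= i < b -> up_class i by move=> /cQ /andP[].
    have bn : b < n.
      have /K/Klt : a <= b.-1 < b by qlia.
      by qlia.
    have : closed_seg P' Q' a b.
      apply: (closed_of_unshared AP' BQ' _ K cPa cPb cQa cQb); first qlia.
      + move=> z b2 b1; have ez := block_uniq_end b1 bP.
        by case: b2 => _ _ _ h2; move: nP; rewrite h2 // ez.
      + move=> z b2 b1; have ez := block_uniq_begin b1 bP.
        by case: b2 => _ _ _ h2; move: nP; rewrite h2 // ez.
      + move=> z b2 b1; have ez := block_uniq_end b1 bQ.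
        by case: b2 => _ _ _ h2; move: nQ; rewrite h2 // ez.
      + move=> z b2 b1; have ez := block_uniq_begin b1 bQ.
        by case: b2 => _ _ _ h2; move: nQ; rewrite h2 // ez.
    move/H1' => []; first qlia.
    by move=> i ai; have /andP[-> _] := cP i ai; have /andP[_ ->] := cQ i ai.
(* If the words differ at [c], then on the component of [c] no first or last block is shared, by
   [component_agree]. So the component is closed in both words and bounded, and [H2] applies. *)
have agree c : upP c = upP' c /\ to_ups Q c = to_ups Q' c.
  have [/andP[/eqP-> /eqP->]//|ne] := boolP ((upP c == upP' c) && (to_ups Q c == to_ups Q' c)).
  have uc : upP c || to_ups Q c.
    apply: contraNT ne => h; have := h; rewrite mism !negb_or => /andP[/negbTE-> /negbTE->].
    by move: h; rewrite negb_or => /andP[/negbTE-> /negbTE->].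
  have [|x [y [bl xc]]] := @block_ex (fun i => upP i || to_ups Q i) n c.
    by move=> i ni; apply/negP => /Kof /Klt; qlia.
  have cy : c < y.
    case: bl => _ _ cy _; rewrite ltn_neqAle; apply/andP; split; last qlia.
    by apply: contraNneq cy => <-.
  have bl' : block (fun i => upP' i || to_ups Q' i) x y.
    exact: eq_block mism bl.
  have contra : ~ (forall i, x <= i < y -> upP i = upP' i /\ to_ups Q i = to_ups Q' i).
    by move=> H; have [h1 h2] := H c ltac:(qlia); move: ne; rewrite h1 h2 !eqxx.
  have nPx z : block upP x z -> ~ block upP' x z.
    by move=> b1 b2; apply: contra; apply: (component_agree RP RP' RQ RQ' EE bl bl' (z := z)); left.
  have nPy z : block upP z y -> ~ block upP' z y.
    by move=> b1 b2; apply: contra; apply: (component_agree RP RP' RQ RQ' EE bl bl' (z := z)); right.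
  have blQ : block (fun i => to_ups Q i || upP i) x y.
    by apply: eq_block bl => i; rewrite orbC.
  have blQ' : block (fun i => to_ups Q' i || upP' i) x y.
    by apply: eq_block bl' => i; rewrite orbC.
  have nQx z : block (to_ups Q) x z -> ~ block (to_ups Q') x z.
    move=> b1 b2; apply: contra => i xi.
    have := component_agree RQ RQ' RP RP' (fun i => esym (EE i)) blQ blQ' (z := z).
    by case/(_ (or_introl (conj b1 b2)) i xi).
  have nQy z : block (to_ups Q) z y -> ~ block (to_ups Q') z y.
    move=> b1 b2; apply: contra => i xi.
    have := component_agree RQ RQ' RP RP' (fun i => esym (EE i)) blQ blQ' (z := z).
    by case/(_ (or_intror (conj b1 b2)) i xi).
  have bnd := component_bound RP RP' RQ RQ' EE bl bl' nPx nQx.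
  have [xy cx cy0 cu] := bl; have [_ cx' cy' cu'] := bl'.
  have K i : x <= i < y -> up_class i by move=> /cu /Kof.
  have yn : y < n.
    have /K/Klt : x <= y.-1 < y by qlia.
    by qlia.
  have xyn : x <= y < n by qlia.
  have cut_or (A B : nat -> bool) z : ~~ (A z || B z) -> ~~ A z /\ ~~ B z.
    by rewrite negb_or => /andP[].
  have cut_or0 (A B : nat -> bool) : (x == 0) || ~~ (A x.-1 || B x.-1) ->
      ((x == 0) || ~~ A x.-1) /\ ((x == 0) || ~~ B x.-1).
    by case: (x == 0) => //=; exact: cut_or.
  have [cPx cQx] := cut_or0 _ _ cx; have [cPy cQy] := cut_or _ _ _ cy0.
  have [cPx' cQx'] := cut_or0 _ _ cx'; have [cPy' cQy'] := cut_or _ _ _ cy'.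
  have C := closed_of_unshared AP BQ xyn K cPx cPy cQx cQy nPx nPy nQx nQy.
  have C' := closed_of_unshared AP' BQ' xyn K cPx' cPy' cQx' cQy' nPx nPy nQx nQy.
  case: contra => i xi; rewrite /upP /upP' /to_ups.
  have := H2 x y ltac:(qlia) bnd C C' _ _ i xi.
  case=> [j xj|j xj|-> ->] //.
    by have := cu j xj; rewrite /upP /to_ups; case: (P j) => //= /andP[].
  by have := cu' j xj; rewrite /upP' /to_ups; case: (P' j) => //= /andP[].
(* Gaps inside a class are settled by [agree]; at a class boundary every block that crosses is
   common to both words. *)
split=> c.
  have [K|K] := boolP (up_class c); first by have [] := agree c; rewrite /upP /upP' K !andbT.
  have [Pc|] := boolP (P c || P' c); last by rewrite negb_or => /andP[/negbTE-> /negbTE->].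
  have [x [y [xc [_ _ _ h] [_ _ _ h']]]] := ups_shared K Pc.
  by rewrite h ?h'.
have [K|K] := boolP (down_class c).
  have [K1 K2] := down_class_up K.
  by have [_] := agree (d c.+1); rewrite /to_ups K1 K2.
have [Qc|] := boolP (Q c || Q' c); last by rewrite negb_or => /andP[/negbTE-> /negbTE->].
have [x [y [xc [_ _ _ h] [_ _ _ h']]]] := downs_shared K Qc.
by rewrite h ?h'.
Qed.

End Matching.

(** * Replacing the blocks of a closed segment *)

(** The arcs of a segment are nested, so its down number [i] matches its up number
    [(sumn p).-1 - i]. Both pairs send each rank [j] of the segment to the same label. *)
Definition pair_equiv (p q p' q' : seq nat) : Prop := forall j, j < sumn p ->
  brev p ((sumn p).-1 - brev q j) = brev p' ((sumn p).-1 - brev q' j).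

(** What the top of [l] looks like after being moved in blocks of sizes [p]: the same formula for
    pushes and for pops. *)
Definition block_list (p l : seq nat) : seq nat :=
  [seq nth 0 l (brev p ((sumn p).-1 - i)) | i <- iota 0 (sumn p)].

Lemma block_list_cons a p l : a + sumn p <= size l ->
  block_list (a :: p) l = block_list p (drop a l) ++ take a l.
Proof.
move=> al; apply: (@eq_from_nth _ 0).
  by rewrite size_cat !size_map !size_iota /= size_takel; lia.
move=> i; rewrite size_map size_iota /= => lt.
rewrite (nth_map 0) ?size_iota //= nth_iota // add0n nth_cat size_map size_iota.
have [ip|pi] := ltnP i (sumn p).
  rewrite (nth_map 0) ?size_iota // nth_iota // add0n nth_drop.
  rewrite (_ : (a + sumn p).-1 - i < a = false); last lia.
  by congr (nth _ _ (_ + brev _ _)); lia.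
rewrite (_ : (a + sumn p).-1 - i < a); last lia.
by rewrite nth_take; [congr nth; lia | lia].
Qed.

Lemma foldl_pushes p inp wk out : sumn p <= size inp ->
  foldl step (inp, wk, out) (map Push p) =
  (drop (sumn p) inp, block_list p inp ++ wk, out).
Proof.
elim: p inp wk => [|a p IH] inp wk /= h; first by rewrite drop0.
by rewrite IH ?size_drop ?drop_drop ?block_list_cons ?catA // 1?addnC //; lia.
Qed.

Lemma foldl_pops q inp wk out : sumn q <= size wk ->
  foldl step (inp, wk, out) (map Pop q) =
  (inp, drop (sumn q) wk, block_list q wk ++ out).
Proof.
elim: q wk out => [|a q IH] wk out /= h; first by rewrite drop0.
by rewrite IH ?size_drop ?drop_drop ?block_list_cons ?catA // 1?addnC //; lia.
Qed.

Lemma foldl_input w c : (foldl step c w).1.1 = drop (sumn (push_sizes w)) c.1.1.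
Proof.
elim: w c => [|[a|b] w IH] [[inp wk] out] /=; rewrite ?drop0 // IH /=.
by rewrite drop_drop addnC.
Qed.

Lemma foldl_frame w inp T out k : hrun (size T) w = Some k ->
  sumn (push_sizes w) <= size inp ->
  exists inp' T' out', size T' = k /\ forall wk,
    foldl step (inp, T ++ wk, out) w = (inp', T' ++ wk, out').
Proof.
elim: w inp T out => [|[a|b] w IH] inp T out /=.
- by case=> <- _; exists inp, T, out.
- move=> hr le.
  have [||inp' [T' [out' [sT H]]]] := IH (drop a inp) (take a inp ++ T) out.
  + by rewrite size_cat size_takel 1?addnC //; lia.
  + by rewrite size_drop; lia.
  by exists inp', T', out'; split=> // wk; rewrite catA.
- case: ifP => // bT hr le.
  have [||inp' [T' [out' [sT H]]]] := IH inp (drop b T) (take b T ++ out) => //.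
    by rewrite size_drop.
  exists inp', T', out'; split=> // wk; rewrite takel_cat // -H drop_cat.
  case: ltnP => // h; have -> : b = size T by lia.
  by rewrite subnn drop0 drop_size.
Qed.

Lemma push_sizes_Push p : push_sizes (map Push p) = p.
Proof. by elim: p => //= a p ->. Qed.
Lemma push_sizes_Pop q : push_sizes (map Pop q) = [::].
Proof. by elim: q. Qed.
Lemma pop_sizes_Push p : pop_sizes (map Push p) = [::].
Proof. by elim: p. Qed.
Lemma pop_sizes_Pop q : pop_sizes (map Pop q) = q.
Proof. by elim: q => //= a q ->. Qed.

Lemma hrun_Push h p : hrun h (map Push p) = Some (h + sumn p).
Proof. by elim: p h => [|a p IH] h /=; rewrite ?addn0 // IH addnA. Qed.

Lemma hrun_Pop h q : hrun h (map Pop q) = if sumn q <= h then Some (h - sumn q) else None.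
Proof.
elim: q h => [|b q IH] h /=; first by rewrite subn0.
rewrite IH; case: (leqP b h) => bh; last by rewrite ifF //; lia.
rewrite (_ : sumn q <= h - b = (b + sumn q <= h)); last lia.
by rewrite subnDA.
Qed.

Lemma block_list_pair_equiv p q p' q' l wk : sumn p = sumn q -> sumn p' = sumn p ->
  sumn q' = sumn q -> pair_equiv p q p' q' ->
  block_list q (block_list p l ++ wk) = block_list q' (block_list p' l ++ wk).
Proof.
move=> epq ep eq pe; rewrite /block_list eq; apply/eq_in_map => i.
rewrite mem_iota add0n => /andP[_ iq].
have lt : (sumn q).-1 - i < sumn q by lia.
have h1 := brev_lt lt.
have h2 : brev q' ((sumn q).-1 - i) < sumn q by rewrite -eq; apply: brev_lt; rewrite eq.
rewrite ep epq !nth_cat !size_map !size_iota h1 h2.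
rewrite !(nth_map 0) ?size_iota // !nth_iota // !add0n.
by have := pe ((sumn q).-1 - i); rewrite epq => ->.
Qed.

(** The balanced [Y] never reaches below its starting height, so the pops [q] act exactly on what
    the pushes [p] have left. *)
Lemma replace_segment X p Y q Z p' q' :
  let w := X ++ map Push p ++ Y ++ map Pop q ++ Z in
  let w' := X ++ map Push p' ++ Y ++ map Pop q' ++ Z in
  hrun 0 w = Some 0 -> hrun 0 Y = Some 0 ->
  sumn p = sumn q -> sumn p' = sumn p -> sumn q' = sumn q -> pair_equiv p q p' q' ->
  hrun 0 w' = Some 0 /\ equivalent w w'.
Proof.
move=> w w' hw hY epq ep eq pe.
have hrw (u v : seq nat) : sumn u = sumn p -> sumn v = sumn q ->
    hrun 0 (X ++ map Push u ++ Y ++ map Pop v ++ Z) = Some 0.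
  move=> eu ev; move: hw; rewrite /w !hrun_cat; case: (hrun 0 X) => [h|//] /=.
  rewrite !hrun_cat !hrun_Push /= eu; have := hrun_add (h + sumn p) hY.
  rewrite !add0n !hrun_cat => -> /=; rewrite !hrun_cat !hrun_Pop ev.
  by case: ifP.
have sz : op_size w = op_size w'.
  by rewrite /op_size !total_pushE /w /w' !push_sizes_cat !push_sizes_Push !push_sizes_Pop !sumn_cat ep.
split; first exact: hrw; split=> //.
rewrite /output -sz; set n := op_size w.
have [h hX] : exists h, hrun 0 X = Some h.
  by move: hw; rewrite /w hrun_cat; case: (hrun 0 X) => // h _; exists h.
have tot : sumn (push_sizes X) + sumn p + sumn (push_sizes Y) <= n.
  by rewrite /n /op_size total_pushE /w !push_sizes_cat push_sizes_Push !sumn_cat; lia.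
rewrite /w /w' !foldl_cat.
have eI := foldl_input X (iota 1 n, [::], [::]).
case EX : (foldl step _ X) eI => [[inp wk] out] /= eI.
have si : sumn p + sumn (push_sizes Y) <= size inp by rewrite eI size_drop size_iota; lia.
rewrite !foldl_pushes; try lia.
rewrite ep.
have [|inp' [T' [out' [/size0nil -> H]]]] := @foldl_frame Y (drop (sumn p) inp) [::] out 0 hY.
  by rewrite size_drop; lia.
rewrite (H (block_list p inp ++ wk)) (H (block_list p' inp ++ wk)) /=.
have sp (u : seq nat) : size (block_list u inp ++ wk) = sumn u + size wk.
  by rewrite size_cat size_map size_iota.
rewrite !foldl_pops ?sp; try lia.
rewrite (block_list_pair_equiv inp wk epq ep eq pe) eq.
congr (foldl step _ Z).2; congr (_, _, _).
rewrite !drop_size_cat ?size_map ?size_iota //; lia.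
Qed.

(** * Existence of a reduced canonical word *)

Definition starts_push (w : seq op) := if w is Push _ :: _ then true else false.
Definition ends_pop (w : seq op) := if last (Push 0) w is Pop _ then true else false.

Lemma sorted_cat_push u v : starts_push v ->
  sorted red2 (u ++ v) = sorted red2 u && sorted red2 v.
Proof.
case: v => [|[a|b] v] // _; case: u => [|o u] //=.
by rewrite cat_path /=; congr (_ && _); rewrite /red2; case: (last o u).
Qed.

Lemma sorted_cat_pop u v : ends_pop u ->
  sorted red2 (u ++ v) = sorted red2 u && sorted red2 v.
Proof.
rewrite /ends_pop; case: u => [|o u] //=; rewrite cat_path.
by case: (last o u) => // b _; case: v.
Qed.

Lemma balanced_ends s t Y : all (op_in s t) Y -> hrun 0 Y = Some 0 -> Y <> [::] ->
  starts_push Y /\ ends_pop Y.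
Proof.
case: Y => [|[a|b] Y] //= /andP[/andP[p0 _] al]; last by rewrite leqn0 (gtn_eqF p0).
move=> hr _; split=> //; rewrite /ends_pop.
case/lastP: Y al hr => [|Y [c|c]] al; last by rewrite /= last_rcons.
  by case; lia.
have := al; rewrite all_rcons /= => /andP[/andP[c0 _] _].
rewrite -cats1 hrun_cat; case: (hrun _ Y) => //= h []; lia.
Qed.

Lemma sorted_map_Push p : sorted red2 (map Push p).
Proof. by case: p => //= a p; elim: p a => //= b p IH a. Qed.

Lemma sorted_map_Pop q : sorted red2 (map Pop q).
Proof. by case: q => //= a q; elim: q a => //= b q IH a. Qed.

(** A nonempty balanced [Y] starts with a push and ends with a pop, so no block of [p] or [q] takes
    part in a peak. The sizes of these blocks can therefore be changed without losing
    reducedness. *)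
Lemma sorted_segment s t X p Y q Z : all (op_in s t) Y -> hrun 0 Y = Some 0 -> Y <> [::] ->
  sorted red2 (X ++ map Push p ++ Y ++ map Pop q ++ Z) =
  [&& sorted red2 X, sorted red2 Y & sorted red2 Z].
Proof.
move=> al hY Y0; have [sY eY] := balanced_ends al hY Y0.
have sYr r : starts_push (Y ++ r) by move: sY; case: (Y).
have eYq : ends_pop (Y ++ map Pop q).
  move: eY; rewrite /ends_pop last_cat; case: (last _ Y) => // b _.
  by elim: q b => //=.
rewrite sorted_cat_push; last by case: (p) => //; apply: sYr.
rewrite sorted_cat_push // sorted_map_Push /= catA sorted_cat_pop // sorted_cat_pop //.
by rewrite sorted_map_Pop andbT.
Qed.

Lemma block_list_ones a l : a <= size l -> block_list (nseq a 1) l = rev (take a l).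
Proof.
elim: a l => [|a IH] [|x l] //= al.
rewrite block_list_cons /=; last by rewrite sumn_nseq; lia.
by rewrite ?drop0 ?take0 IH // rev_cons cats1.
Qed.

(** A reduced substitute for [Push a] followed by [Pop a]: the unit pushes and the unit pops both
    reverse the elements, which restores their order. *)
Definition units (a : nat) : seq op := map Push (nseq a 1) ++ map Pop (nseq a 1).

Lemma foldl_units a inp wk out : a <= size inp ->
  foldl step (inp, wk, out) (units a) = (drop a inp, wk, take a inp ++ out).
Proof.
move=> al; rewrite /units foldl_cat foldl_pushes sumn_nseq mul1n // block_list_ones //.
have sz : size (rev (take a inp)) = a by rewrite size_rev size_takel.
rewrite foldl_pops ?sumn_nseq ?mul1n ?size_cat ?sz ?leq_addr //.
rewrite block_list_ones ?size_cat ?sz ?leq_addr //.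
by rewrite drop_size_cat // take_size_cat // revK.
Qed.

Lemma units_ok s t a : 0 < s -> 0 < t -> [/\ all (op_in s t) (units a), sorted red2 (units a),
  push_sizes (units a) = nseq a 1 & forall h, hrun h (units a) = Some h].
Proof.
move=> s0 t0; split.
- by rewrite /units all_cat !map_nseq !all_nseq /= s0 t0 !orbT.
- suff so w : all (fun o => match o with Push a => a == 1 | Pop b => b == 1 end) w ->
    sorted red2 w by apply: so; rewrite /units all_cat !map_nseq !all_nseq /= !orbT.
  case: w => //= o w /andP[]; elim: w o => //= o' w IH o h /andP[h' al].
  rewrite IH // andbT /red2; case: o h => // c /eqP->; case: o' h' => // c' /eqP->; done.
- by rewrite /units push_sizes_cat push_sizes_Push push_sizes_Pop cats0.
- by move=> h; rewrite /units hrun_cat hrun_Push /= hrun_Pop !sumn_nseq !mul1n leq_addl addnK.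
Qed.

(** Equality of whole configurations, on every sufficiently long input: unlike [equivalent], it
    applies to prefixes and survives appending operations. *)
Definition simulates (v w : seq op) : Prop :=
  sumn (push_sizes v) = sumn (push_sizes w) /\
  forall inp, sumn (push_sizes w) <= size inp ->
    foldl step (inp, [::], [::]) v = foldl step (inp, [::], [::]) w.

Lemma sorted_rcons_r v o : sorted red2 (rcons v o) -> sorted red2 v.
Proof. by rewrite -cats1; case: v => //= x v; rewrite cat_path => /andP[]. Qed.

(* Appending a pop after a push of a different size creates a redex; the
   leftover pop is moved before the push, where the prefix is shorter. *)
Lemma reduce_pop s t v b h : 0 < s -> 0 < t -> all (op_in s t) v -> sorted red2 v ->
  0 < b <= t -> hrun 0 (rcons v (Pop b)) = Some h ->
  exists v', [/\ all (op_in s t) v', sorted red2 v', hrun 0 v' = Some h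
    & simulates v' (rcons v (Pop b))].
Proof.
move=> s0 t0; elim/last_ind: v b h => [|v o IH] b h al so bt hr.
  by move: hr => /=; case: b bt.
case: o al so hr => [a|c] al so hr; last first.
  exists (rcons (rcons v (Pop c)) (Pop b)); split=> //.
    by rewrite all_rcons al /= bt.
  by rewrite -(cats1 (rcons v (Pop c))) sorted_cat_pop ?so // /ends_pop last_rcons.
have := al; rewrite all_rcons /= => /andP[/andP[a0 as_] alv].
have sov := sorted_rcons_r so.
have [h1 hv] : exists h1, hrun 0 v = Some h1.
  by move: hr; rewrite -!cats1 -catA hrun_cat; case: (hrun 0 v) => // h1 _; exists h1.
have [bh eh] : b <= h1 + a /\ h = h1 + a - b.
  by move: hr; rewrite -!cats1 -catA hrun_cat hv /=; case: ifP => // ? [].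
have stackv inp : sumn (push_sizes v) <= size inp ->
    exists inp' wk out, [/\ foldl step (inp, [::], [::]) v = (inp', wk, out),
      size wk = h1 & size inp' = size inp - sumn (push_sizes v)].
  move=> le; have [i [T [o [sT H]]]] := @foldl_frame v inp [::] [::] h1 hv le.
  have := H [::]; rewrite /= cats0 => E; exists i, T, o; split=> //.
  by have := foldl_input v (inp, [::], [::]); rewrite E /= => ->; rewrite size_drop.
have psz : push_sizes (rcons (rcons v (Push a)) (Pop b)) = rcons (push_sizes v) a.
  by rewrite -!cats1 -catA push_sizes_cat.
(* If [a < b], the pop takes the pushed block and [b - a] elements below it: pop these before, then
   pass [a] elements through. If [a = b], the block only passes through. If [a > b], its first [b]
   elements pass through and the others are pushed. *)
have [ab|ba] := ltnP a b.
- have [||v1 [al1 so1 hr1 [ps1 sim1]]] := IH (b - a) (h1 + a - b) alv sov.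
  + lia.
  + by rewrite -cats1 hrun_cat hv /= (_ : b - a <= h1); [congr Some; lia | lia].
  have [alu sou psu hru] := units_ok a s0 t0.
  have psv : push_sizes (rcons v (Pop (b - a))) = push_sizes v.
    by rewrite -cats1 push_sizes_cat cats0.
  exists (v1 ++ units a); split.
  + by rewrite all_cat al1.
  + by rewrite sorted_cat_push ?so1 //; rewrite /units; case: (a) a0.
  + by rewrite hrun_cat hr1 /= hru eh.
  split=> [|inp]; rewrite psz.
    by rewrite (push_sizes_cat v1) psu sumn_rcons sumn_cat ps1 psv sumn_nseq; lia.
  rewrite sumn_rcons => le; rewrite foldl_cat sim1 ?psv; last lia.
  rewrite !foldl_rcons; have [|inp' [wk [out [-> sw si]]]] := stackv inp; first lia.
  rewrite /= foldl_units; last lia.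
  have sa : size (take a inp') = a by rewrite size_takel //; lia.
  by rewrite drop_cat take_cat sa ltnNge (ltnW ab) /= catA.
- have [alu sou psu hru] := units_ok b s0 t0.
  have [eab|nab] := eqVneq a b.
    exists (v ++ units b); split.
    + by rewrite all_cat alv.
    + by rewrite sorted_cat_push ?sov //; rewrite /units; case: (b) bt.
    + by rewrite hrun_cat hv /= hru eh eab addnK.
    split=> [|inp]; rewrite psz.
      by rewrite (push_sizes_cat v) psu sumn_rcons sumn_cat sumn_nseq; lia.
    rewrite sumn_rcons => le; rewrite foldl_cat !foldl_rcons.
    have [|inp' [wk [out [-> sw si]]]] := stackv inp; first lia.
    have sa : size (take a inp') = a by rewrite size_takel //; lia.
    rewrite /= foldl_units; last lia.
    by rewrite -eab drop_size_cat // take_size_cat.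
  exists (v ++ units b ++ [:: Push (a - b)]); split.
  + rewrite all_cat (all_cat _ (units b)) alv alu /= andbT; lia.
  + rewrite sorted_cat_push; last by rewrite /units; case: (b) bt.
    by rewrite sorted_cat_push // sov sou.
  + by rewrite hrun_cat hv /= (hrun_cat _ (units b)) hru /= eh; congr Some; lia.
  split=> [|inp]; rewrite psz.
    rewrite (push_sizes_cat v) (push_sizes_cat (units b)) psu sumn_rcons !sumn_cat sumn_nseq /=.
    by lia.
  rewrite sumn_rcons => le; rewrite foldl_cat (foldl_cat _ _ (units b)) !foldl_rcons.
  have [|inp' [wk [out [-> sw si]]]] := stackv inp; first lia.
  have sa : size (take a inp') = a by rewrite size_takel //; lia.
  rewrite foldl_units /=; last lia.
  rewrite drop_drop drop_cat take_cat sa.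
  have -> : b < a by lia.
  by rewrite subnK // take_drop subnK // take_takel.
Qed.

Lemma reduce_exists s t w h : 0 < s -> 0 < t -> all (op_in s t) w -> hrun 0 w = Some h ->
  exists v, [/\ all (op_in s t) v, sorted red2 v, hrun 0 v = Some h & simulates v w].
Proof.
move=> s0 t0; elim/last_ind: w h => [|w o IH] h al hr.
  by exists [::]; split=> //; split.
move: al; rewrite all_rcons => /andP[ho al].
have [h1 hw] : exists h1, hrun 0 w = Some h1.
  by move: hr; rewrite -cats1 hrun_cat; case: (hrun 0 w) => // h1 _; exists h1.
have [v [alv sov hv [psv simv]]] := IH h1 al hw.
have hvo : hrun 0 (rcons v o) = Some h.
  by rewrite -hr -!cats1 !hrun_cat hv hw.
have simo : simulates (rcons v o) (rcons w o).
  split=> [|inp]; first by rewrite -!cats1 !push_sizes_cat !sumn_cat psv.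
  rewrite -cats1 push_sizes_cat sumn_cat => le.
  by rewrite foldl_cat foldl_rcons simv //; lia.
case: o ho hr hvo simo => [a|b] ho hr hvo simo.
  exists (rcons v (Push a)); split=> //; first by rewrite all_rcons ho.
  by rewrite -cats1 sorted_cat_push ?sov.
have [v' [h1' h2 h3 [h4 h5]]] := reduce_pop s0 t0 alv sov ho hvo.
case: simo => e1 e2; exists v'; split=> //; split; first by rewrite h4.
by move=> inp le; rewrite h5 ?e2 // e1.
Qed.

(** A proper prefix is not declared smaller; the lists compared here have positive entries and equal
    sums, so neither is a proper prefix of the other. *)
Fixpoint lexlt (u v : seq nat) : bool :=
  match u, v with
  | x :: u', y :: v' => (x < y) || ((x == y) && lexlt u' v')
  | _, _ => false
  end.

Lemma lexlt_cat u v a b : lexlt u v -> lexlt (u ++ a) (v ++ b).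
Proof.
elim: u v => [|x u IH] [|y v] //= /orP[->//|/andP[-> /IH ->]].
by rewrite orbT.
Qed.

Lemma lexlt_prefix u a b : lexlt a b -> lexlt (u ++ a) (u ++ b).
Proof. by move=> h; elim: u => //= x u ->; rewrite eqxx orbT. Qed.

Lemma lexlt_split k k' u v a b : sizes_in k u -> sizes_in k' v -> sumn u = sumn v ->
  lexlt (u ++ a) (v ++ b) -> lexlt u v \/ u = v /\ lexlt a b.
Proof.
elim: u v => [|x u IH] [|y v] //=.
- by move=> _ _ _; right.
- by move=> _ /andP[h _]; lia.
- by move=> /andP[h _]; lia.
move=> /andP[h /IH{}IH] /andP[h' /IH{}IH] e /orP[->|/andP[/eqP exy]]; first by left.
rewrite exy eqxx ltnn /= => /IH; case=> [|->|[-> ->]]; [lia|by left|by right].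
Qed.

Lemma lexlt_total k u v : sizes_in k u -> sizes_in k v -> sumn u = sumn v ->
  ~~ lexlt u v -> ~~ lexlt v u -> u = v.
Proof.
elim: u v => [|x u IH] [|y v] //=.
- by move=> _ /andP[h _]; lia.
- by move=> /andP[h _]; lia.
move=> /andP[_ h1] /andP[_ h2] e; rewrite !negb_or => /andP[xy n1] /andP[yx n2].
have exy : x = y by lia.
move: n1 n2; rewrite exy eqxx /= => n1 n2.
by rewrite (IH v) //; lia.
Qed.

(** The number with digits [u] in base [B], padded to length [L]. It makes the lexicographic descent
    terminate, since the number of blocks is bounded by the total size. *)
Fixpoint lexval (B L : nat) (u : seq nat) : nat :=
  match L, u with
  | L'.+1, x :: u' => x * B ^ L' + lexval B L' u'
  | _, _ => 0
  end.

Lemma lexval_lt B L u : 0 < B -> all (fun x => x < B) u -> lexval B L u < B ^ L.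
Proof.
move=> B0; elim: L u => [|L IH] [|x u] //=; rewrite ?expn_gt0 ?B0 //.
by move=> /andP[xB /IH h]; rewrite expnS; nia.
Qed.

Lemma lexlt_val B L u v : all (fun x => x < B) u -> all (fun x => x < B) v ->
  size u <= L -> lexlt u v -> lexval B L u < lexval B L v.
Proof.
elim: L u v => [|L IH] [|x u] [|y v] //= /andP[xB hu] /andP[yB hv] sz.
case/orP => [lt|/andP[/eqP-> lt]]; last by rewrite ltn_add2l IH.
have := lexval_lt L (leq_ltn_trans (leq0n x) xB) hu; nia.
Qed.

Definition op_amount (o : op) : nat := match o with Push a => a | Pop b => b end.

(* Least block sizes, in lexicographic order, among all the admissible ways to
   permute the arcs of the segment in the same manner. *)
Definition good (s t : nat) (p q : seq nat) : Prop :=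
  forall p' q', sizes_in s p' -> sizes_in t q' -> sumn p' = sumn p -> sumn q' = sumn q ->
    pair_equiv p q p' q' -> ~~ lexlt (p' ++ q') (p ++ q).

Definition canonical (s t : nat) (w : seq op) : Prop :=
  forall X p Y q Z, w = X ++ map Push p ++ Y ++ map Pop q ++ Z ->
    hrun 0 Y = Some 0 -> Y <> [::] -> sumn p = sumn q -> good s t p q.

Lemma op_in_Push s t p : all (op_in s t) (map Push p) = sizes_in s p.
Proof. by elim: p => //= a p ->. Qed.

Lemma op_in_Pop s t q : all (op_in s t) (map Pop q) = sizes_in t q.
Proof. by elim: q => //= a p ->. Qed.

Lemma size_op_amount s t w : all (op_in s t) w ->
  size (map op_amount w) <= sumn (push_sizes w) + sumn (pop_sizes w).
Proof. by elim: w => //= -[a|b] w IH /= /andP[h /IH]; lia. Qed.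

Lemma op_amount_lt s t w : all (op_in s t) w ->
  all (fun x => x < (s + t).+1) (map op_amount w).
Proof. by elim: w => //= -[a|b] w IH /= /andP[h /IH ->]; rewrite andbT; lia. Qed.

Lemma simulates_equivalent v w : simulates v w -> equivalent v w.
Proof.
case=> e H; have eo : op_size v = op_size w by rewrite /op_size !total_pushE.
by split=> //; rewrite /output eo H // size_iota /op_size total_pushE.
Qed.

Lemma equivalent_trans u v w : equivalent u v -> equivalent v w -> equivalent u w.
Proof. by case=> e1 e2 [e3 e4]; split; [rewrite e1 | rewrite e2]. Qed.

(** As long as some segment is not good, it is replaced by a smaller admissible one. The total size
    is unchanged, so the values [val] are taken with the same length and strictly decrease. *)
Lemma canonical_exists_reduced s t w : all (op_in s t) w -> sorted red2 w ->
  hrun 0 w = Some 0 -> exists w', [/\ all (op_in s t) w', sorted red2 w',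
    hrun 0 w' = Some 0, equivalent w w' & canonical s t w'].
Proof.
set val := fun w : seq op =>
  lexval (s + t).+1 (sumn (push_sizes w) + sumn (pop_sizes w)) (map op_amount w).
have [k] := ubnP (val w); elim: k w => // k IH w vk al so hr.
have [can|] := classic (canonical s t w); first by exists w.
rewrite /canonical => /not_all_ex_not[X /not_all_ex_not[p /not_all_ex_not[Y]]].
move=> /not_all_ex_not[q /not_all_ex_not[Z ncan]].
have [ew n1] := imply_to_and _ _ ncan; have [hY n2] := imply_to_and _ _ n1.
have [Y0 n3] := imply_to_and _ _ n2; have [epq n4] := imply_to_and _ _ n3.
move: n4; rewrite /good => /not_all_ex_not[p' /not_all_ex_not[q' n5]].
have [sp n6] := imply_to_and _ _ n5; have [sq n7] := imply_to_and _ _ n6.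
have [ep n8] := imply_to_and _ _ n7; have [eq n9] := imply_to_and _ _ n8.
have [pe n10] := imply_to_and _ _ n9.
have lt : lexlt (p' ++ q') (p ++ q) by apply/negPn/negP.
set w' := X ++ map Push p' ++ Y ++ map Pop q' ++ Z.
have [hw' eqv] : hrun 0 w' = Some 0 /\ equivalent w w'.
  by rewrite ew; apply: replace_segment; rewrite -?ew.
have := al; rewrite ew !all_cat => /and5P[aX ap aY aq aZ].
rewrite op_in_Push in ap; rewrite op_in_Pop in aq.
have al' : all (op_in s t) w' by rewrite !all_cat aX aY aZ op_in_Push op_in_Pop sp sq.
have so' : sorted red2 w'.
  by rewrite (sorted_segment _ _ _ _ aY hY Y0) -(sorted_segment X p q Z aY hY Y0) -ew.
have vlt : val w' < val w.
  have eL : sumn (push_sizes w') + sumn (pop_sizes w') =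
            sumn (push_sizes w) + sumn (pop_sizes w).
    rewrite ew /w' !push_sizes_cat !pop_sizes_cat !sumn_cat.
    by rewrite !push_sizes_Push !push_sizes_Pop !pop_sizes_Push !pop_sizes_Pop ep eq.
  rewrite /val eL; apply: lexlt_val; try exact: op_amount_lt.
    by rewrite -eL; apply: size_op_amount al'.
  rewrite ew /w' !map_cat -!map_comp; apply: lexlt_prefix.
  have mP u : map (op_amount \o Push) u = u by elim: u => //= a u ->.
  rewrite !mP.
  have [h|[-> h]] := lexlt_split sp ap ep lt; first exact: lexlt_cat.
  apply: lexlt_prefix; apply: lexlt_prefix; exact: lexlt_cat.
have [w2 [h1 h2 h3 h4 h5]] := IH w' (leq_trans vlt vk) al' so' hw'.
by exists w2; split=> //; rewrite -ew; exact: equivalent_trans eqv h4.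
Qed.

Lemma canonical_exists s t w : 0 < s -> 0 < t -> all (op_in s t) w -> hrun 0 w = Some 0 ->
  exists w', [/\ all (op_in s t) w', sorted red2 w',
    hrun 0 w' = Some 0, equivalent w w' & canonical s t w'].
Proof.
move=> s0 t0 al hr; have [v [h1 h2 h3 /simulates_equivalent [e1 e2]]] := reduce_exists s0 t0 al hr.
have [w' [k1 k2 k3 k4 k5]] := canonical_exists_reduced h1 h2 h3.
by exists w'; split=> //; exact: equivalent_trans (conj (esym e1) (esym e2)) k4.
Qed.

(** * From positions back to factorizations of words *)

Lemma uflags_cat sz1 sz2 : uflags (sz1 ++ sz2) = uflags sz1 ++ uflags sz2.
Proof. by rewrite /uflags map_cat flatten_cat. Qed.

Lemma unc_catr b sz1 sz2 i : sizes_in b sz1 ->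
  unc (sz1 ++ sz2) (sumn sz1 + i) = unc sz2 i.
Proof.
move=> h; rewrite /unc uflags_cat nth_cat (size_uflags h) ltnNge leqW ?leq_addr //=.
by rewrite -addnS addKn.
Qed.

Lemma unc_catl b sz1 sz2 i : sizes_in b sz1 -> i.+1 < sumn sz1 ->
  unc (sz1 ++ sz2) i = unc sz1 i.
Proof. by move=> h lt; rewrite /unc uflags_cat nth_cat (size_uflags h) lt. Qed.

Lemma split_at_push s t w x : all (op_in s t) w -> x < sumn (push_sizes w) ->
  (x == 0) || ~~ unc (push_sizes w) x.-1 ->
  exists X a W, w = X ++ Push a :: W /\ sumn (push_sizes X) = x.
Proof.
elim: w x => [|[a|b] w IH] x //= /andP[/andP[p0 _] al] lt.
  case: (posnP x) => [->|x0] /= cx; first by exists [::], a, w.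
  move: cx; rewrite unc_cons // prednK //.
  have [//|ax] := ltnP x a.
  case: (eqVneq x a) => [eq _|ne cx].
    have [|//|X [a' [W [-> e]]]] := IH 0 al; first lia.
    by exists (Push a :: X), a', W; split=> //=; rewrite e; lia.
  have [||X [a' [W [-> e]]]] := IH (x - a) al; first lia.
    by rewrite (_ : (x - a).-1 = x.-1 - a) ?cx ?orbT //; lia.
  by exists (Push a :: X), a', W; split=> //=; rewrite e; lia.
move=> cx; have [X [a [W [-> e]]]] := IH x al lt cx.
by exists (Pop b :: X), a, W.
Qed.

Lemma split_at_pop s t w x : all (op_in s t) w -> x < sumn (pop_sizes w) ->
  (x == 0) || ~~ unc (pop_sizes w) x.-1 ->
  exists X a W, w = X ++ Pop a :: W /\ sumn (pop_sizes X) = x.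
Proof.
elim: w x => [|[b|a] w IH] x //= /andP[/andP[p0 _] al] lt.
  move=> cx; have [X [a [W [-> e]]]] := IH x al lt cx.
  by exists (Push b :: X), a, W.
case: (posnP x) => [->|x0] /= cx; first by exists [::], a, w.
move: cx; rewrite unc_cons // prednK //.
have [//|ax] := ltnP x a.
case: (eqVneq x a) => [eq _|ne cx].
  have [|//|X [a' [W [-> e]]]] := IH 0 al; first lia.
  by exists (Pop a :: X), a', W; split=> //=; rewrite e; lia.
have [||X [a' [W [-> e]]]] := IH (x - a) al; first lia.
  by rewrite (_ : (x - a).-1 = x.-1 - a) ?cx ?orbT //; lia.
by exists (Pop a :: X), a', W; split=> //=; rewrite e; lia.
Qed.

Lemma downs_before_ge k w i : i < sumn (push_sizes w) -> k <= nth 0 (downs_before k w) i.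
Proof.
elim: w k i => [|[a|b] w IH] k i //= lt.
  rewrite nth_cat size_nseq nth_nseq; case: ltnP => // h; apply: IH; lia.
by apply: leq_trans (IH (k + b) i lt); rewrite leq_addr.
Qed.

Lemma ups_before_ge k w i : i < sumn (pop_sizes w) -> k <= nth 0 (ups_before k w) i.
Proof.
elim: w k i => [|[b|a] w IH] k i //= lt.
  by apply: leq_trans (IH (k + b) i lt); rewrite leq_addr.
rewrite nth_cat size_nseq nth_nseq; case: ltnP => // h; apply: IH; lia.
Qed.

Lemma push_run s t w m k : all (op_in s t) w -> m < sumn (push_sizes w) ->
  nth 0 (downs_before k w) m = k -> ~~ unc (push_sizes w) m ->
  exists p W, w = map Push p ++ W /\ sumn p = m.+1.
Proof.
elim: w m => [|[a|b] w IH] m //= /andP[/andP[p0 _] al] lt.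
  rewrite nth_cat size_nseq unc_cons //.
  have [//|am] := ltnP m.+1 a.
  case: (eqVneq m.+1 a) => [<-|ne]; first by exists [:: m.+1], w; rewrite /= addn0.
  rewrite (_ : m < a = false); last lia.
  move=> h1 h2; have [|p [W [-> e]]] := IH _ al _ h1 h2; first lia.
  by exists (a :: p), W; rewrite /= e; split=> //; lia.
by move=> e; have := downs_before_ge (k + b) lt; lia.
Qed.

Lemma pop_run s t w m k : all (op_in s t) w -> m < sumn (pop_sizes w) ->
  nth 0 (ups_before k w) m = k -> ~~ unc (pop_sizes w) m ->
  exists q W, w = map Pop q ++ W /\ sumn q = m.+1.
Proof.
elim: w m => [|[b|a] w IH] m //= /andP[/andP[p0 _] al] lt.
  by move=> e; have := ups_before_ge (k + b) lt; lia.
rewrite nth_cat size_nseq unc_cons //.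
have [//|am] := ltnP m.+1 a.
case: (eqVneq m.+1 a) => [<-|ne]; first by exists [:: m.+1], w; rewrite /= addn0.
rewrite (_ : m < a = false); last lia.
move=> h1 h2; have [|p [W [-> e]]] := IH _ al _ h1 h2; first lia.
by exists (a :: p), W; rewrite /= e; split=> //; lia.
Qed.

Lemma prefix_cases (T : Type) (A B C D : seq T) : A ++ B = C ++ D ->
  (exists Y, C = A ++ Y /\ B = Y ++ D) \/ (exists o Y, A = C ++ o :: Y).
Proof.
elim: A C => [|x A IH] [|y C] /= e; first by left; exists [::].
- by left; exists (y :: C).
- by right; exists x, A.
case: e => <- /IH[[Y [-> ->]]|[o [Y ->]]]; first by left; exists Y.
by right; exists o, Y.
Qed.

Lemma uinv_foldl S c : uinv c -> uinv (foldl ustep c S).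
Proof. by elim: S c => //= b S IH c /(uinv_step b) /IH. Qed.

(** A popped up is recorded in [dl] for good, and [uinv] keeps open and matched ups distinct. So if
    [z] is on top at the end, it has never been popped, and [w] has consumed exactly what was above
    it. *)
Lemma balanced_of_return w T z S dl ru rd k : uinv (T ++ z :: S, dl, ru, rd) ->
  hrun (size (T ++ z :: S)) w = Some k ->
  (exists S', open_ups (foldl ustep (T ++ z :: S, dl, ru, rd) (shape w)) = z :: S') ->
  hrun (size T) w = Some 0.
Proof.
elim: w T dl ru rd => [|[a|b] w IH] T dl ru rd inv /=.
- move=> _ [S' e]; case: T inv e => //= y T inv [ey _]; subst y.
  by case: inv => -[_ + _ _] _ _ _; rewrite /= mem_cat mem_cat inE eqxx orbT.
- have := uinv_foldl (nseq a true) inv.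
  rewrite foldl_cat ustep_pushes catA => inv' hr H.
  have hr' : hrun (size ((rev (iota (size ru) a) ++ T) ++ z :: S)) w = Some k.
    rewrite -hr; congr hrun; rewrite !size_cat size_rev size_iota /=; lia.
  by have := IH _ _ _ _ inv' hr' H; rewrite size_cat size_rev size_iota addnC.
- case: ifP => // bsz hr; rewrite foldl_cat ustep_pops //.
  have := uinv_foldl (nseq b false) inv; rewrite ustep_pops // => inv'.
  case: (leqP b (size T)) => bT H.
    have eT : drop b (T ++ z :: S) = drop b T ++ z :: S.
      rewrite drop_cat; case: ltnP => // h.
      by rewrite (_ : b = size T) ?subnn ?drop0 ?drop_size //; lia.
    rewrite eT in inv' H; rewrite -size_drop; apply: IH inv' _ H.
    by rewrite -eT size_drop.
  have hsz : hrun (size (drop b (T ++ z :: S))) w = Some k by rewrite size_drop.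
  have [st' [e [E _ _]]] := foldl_shape (dl ++ take b (T ++ z :: S)) ru
     (rd ++ nseq b (size ru)) hsz.
  have := uinv_foldl (shape w) inv'; rewrite E => -[[_ U _ _] _ _ _].
  case: H => S'; rewrite E /open_ups /= => est.
  move: U; rewrite est /= !mem_cat => /andP[/negP[]].
  rewrite take_cat ltnNge (ltnW bT) /= mem_cat.
  by rewrite -[b - size T]prednK ?subn_gt0 //= inE eqxx !orbT.
Qed.

Section Extract.

Variable w : seq op.
Hypothesis hw : hrun 0 w = Some 0.

Let n := sumn (push_sizes w).
Let dl := matched_ups (run w).

Lemma run_total : run w = ([::], dl, downs_before 0 w, ups_before 0 w) /\ size dl = n.
Proof.
have [st [dl' [E h1 h2]]] := run_ok hw; rewrite /dl E /matched_ups /=.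
by rewrite (size0nil h1) h2 /n; have := hrun_total hw; rewrite !add0n => ->.
Qed.

Lemma matching_facts :
  [/\ forall j, j < n -> nth 0 dl j < n, forall i, i < n -> index i dl < n,
      forall j, j < n -> index (nth 0 dl j) dl = j & forall i, i < n -> nth 0 dl (index i dl) = i]
  /\ [/\ forall j, j < n -> nth 0 (ups_before 0 w) j <= n,
      forall c j, c < n -> j < n ->
        (nth 0 (downs_before 0 w) c <= j) = (c < nth 0 (ups_before 0 w) j),
      forall c, c < n -> nth 0 (downs_before 0 w) c <= index c dl
    & forall c c', c < c' -> c' < n ->
        index c dl < nth 0 (downs_before 0 w) c' \/ index c' dl < index c dl].
Proof.
have [E sz] := run_total; have := uinv_run (shape w); rewrite -/(run w) E.
move=> [[I1 I2 _ I4] [G1 G2 G3] O NC].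
have sru : size (downs_before 0 w) = n by rewrite size_downs_before.
have srd : size (ups_before 0 w) = n by rewrite I1.
rewrite sru in I4 G3 NC G2; rewrite sz in G3 G1.
have mem i : i < n -> i \in dl by rewrite -I4.
split; split.
- by move=> j jn; rewrite -I4 mem_nth ?sz.
- by move=> i /mem; rewrite -index_mem sz.
- by move=> j jn; rewrite index_uniq ?sz.
- by move=> i /mem h; rewrite nth_index.
- by move=> j jn; move/all_nthP: G2; apply; rewrite srd.
- exact: G3.
- by move=> c /mem; exact: O.
- move=> c c' cc cn; have /mem h : c < n by lia.
  by case: (NC c c' cc cn h) => [|[]]; [left|right].
Qed.

(** The cuts at the ends allow the word to be split there; belonging to one up-run and one down-run
    makes the two pieces consist of pushes only and of pops only. *)
Lemma extract_segment s t (al : all (op_in s t) w) x y :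
  let P := unc (push_sizes w) in let Q := unc (pop_sizes w) in
  x <= y < n ->
  nth 0 (downs_before 0 w) y = nth 0 (downs_before 0 w) x ->
  nth 0 (ups_before 0 w) (index x dl) = nth 0 (ups_before 0 w) (index y dl) ->
  index x dl = index y dl + (y - x) ->
  (x == 0) || ~~ P x.-1 -> ~~ P y -> ~~ Q (index x dl) ->
  (index y dl == 0) || ~~ Q (index y dl).-1 ->
  exists X p Y q Z, [/\ w = X ++ map Push p ++ Y ++ map Pop q ++ Z, hrun 0 Y = Some 0,
    sumn p = (y - x).+1 /\ sumn q = (y - x).+1,
    forall i, i < y - x -> unc p i = P (x + i)
  & forall i, i < y - x -> unc q i = Q (index y dl + i)].
Proof.
move=> P Q /andP[xy yn] eru erd ei cPx cPy cQx cQy.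
have [[F1 F2 F3 F4] [F5 F6 F7 F8]] := matching_facts.
have [X [a [W [eX sX]]]] := split_at_push al (leq_ltn_trans xy yn) cPx.
have alX : sizes_in s (push_sizes X).
  by apply: (@sizes_in_push s t); move: al; rewrite eX all_cat => /andP[].
have alW : all (op_in s t) (Push a :: W) by move: al; rewrite eX all_cat => /andP[].
have szX := size_downs_before 0 X; rewrite sX in szX.
have tot : n = x + sumn (push_sizes (Push a :: W)).
  by rewrite /n eX push_sizes_cat sumn_cat sX.
have [p [W' [eW sp]]] : exists p W', Push a :: W = map Push p ++ W' /\ sumn p = (y - x).+1.
  apply: (push_run (k := sumn (pop_sizes X)) alW).
  - lia.
  - move: eru; rewrite eX downs_before_cat !nth_cat szX ltnn subnn (ltnNge y) xy /=.
    move=> ->; case/andP: alW => /andP[]; case: (a) => //.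
  - by move: cPy; rewrite /P eX push_sizes_cat -{1}(subnKC xy) -{1}sX (unc_catr _ _ alX).
have vn : index y dl < n by exact: F2.
have npop : sumn (pop_sizes w) = n by rewrite /n; have := hrun_total hw.
have [X2 [b [W2 [eX2 sX2]]]] : exists X b W, w = X ++ Pop b :: W /\ sumn (pop_sizes X) = index y dl.
  by apply: (split_at_pop al) => //; rewrite npop.
have alX2 : sizes_in t (pop_sizes X2).
  by apply: (@sizes_in_pop s t); move: al; rewrite eX2 all_cat => /andP[].
have alW2 : all (op_in s t) (Pop b :: W2) by move: al; rewrite eX2 all_cat => /andP[].
have szX2 := size_ups_before 0 X2; rewrite sX2 in szX2.
have b0 : 0 < b by case/andP: alW2 => /andP[].
have xn : index x dl < n by apply: F2; lia.
have tot2 : n = index y dl + sumn (pop_sizes (Pop b :: W2)).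
  by rewrite -npop eX2 pop_sizes_cat sumn_cat sX2.
have rdv : nth 0 (ups_before 0 w) (index y dl) = sumn (push_sizes X2).
  by rewrite eX2 ups_before_cat nth_cat szX2 ltnn subnn /=; case: (b) b0.
have [q [Z [eW2 sq]]] : exists q Z, Pop b :: W2 = map Pop q ++ Z /\ sumn q = (y - x).+1.
  apply: (pop_run (k := sumn (push_sizes X2)) alW2).
  - lia.
  - move: erd; rewrite rdv ei {1}eX2 ups_before_cat nth_cat szX2 ltnNge leq_addr /= addKn.
    by [].
  - by move: cQx; rewrite /Q eX2 pop_sizes_cat ei -{1}sX2 (unc_catr _ _ alX2).
have rdy : y < sumn (push_sizes X2) by rewrite -rdv -F6 // F7.
have eA : (X ++ map Push p) ++ W' = X2 ++ Pop b :: W2 by rewrite -catA -eW -eX.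
have sA : sumn (push_sizes (X ++ map Push p)) = y.+1.
  by rewrite push_sizes_cat push_sizes_Push sumn_cat sX sp; lia.
have [p1 [c ep]] : exists p1 c, p = rcons p1 c.
  by case/lastP: (p) sp => // p1 c _; exists p1, c.
have c0 : 0 < c.
  move: alW; rewrite eW all_cat ep map_rcons all_rcons /= => /andP[/andP[/andP[]]] //.
(* Up [y] belongs to the last push of [p] and precedes its down ([rdy]), so the pops cannot begin
   before the pushes are complete. *)
have [[Y [eC eW']]|[o [Y eC]]] := prefix_cases eA; last first.
  exfalso; move: sA; rewrite eC push_sizes_cat sumn_cat.
  have : exists Y', o :: Y = rcons Y' (Push c).
    move: eC; rewrite ep map_rcons -rcons_cat.
    case/lastP: Y => [|Y' o']; first by rewrite cats1 => /rcons_inj[_ <-]; exists [::].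
    by rewrite -rcons_cons -rcons_cat => /rcons_inj[_ <-]; exists (o :: Y').
  case=> Y' ->; rewrite -cats1 push_sizes_cat sumn_cat /=; lia.
(* Up [y] is on top of the stack after the pushes, and it is the first arc removed by the pops, so
   it is on top again after [Y]. *)
have bal : hrun 0 Y = Some 0.
  set A := X ++ map Push p.
  have [h hA] : exists h, hrun 0 A = Some h.
    by move: hw; rewrite eX2 eC -catA hrun_cat; case: (hrun 0 A) => // h _; exists h.
  have hX2 : exists h2, hrun 0 X2 = Some h2.
    by move: hw; rewrite eX2 hrun_cat; case: (hrun 0 X2) => // h2 _; exists h2.
  case: hX2 => h2 hX2.
  have headA : exists S, open_ups (run A) = y :: S.
    have eAr : A = (X ++ map Push p1) ++ [:: Push c].
      by rewrite /A ep map_rcons -cats1 catA.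
    have [h1 hA1] : exists h1, hrun 0 (X ++ map Push p1) = Some h1.
      move: hA; rewrite eAr hrun_cat; case: (hrun 0 (X ++ _)) => // h1 _; by exists h1.
    have [st1 [dl1 [E1 _ _]]] := run_ok hA1.
    have sA1 : sumn (push_sizes (X ++ map Push p1)) + c = y.+1.
      by rewrite -sA ep map_rcons -cats1 catA (push_sizes_cat _ [:: Push c]) sumn_cat /= addn0.
    rewrite eAr /run shape_cat match_run_cat -/(run _) E1 /shape /= cats0 ustep_pushes.
    rewrite /open_ups /= size_downs_before.
    rewrite -[c]prednK // -addn1 iotaD rev_cat /=.
    by eexists; congr (_ :: _); lia.
  case: headA => S eS.
  have [stA [dlA [EA szA _]]] := run_ok hA.
  rewrite EA /open_ups /= in eS; subst stA.
  have := uinv_run (shape A); rewrite -/(run A) EA => inv.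
  have hY : hrun (size (y :: S)) Y = Some h2.
    by move: hX2; rewrite eC hrun_cat hA szA.
  apply: (@balanced_of_return Y [::] y S _ _ _ h2 inv hY).
  rewrite /= -EA /run -match_run_cat -shape_cat -eC -/(run X2).
  have [st2 [dl2 [E2 sz2 szd]]] := run_ok hX2.
  have bst : b <= size st2.
    by move: hw; rewrite eX2 hrun_cat hX2 /= sz2; case: ifP.
  have hrest : hrun (size (drop b st2)) W2 = Some 0.
    by move: hw; rewrite eX2 hrun_cat hX2 /= size_drop sz2; case: ifP.
  have eqdl : nth 0 dl (index y dl) = head 0 st2.
    have := run_total; rewrite {1}/run eX2 shape_cat match_run_cat -/(run X2) E2.
    rewrite /shape /= foldl_cat ustep_pops // -/(shape W2).
    have [st' [e [-> _ _]]] := foldl_shape (dl2 ++ take b st2) (downs_before 0 X2)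
      (ups_before 0 X2 ++ nseq b (size (downs_before 0 X2))) hrest.
    case=> -[_ edl _ _] _.
    rewrite -[X in nth 0 X _]edl -catA nth_cat szd sX2 ltnn subnn.
    by case: (b) (st2) b0 bst => // b' [].
  rewrite F4 // in eqdl; rewrite E2 /open_ups /=.
  by case: (st2) eqdl bst => [|z S2] /= ; [case: (b) b0 | move=> -> _; exists S2].
exists X, p, Y, q, Z; split=> //.
- by rewrite eX eW eW' eW2 .
- move=> i iy; rewrite /P eX eW push_sizes_cat -sX (unc_catr _ _ alX).
  rewrite push_sizes_cat push_sizes_Push (@unc_catl s) ?sp //.
  by move: alW; rewrite eW all_cat => /andP[+ _]; rewrite op_in_Push.
- move=> i iy; rewrite /Q eX2 eW2 pop_sizes_cat -sX2 (unc_catr _ _ alX2).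
  rewrite pop_sizes_cat pop_sizes_Pop (@unc_catl t) ?sq //.
  by move: alW2; rewrite eW2 all_cat => /andP[+ _]; rewrite op_in_Pop.
Qed.

End Extract.

(** * The automaton *)

Section Automaton.

(* [check L] decides whether a segment is good; [L] lists its gaps from the
   outermost inwards, each gap recording whether it is inside a push block and
   inside a pop block. *)
Variables (s t N : nat) (check : seq (bool * bool) -> bool).

Definition seg := option (N.-bseq (bool * bool)).

(* [inl None]: at the start or after a peak; [inl (Some b)]: after a push, of
   size 1 iff [b]; [inr (f, g)]: after popping an arc whose lower gap has flag
   [f], inside the segment [g], [None] meaning that nothing is to be checked. *)
Definition phase := (option bool + option bool * seg)%type.

(* Flag of the gap below the arc ([Some true]: same push block; [Some false]:
   other block of the same up-run; [None]: other up-run), whether the arc above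
   is in the same push block, and whether the arc is the lowest one. *)
Definition slot := (option bool * bool * bool)%type.

Definition seg_ok (g : seg) : bool := if g is Some L then check L else true.

(** Arcs are popped from the innermost outwards, so the new gap goes in front. [insub] gives [None]
    once there would be more than [N] gaps, and the segment is then no longer recorded. *)
Definition seg_add (l : bool * bool) (g : seg) : seg :=
  obind (fun L : N.-bseq (bool * bool) => insub (l :: L)) g.

(** A segment whose first arc is joined by its push block to the arc above it is not closed. *)
Definition new_seg (sl : slot) : seg := if sl.1.2 then None else insub [::].

Definition close_ok (ph : phase) : bool :=
  if ph is inr (f, g) then (f == Some true) || seg_ok g else true.

Definition gap_flag (ph : phase) : option bool :=
  if ph is inl (Some _) then Some false else None.

Definition slots (a : nat) (f : option bool) (emp : bool) : seq slot :=
  [seq (if j == a.-1 then f else Some true, 0 < j, (j == a.-1) && emp) | j <- iota 0 a].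

Definition push_next (ph : phase) (a : nat) : option phase :=
  if close_ok ph then Some (inl (Some (a == 1))) else None.

(** Pops one arc; [q] tells that it continues the current pop block, [one] that the pop has size 1,
    as a peak demands. A gap joined by a push or by a pop extends the segment, unless the pop block
    passes to another up-run, where no closed segment is possible. A gap cut on both sides ends the
    segment, which is checked before another one begins. Hence only segments without inner common
    cuts are checked. *)
Definition pop_next (q one : bool) (ph : phase) (sl : slot) : option phase :=
  match ph with
  | inl (Some b) => if ~~ q && b && one then Some (inl None) else None
  | inl None => if q then None else Some (inr (sl.1.1, new_seg sl))
  | inr (f, g) =>
      if f == Some true then Some (inr (sl.1.1, seg_add (true, q) g))
      else if q then
        Some (inr (sl.1.1, if f == Some false then seg_add (false, true) g else None))
      else if seg_ok g then Some (inr (sl.1.1, new_seg sl)) else None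
  end.

Definition fconfig := (phase * bool * seq slot)%type.

Fixpoint pops (q one : bool) (k : nat) (ph : phase) (emp : bool) (G : seq slot) :
    option fconfig :=
  if k is k'.+1 then
    if G is sl :: G' then
      obind (fun ph' => pops true one k' ph' sl.2 G') (pop_next q one ph sl)
    else None
  else Some (ph, emp, G).

(** The automaton as a function on whole operations, with the bottom marker left implicit. *)
Fixpoint frun (c : fconfig) (w : seq op) : option fconfig :=
  match w with
  | [::] => Some c
  | Push a :: w' =>
      obind (fun ph' => frun (ph', false, slots a (gap_flag c.1.1) c.1.2 ++ c.2) w')
        (push_next c.1.1 a)
  | Pop b :: w' => obind (frun^~ w') (pops false (b == 1) b c.1.1 c.1.2 c.2)
  end.

Definition fstart : fconfig := (inl None, true, [::]).

Definition ffinal (ph : phase) (emp : bool) : bool :=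
  [&& emp, close_ok ph & if ph is inl (Some _) then false else true].

Definition faccepts (w : seq op) : Prop :=
  exists c, frun fstart w = Some c /\ ffinal c.1.1 c.1.2.

(** The Boolean tells that no arc is open, information that acceptance by final state cannot take
    from the stack. The last component counts the arcs that the current pop still has to remove by
    silent moves; letters are read only when it is 0, which makes the automaton deterministic. *)
Definition astate : finType := (phase * bool * 'I_t.+1)%type.
Definition astack : finType := option slot.

Definition adelta (q : astate) (x : option (sym s t)) (Z : astack) :
    option (astate * seq astack) :=
  let: (ph, emp, r) := q in
  match x with
  | Some a =>
      if r == ord0 then
        match to_op a with
        | Push a => omap (fun ph' => ((ph', false, ord0) : astate,
                      [seq Some sl | sl <- slots a (gap_flag ph) emp] ++ [:: Z]))
                      (push_next ph a)
        | Pop b => if Z is Some sl then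
              omap (fun ph' => ((ph', sl.2, inord b.-1) : astate, [::]))
                (pop_next false (b == 1) ph sl)
            else None
        end
      else None
  | None =>
      if r == ord0 then None
      else if Z is Some sl then
        omap (fun ph' => ((ph', sl.2, inord r.-1) : astate, [::])) (pop_next true false ph sl)
      else None
  end.

Lemma adelta_det q Z : adelta q None Z != None -> forall a, adelta q (Some a) Z = None.
Proof. by case: q => [[ph emp] r] /=; case: (r == ord0). Qed.

Definition automaton : DPDA (sym s t) :=
  {| dpda_state := astate; dpda_stack := astack; dpda_delta := adelta;
     dpda_start := (inl None, true, ord0); dpda_bottom := None;
     dpda_final := [set q : astate | (q.2 == ord0) && ffinal q.1.1 q.1.2];
     dpda_det := adelta_det |}.

Lemma moves_trans (c1 c2 c3 : config automaton) : moves c1 c2 -> moves c2 c3 -> moves c1 c3.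
Proof. by elim=> // c c' c'' m _ IH /IH; apply: moves_step. Qed.

Definition bstack (G : seq slot) : seq astack := rcons (map Some G) None.

Lemma pops_one q one one' k ph emp G : (k = 0 \/ one = one') ->
  pops q one k ph emp G = pops q one' k ph emp G.
Proof. by case=> [->|->]. Qed.

Lemma pops_moves r ph emp G c w (hr : r < t.+1) : pops true false r ph emp G = Some c ->
  @moves _ automaton ((ph, emp, inord r), w, bstack G) ((c.1, ord0), w, bstack c.2).
Proof.
elim: r ph emp G hr => [|r IH] ph emp G hr /=.
  case=> <-; rewrite (_ : inord 0 = ord0); first exact: moves_refl.
  by apply: val_inj; rewrite /= inordK.
case: G => // sl G; case E: (pop_next _ _ _ _) => [ph'|] //= H.
apply: moves_step (IH _ _ _ _ H); last exact: ltnW.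
apply: (@move_eps _ automaton (ph, emp, inord r.+1) w (Some sl) (bstack G) _ [::]).
rewrite /= -val_eqE /= inordK //= E /=.
by congr (Some (_, _)); congr (_, _, _); apply: val_inj; rewrite /= !inordK.
Qed.

Lemma to_op_size (x : sym s t) : match to_op x with Push a => 0 < a <= s | Pop b => 0 < b <= t end.
Proof. by case: x => i /=; rewrite ltn_ord. Qed.

Lemma faccepts_accepts w : faccepts (map (@to_op s t) w) -> accepts automaton w.
Proof.
case=> c [H F]; exists (c.1, ord0), (bstack c.2); split; last by rewrite inE /= ?eqxx.
suff main v d : frun d (map (@to_op s t) v) = Some c ->
    @moves _ automaton ((d.1, ord0), v, bstack d.2) ((c.1, ord0), [::], bstack c.2).
  exact: (main w fstart H).
elim: v d {H} => [|x v IH] [[ph emp] G] /=; first by case=> <-; exact: moves_refl.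
have := to_op_size x; case E: (to_op x) => [a|b] /= xs.
- case P: (push_next ph a) => [ph'|] //= /IH m.
  apply: moves_step m.
  have [Z [g eG]] : exists Z g, bstack G = Z :: g.
    by case: G => [|sl G]; [exists None, [::] | exists (Some sl), (bstack G)].
  rewrite eG (_ : bstack (_ ++ G) = ([seq Some sl | sl <- slots a (gap_flag ph) emp] ++ [:: Z]) ++ g).
    by apply: (@move_read _ automaton (ph, emp, ord0) x v Z g); rewrite /= E P.
  by rewrite /bstack map_cat rcons_cat -/(bstack G) eG -catA.
- case: b E xs => // b E xs; case: G => // sl G.
  rewrite [pops _ _ _ _ _ _]/=; case P: (pop_next _ _ _ _) => [ph'|] //= H.
  case Q: (pops _ _ _ _ _ _) H => [d|] //= /IH m.
  have Q' : pops true false b ph' sl.2 G = Some d.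
    by rewrite -Q; apply: pops_one; case: (b); [left|right].
  apply: moves_step (moves_trans (pops_moves v _ Q') m); last lia.
  apply: (@move_read _ automaton (ph, emp, ord0) x v (Some sl) (bstack G) _ [::]).
  by rewrite /= E P.
Qed.

Lemma accepts_faccepts w : accepts automaton w -> faccepts (map (@to_op s t) w).
Proof.
(* Backward induction along the run: from [c], the pending silent pops followed by the remaining
   letters lead [frun] to acceptance. *)
pose P (c : config automaton) := forall G, c.2 = bstack G ->
  exists d e, [/\ pops true false c.1.1.2 c.1.1.1.1 c.1.1.1.2 G = Some d,
    frun d (map (@to_op s t) c.1.2) = Some e & ffinal e.1.1 e.1.2].
case=> q [g [m F]].
suff /(_ [::] erefl) : P (dpda_start automaton, w, [:: dpda_bottom automaton]).
  by case=> d [e [/= [<-] H1 H2]]; exists e.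
have F' : P (q, [::], g).
  case: q F {m} => [[ph emp] r]; rewrite inE /= => /andP[/eqP -> F] G _.
  by exists (ph, emp, G), (ph, emp, G).
move: {q F} (q, [::], g) m F' => c.
elim=> // c1 c2 c3 m _ IH /IH {IH}.
case: c1 c2 / m => [[[ph emp] r] x v Z g' q' al|[[ph emp] r] v Z g' q' al] /=.
- case: eqP => // er; have := to_op_size x.
  case E: (to_op x) => [a|b] /= xs.
    case Q: (push_next ph a) => [ph'|] //= [<- <-] H G /= eG.
    have := H (slots a (gap_flag ph) emp ++ G); case.
      rewrite /= -catA /= eG.
      by rewrite /bstack map_cat rcons_cat.
    move=> d [e [/= [<-] H1 H2]]; exists (ph, emp, G), e.
    by rewrite er /= E /= Q.
  case: Z => // sl; case Q: (pop_next _ _ _ _) => [ph'|] //= [<- <-] H G /= eG.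
  case: G eG => [|sl' G]; first by case.
  case=> es eG; subst sl'.
  have [d [e [/= H0 H1 H2]]] := H G eG.
  exists (ph, emp, sl :: G), e; rewrite er /= E; split=> //.
  case: b E xs Q {H} H0 => // b E xs Q; rewrite inordK /=; last lia.
  move=> H0; rewrite Q /= (@pops_one true (b.+1 == 1) false) ?H0 //.
  by case: (b); [left|right].
- case: eqP => // /eqP r0; case: Z => // sl; case Q: (pop_next _ _ _ _) => [ph'|] //= [<- <-] H G /= eG.
  case: G eG => [|sl' G]; first by case.
  case=> es eG; subst sl'.
  have [d [e [/= H0 H1 H2]]] := H G eG.
  exists d, e; split=> //.
  move: H0 r0; rewrite inordK; last by case: (r) => k /=; lia.
  by case: r {H} => -[|k] //= ? H0 _; rewrite Q.
Qed.

End Automaton.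

Arguments seg_add : simpl never.
Arguments new_seg : simpl never.

(** * Accepted words are well formed and reduced *)

Section Soundness.

Variables (s t N : nat) (check : seq (bool * bool) -> bool).
Notation frun := (@frun N check).
Notation pops := (@pops N check).
Notation pop_next := (@pop_next N check).

Lemma frun_cat c u v : frun c (u ++ v) = obind (frun^~ v) (frun c u).
Proof.
elim: u c => [|[a|b] u IH] c //=; first by case: (push_next _ _ _) => /=.
by case: (pops _ _ _ _ _ _) => /=.
Qed.

Lemma pops_drop q one k ph emp G ph' emp' G' :
  pops q one k ph emp G = Some (ph', emp', G') -> k <= size G /\ G' = drop k G.
Proof.
elim: k q one ph emp G => [|k IH] q one ph emp G /=; first by case=> _ _ <-; rewrite drop0.
by case: G => // sl G; case: (pop_next _ _ _ _) => //= ph1 /IH.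
Qed.

Lemma size_slots a f emp : size (slots a f emp) = a.
Proof. by rewrite size_map size_iota. Qed.

Lemma frun_hrun c w c' : frun c w = Some c' -> hrun (size c.2) w = Some (size c'.2).
Proof.
elim: w c => [|[a|b] w IH] [[ph emp] G] /=; first by case=> <-.
  case: (push_next _ _ _) => //= ph' /IH /=.
  by rewrite size_cat size_slots addnC.
case E: (pops _ _ _ _ _ _) => [[[ph' emp'] G']|] //= /IH.
by have [le ->] := pops_drop E; rewrite le /= size_drop.
Qed.

Fixpoint bottoms (G : seq slot) : bool :=
  if G is sl :: G' then (sl.2 == nilp G') && bottoms G' else true.

Lemma bottoms_slots a f G : 0 < a -> bottoms G ->
  bottoms (slots a f (nilp G) ++ G).
Proof.
move=> a0 bG; rewrite /slots.
suff main k : k <= a -> bottoms ([seq (if j == a.-1 then f else Some true, 0 < j,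
    (j == a.-1) && nilp G) | j <- iota (a - k) k] ++ G).
  by have := main a (leqnn a); rewrite subnn.
elim: k => [|k IH] ka //=.
rewrite (_ : (a - k.+1).+1 = a - k); last lia.
rewrite IH ?andbT; last lia.
case: k ka {IH} => [|k] ka /=; last by rewrite (_ : (a - k.+2 == a.-1) = false) //; lia.
by rewrite (_ : a - 1 == a.-1) ?eqxx //; lia.
Qed.

Lemma pops_bottoms q one k ph emp G ph' emp' G' :
  pops q one k ph emp G = Some (ph', emp', G') -> emp = nilp G -> bottoms G ->
  emp' = nilp G' /\ bottoms G'.
Proof.
elim: k q one ph emp G => [|k IH] q one ph emp G /=; first by case=> _ <- <-.
case: G => // sl G; case: (pop_next _ _ _ _) => //= ph1 /IH H _ /andP[/eqP e b].
exact: H.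
Qed.

Lemma frun_bottoms s0 t0 c w c' : all (op_in s0 t0) w -> frun c w = Some c' ->
  c.1.2 = nilp c.2 -> bottoms c.2 -> c'.1.2 = nilp c'.2 /\ bottoms c'.2.
Proof.
elim: w c => [|[a|b] w IH] [[ph emp] G] /=; first by move=> _ [<-].
  move=> /andP[/andP[a0 _] al]; case: (push_next _ _ _) => //= ph' H e b.
  apply: (IH _ al H) => /=; last by rewrite e bottoms_slots.
  by case: (a) a0.
move=> /andP[_ al]; case E: (pops _ _ _ _ _ _) => [[[ph' emp'] G']|] //= H e bt.
have [e' b'] := pops_bottoms E e bt.
exact: (IH _ al H).
Qed.

Definition phase_after (prev : op) (ph : phase N) : Prop :=
  if prev is Push a then ph = inl (Some (a == 1)) else True.

Lemma frun_red s0 t0 c w c' prev : all (op_in s0 t0) w -> frun c w = Some c' ->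
  phase_after prev c.1.1 -> path red2 prev w.
Proof.
elim: w c prev => [|[a|b] w IH] [[ph emp] G] prev //=.
  move=> /andP[_ al]; rewrite /push_next; case: ifP => //= _ H _.
  rewrite (IH _ (Push a) al H) // andbT.
  by rewrite /red2; case: prev.
move=> /andP[/andP[b0 _] al]; case E: (pops _ _ _ _ _ _) => [[[ph' emp'] G']|] //= H pa.
rewrite (IH _ (Pop b) al H) // andbT.
case: prev pa => [a|//] /= pa; rewrite /red2.
case: b b0 E => // b _; case: G => //= sl G; rewrite pa /=.
by case: (a == 1) (b.+1 == 1) => -[].
Qed.

Lemma faccepts_wf s0 t0 w : all (op_in s0 t0) w -> faccepts N check w ->
  hrun 0 w = Some 0 /\ sorted red2 w.
Proof.
move=> al [[[ph emp] G] [H F]]; split; last first.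
  by have := frun_red (prev := Pop 0) al H I; case: (w) => //= o w' /andP[].
have [/= e _] := frun_bottoms al H erefl isT.
have := frun_hrun H; rewrite /= => ->.
by case/and3P: F => /=; rewrite e => /nilP->.
Qed.

(** * Accepted words have good segments *)

(** No push block reaches from [T] into the stack below it. *)
Definition last_cut (T : seq slot) : Prop :=
  if T is sl :: T' then (last sl T').1.1 <> Some true else True.

Definition phase_cut (ph : phase N) : Prop :=
  match ph with inl (Some _) => False | inl None => True | inr (f, _) => f <> Some true end.

Lemma pop_next_cut q one ph sl ph' : pop_next q one ph sl = Some ph' ->
  sl.1.1 <> Some true -> phase_cut ph'.
Proof.
case: ph => [[b|]|[f g]] /=; first by case: ifP => // _ [<-].
  by case: q => // -[<-].
by case: ifP => _; [case=> <-|case: q => [[<-]|]; last case: ifP => // _ [<-]].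
Qed.

Lemma pops_frame q one k ph emp T G c : pops q one k ph emp (T ++ G) = Some c ->
  0 < k -> k <= size T -> last_cut T ->
  [/\ c.2 = drop k T ++ G, last_cut (drop k T) & drop k T = [::] -> phase_cut c.1.1].
Proof.
elim: k q one ph emp T => // k IH q one ph emp [|sl T] //= + _ kT lc.
case P: (pop_next _ _ _ _) => [ph'|] //=.
case: (posnP k) => [->|k0] H.
  case: H => <- /=; rewrite drop0; split=> //; first by case: (T) lc.
  by move=> T0; apply: (pop_next_cut P); rewrite T0 in lc.
by apply: (IH _ _ _ _ _ H) => //; case: (T) lc.
Qed.

Lemma last_cut_slots a ph emp : 0 < a -> last_cut (slots a (gap_flag (N := N) ph) emp).
Proof.
case: a => // a _; rewrite /slots -addn1 iotaD map_cat /= add0n.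
have -> : last_cut = fun T => if T is sl :: T' then (last sl T').1.1 <> Some true else True by [].
case E: (_ ++ _) => [|sl T]; first by [].
have := congr1 (last sl) E; rewrite last_cat /= => <- {E}.
by rewrite ?addn1 /= ?eqxx /gap_flag; case: ph => [[b|]|].
Qed.

(** The flag given to the lowest arc of a push is never [Some true], so whatever is pushed over [G]
    stays separated from it; when the height of [G] is reached again, the automaton is at a cut, and
    the next pop starts a segment. *)
Lemma frun_frame s0 t0 c T G w k c' : all (op_in s0 t0) w ->
  frun c w = Some c' -> c.2 = T ++ G -> hrun (size T) w = Some k ->
  last_cut T -> (T = [::] -> phase_cut c.1.1) ->
  exists T', [/\ c'.2 = T' ++ G, size T' = k, last_cut T' & T' = [::] -> phase_cut c'.1.1].
Proof.
elim: w c T => [|[a|b] w IH] [[ph emp] G0] T /=.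
- by move=> _ [<-] -> [<-] lc pc; exists T.
- move=> /andP[/andP[a0 _] al]; case P: (push_next _ _ _) => [ph'|] //= H eG hr lc pc.
  apply: (IH _ (slots a (gap_flag ph) emp ++ T) al H).
  + by rewrite /= eG catA.
  + by rewrite size_cat size_slots addnC.
  + have := last_cut_slots ph emp a0; case: T lc {pc eG hr} => [|sl T] lc; first by rewrite cats0.
    by case: (slots _ _ _) => //= sl' T' _; rewrite last_cat.
  + by case: (a) a0.
- move=> /andP[/andP[b0 _] al]; case P: (pops _ _ _ _ _ _) => [d|] //= H eG.
  case: ifP => // bT hr lc pc; rewrite eG in P.
  have [h1 h2 h3] := pops_frame P b0 bT lc.
  by apply: (IH d (drop b T) al H) => //; rewrite size_drop.
Qed.

Lemma balanced_frame s0 t0 c w c' : all (op_in s0 t0) w -> w <> [::] ->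
  frun c w = Some c' -> hrun 0 w = Some 0 -> c'.2 = c.2 /\ phase_cut c'.1.1.
Proof.
case: w => [|[a|b] w] //=; last first.
  by move=> /andP[/andP[b0 _] _] _ _; rewrite leqn0 (gtn_eqF b0).
case: c => [[ph emp] G] /andP[/andP[a0 _] al] _.
case P: (push_next _ _ _) => [ph'|] //= H hr.
have [|||T' [h1 /size0nil e _ h2]] := frun_frame (T := slots a (gap_flag ph) emp) (k := 0) al H erefl.
- by rewrite size_slots.
- exact: last_cut_slots.
- by case: (a) a0.
by split; [rewrite h1 e | exact: h2].
Qed.

(** The stack symbol of up [i] of the pushes [p], counted from the bottom; only up 0 depends on what
    precedes these pushes. *)
Definition seg_slot (p : seq nat) (f : option bool) (emp : bool) (i : nat) : slot :=
  (if i == 0 then f else Some (unc p i.-1), unc p i, (i == 0) && emp).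

Lemma frun_pushes s0 c p c' : sizes_in s0 p -> p <> [::] ->
  frun c (map Push p) = Some c' ->
  c'.2 = rev (mkseq (seg_slot p (gap_flag c.1.1) c.1.2) (sumn p)) ++ c.2
  /\ (exists b, c'.1.1 = inl (Some b)) /\ c'.1.2 = false.
Proof.
elim/last_ind: p c' => // p a IH c' sp _; rewrite map_rcons -cats1 frun_cat.
have sp1 : sizes_in s0 p by move: sp; rewrite /sizes_in all_rcons => /andP[].
have a0 : 0 < a by move: sp; rewrite /sizes_in all_rcons => /andP[/andP[]].
have uncA i : unc (p ++ [:: a]) (sumn p + i) = (i.+1 < a).
  by rewrite (unc_catr _ _ sp1) unc_cons //; case: ltnP => // _; case: eqP.
have uncP i : i < sumn p -> unc (p ++ [:: a]) i = unc p i.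
  move=> ip; have [lt|le] := ltnP i.+1 (sumn p); first by rewrite (unc_catl _ sp1).
  rewrite (unc_ge sp1 le) /unc uflags_cat nth_cat (size_uflags sp1) ltnNge le /=.
  by rewrite (_ : i.+1 - sumn p = 0) //; lia.
have slotsE f emp (g : nat -> slot) :
    (forall j, j < a -> g (sumn p + (a.-1 - j)) =
       (if j == a.-1 then f else Some true, 0 < j, (j == a.-1) && emp)) ->
    rev (mkseq g (sumn p + a)) = slots a f emp ++ rev (mkseq g (sumn p)).
  move=> Hg; rewrite /mkseq iotaD map_cat rev_cat; congr (_ ++ _).
  apply: (@eq_from_nth _ (f, true, emp)); first by rewrite size_rev size_map size_iota size_slots.
  move=> j; rewrite size_rev size_map size_iota => ja.
  rewrite nth_rev size_map size_iota // (nth_map 0) ?size_iota; last lia.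
  rewrite nth_iota ?add0n; last lia.
  rewrite (nth_map 0) ?size_iota // nth_iota // add0n -Hg //.
  by congr g; lia.
rewrite -cats1 sumn_cat /= addn0.
case: (eqVneq p [::]) => [p0|/eqP pn].
  subst p; rewrite /=; case: c {IH} => [[ph emp] G] /=; rewrite /push_next.
  case: ifP => //= _ [<-] /=; split; last by split=> //; exists (a == 1).
  rewrite (slotsE (gap_flag ph) emp) ?cats0 // => j ja.
  have u1 i : unc [:: a] i = (i.+1 < a) by have := uncA i; rewrite add0n.
  rewrite add0n /seg_slot !u1.
  rewrite (_ : (a.-1 - j == 0) = (j == a.-1)); last lia.
  rewrite (_ : ((a.-1 - j).+1 < a) = (0 < j)); last lia.
  case: eqP => // ne; congr (Some _, _, _); lia.
case E: (frun c (map Push p)) => [[[ph emp] G]|] //=.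
have [/= h1 [[b h2] h3]] := IH _ sp1 pn E.
rewrite /push_next; case: ifP => //= _ [<-] /=; split; last by split=> //; exists (a == 1).
rewrite h2 h3 h1 /= (slotsE (Some false) false); last first.
  move=> j ja; rewrite /seg_slot uncA andbF.
  have sp0 : 0 < sumn p.
    by case: (p) pn sp1 => // c0 p' _ /andP[/andP[]] /=; lia.
  rewrite (_ : (sumn p + _ == 0) = false); last lia.
  rewrite (_ : ((a.-1 - j).+1 < a) = (0 < j)); last lia.
  congr (_, _, _); case: eqP => [->|ne].
    rewrite subnn addn0 uncP ?(unc_ge sp1) //; lia.
  congr Some; rewrite (_ : (sumn p + (a.-1 - j)).-1 = sumn p + (a.-1 - j).-1); last lia.
  by rewrite uncA; lia.
rewrite -catA; congr (_ ++ (rev _ ++ _)).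
apply/eq_in_map => i; rewrite mem_iota => ip; rewrite /seg_slot uncP; last lia.
by case: eqP => // i0; rewrite uncP //; lia.
Qed.

End Soundness.

(* The gaps between the [j] innermost arcs of the segment, outermost first. *)
Definition letters (p q : seq nat) (j : nat) : seq (bool * bool) :=
  [seq (unc p i, unc q (sumn p - 2 - i)) | i <- iota (sumn p - j) j.-1].

Section SegmentRun.

Variables (s t N : nat) (check : seq (bool * bool) -> bool).
Notation frun := (@frun N check).
Notation pops := (@pops N check).
Notation pop_next := (@pop_next N check).

Variables (p q : seq nat) (f : option bool) (emp0 : bool).
Hypotheses (sp : sizes_in s p) (sq : sizes_in t q) (epq : sumn p = sumn q).
Hypothesis small : (sumn p).-1 <= N.
Hypothesis prim : forall i, i < (sumn p).-1 -> unc p i || unc q (sumn p - 2 - i).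

Let sl := seg_slot p f emp0.
Let m := sumn p.

(** The phase after [j] arcs of the segment have been popped. By [prim] no common cut makes the
    automaton restart inside the segment, and by [small] the record does not overflow. *)
Definition seg_state (j : nat) (ph : phase N) : Prop :=
  exists L : N.-bseq (bool * bool), ph = inr ((sl (m - j)).1.1, Some L) /\
    (L : seq _) = letters p q j.

Lemma pop_unit j one ph : 0 < j < m -> seg_state j ph ->
  exists ph', pop_next (unc q j.-1) one ph (sl (m - j.+1)) = Some ph' /\ seg_state j.+1 ph'.
Proof.
move=> jm [L [-> eL]].
have g0 : m - j <> 0 by lia.
have eg : m - j.+1 = (m - j).-1 by lia.
have eL' : letters p q j.+1 = (unc p (m - j.+1), unc q j.-1) :: letters p q j.
  rewrite /letters -/m; case: j jm {eL g0 eg} => // j jm /=.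
  rewrite (_ : (m - j.+2).+1 = m - j.+1); last lia.
  by congr ((_, unc q _) :: _); lia.
have szL : size (letters p q j.+1) <= N by rewrite size_map size_iota /=; lia.
have seg_addE l : l :: letters p q j = letters p q j.+1 ->
    exists L' : N.-bseq (bool * bool), seg_add l (Some L) = Some L' /\ (L' : seq _) = letters p q j.+1.
  move=> el; rewrite /seg_add /= eL el.
  by case: insubP => [L' _ eL''|]; [exists L' | rewrite szL].
rewrite /sl /seg_slot; case: eqP => // _ /=.
rewrite -eg; case E: (unc p (m - j.+1)) => /=.
  have [|L' [-> e2]] := seg_addE (true, unc q j.-1); first by rewrite eL' E.
  by eexists; split=> //; exists L'; split.
have := prim (i := m - j.+1); rewrite -/m E /= => /(_ _) h.
have uq : unc q j.-1 by rewrite (_ : j.-1 = m - 2 - (m - j.+1)); [apply: h|]; lia.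
rewrite uq /=; have [|L' [-> e2]] := seg_addE (false, true); first by rewrite eL' E uq.
by eexists; split=> //; exists L'; split.
Qed.

Lemma pops_units k j fl one ph emp G : 0 < j -> j + k <= m -> seg_state j ph ->
  (0 < k -> fl = unc q j.-1) -> (forall i, 0 < i < k -> unc q (j + i).-1) ->
  exists ph' emp', pops fl one k ph emp (rev (mkseq sl (m - j)) ++ G) =
      Some (ph', emp', rev (mkseq sl (m - (j + k))) ++ G) /\ seg_state (j + k) ph'.
Proof.
elim: k j fl one ph emp => [|k IH] j fl one ph emp j0 jk st e1 e2.
  by rewrite addn0; exists ph, emp.
have emk : rev (mkseq sl (m - j)) = sl (m - j.+1) :: rev (mkseq sl (m - j.+1)).
  rewrite (_ : m - j = (m - j.+1).+1); last lia.
  by rewrite /mkseq -addn1 iotaD map_cat rev_cat /= add0n.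
have [|ph1 [E st1]] := @pop_unit j one ph _ st; first lia.
rewrite emk /= (e1 isT) E /=.
have [||||ph' [emp' [-> st']]] := IH j.+1 true one ph1 (sl (m - j.+1)).2 _ _ st1.
- by [].
- lia.
- by move=> k0; have := e2 1; rewrite addn1 => ->.
- by move=> i ik; rewrite addSnnS; apply: e2; lia.
by exists ph', emp'; rewrite -addSnnS.
Qed.

Lemma frun_pops q1 q2 ph emp G c : q = q1 ++ q2 -> 0 < sumn q1 ->
  seg_state (sumn q1) ph ->
  frun (ph, emp, rev (mkseq sl (m - sumn q1)) ++ G) (map Pop q2) = Some c ->
  seg_state m c.1.1.
Proof.
elim: q2 q1 ph emp => [|b q2 IH] q1 ph emp eq q10 st /=.
  by case=> <- /=; rewrite /m epq eq cats0.
have sq1 : sizes_in t q1 by move: sq; rewrite eq /sizes_in all_cat => /andP[].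
have b0 : 0 < b by move: sq; rewrite eq /sizes_in all_cat /= => /and3P[_ /andP[]].
have uncb i : i < b -> unc q (sumn q1 + i).-1 = (0 < i).
  case: i => [|i] ib.
    rewrite addn0 eq /unc uflags_cat prednK // nth_cat (size_uflags sq1) ltnn subnn.
    by [].
  by rewrite addnS /= eq (unc_catr _ _ sq1) unc_cons // ib.
have [|||ph' [emp' [-> st']]] := @pops_units b (sumn q1) false (b == 1) ph emp G q10 _ st.
- by rewrite /m epq eq sumn_cat /=; lia.
- by move=> _; rewrite -[sumn q1]addn0 uncb.
- by move=> i /andP[i0 ib]; rewrite uncb.
rewrite /=; have -> : sumn q1 + b = sumn (rcons q1 b) by rewrite sumn_rcons.
apply: IH; rewrite ?sumn_rcons ?cat_rcons //; lia.
Qed.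

Lemma frun_segment ph emp G c : q <> [::] -> phase_cut ph ->
  frun (ph, emp, rev (mkseq sl m) ++ G) (map Pop q) = Some c -> seg_state m c.1.1.
Proof.
case eq: q => [|b q2] // _ pc.
have b0 : 0 < b by move: sq; rewrite eq => /andP[/andP[]].
have m0 : 0 < m by rewrite /m epq eq /=; lia.
have emk : rev (mkseq sl m) = sl (m - 1) :: rev (mkseq sl (m - 1)).
  rewrite {1}(_ : m = (m - 1).+1); last lia.
  by rewrite /mkseq -addn1 iotaD map_cat rev_cat /= add0n.
rewrite emk; case: b b0 eq => // b _ eq.
rewrite [frun _ _]/=; case P: (pop_next _ _ _ _) => [ph1|] //=.
have st1 : seg_state 1 ph1.
  have up0 : unc p (m - 1) = false by rewrite (unc_ge sp) //; lia.
  have ns : new_seg N (sl (m - 1)) = insub [::] by rewrite /new_seg /= up0.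
  have [L eL] : exists L : N.-bseq (bool * bool), insub [::] = Some L /\ (L : seq _) = [::].
    by case: insubP => [L _ eL|//]; exists L.
  case: eL => eL1 eL2.
  suff -> : ph1 = inr ((sl (m - 1)).1.1, Some L).
    by exists L; rewrite eL2 /letters /=.
  case: ph pc P => [[//|] _ /= [<-]|[f' g] /= pc]; first by rewrite ns eL1.
  case: eqP => // _; case: ifP => // _ [<-]; by rewrite ns eL1.
have uq i : i.+1 < b.+1 -> unc q i by move=> ib; rewrite eq unc_cons // ib.
have [|||ph' [emp' [-> st']]] := @pops_units b 1 true (b.+1 == 1) ph1 (sl (m - 1)).2 G isT _ st1.
- by rewrite /m epq eq /=; lia.
- by move=> b0; rewrite uq.
- by move=> i ib; rewrite add1n /= uq; lia.
rewrite /= add1n; move=> H.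
apply: (@frun_pops [:: b.+1] q2 ph' emp' G c); rewrite /= ?addn0 //.
Qed.

(** Only the next operation shows that the last pop block has ended: a push, a further pop and the
    end of the input each trigger the check. *)
Lemma check_next ph emp G Z c t' : all (op_in t' t') Z -> f <> Some true -> 0 < m -> seg_state m ph ->
  frun (ph, emp, G) Z = Some c -> ffinal check c.1.1 c.1.2 -> check (letters p q m).
Proof.
move=> al f1 m0 [L [-> eL]].
rewrite /sl subnn /seg_slot /= -eL.
case: Z al => [|[a|b] Z] /=.
- by move=> _ [<-] /=; rewrite /ffinal /= => /and3P[_ + _]; case: eqP.
- by move=> _; rewrite /push_next /=; case: eqP => //= _; case: ifP.
- case/andP=> /andP[b0 _] _; case: b b0 => // b _.
  by case: G => //= sl' G'; case: (f =P Some true) => //= _; case: ifP.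
Qed.

End SegmentRun.

Lemma faccepts_good s t N check X p Y q Z :
  all (op_in s t) (X ++ map Push p ++ Y ++ map Pop q ++ Z) ->
  faccepts N check (X ++ map Push p ++ Y ++ map Pop q ++ Z) ->
  hrun 0 Y = Some 0 -> Y <> [::] -> p <> [::] -> sumn p = sumn q -> (sumn p).-1 <= N ->
  (forall i, i < (sumn p).-1 -> unc p i || unc q (sumn p - 2 - i)) ->
  check (letters p q (sumn p)).
Proof.
rewrite !all_cat op_in_Push op_in_Pop => /and5P[aX sp aY sq aZ] [c [H F]] hY Y0 p0 epq small prim.
move: H; rewrite frun_cat; case E1: (frun check _ X) => [c1|] //=.
rewrite frun_cat; case E2: (frun check c1 _) => [c2|] //=.
rewrite frun_cat; case E3: (frun check c2 _) => [c3|] //=.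
rewrite frun_cat; case E4: (frun check c3 _) => [c4|] //= E5.
have [G2 _] := frun_pushes sp p0 E2.
have [G3 pc] := balanced_frame aY Y0 E3 hY.
have q0 : q <> [::] by move=> q0; move: epq; case: (p) p0 sp => // a p' _ /andP[/andP[]]; rewrite q0 /=; lia.
have m0 : 0 < sumn p by case: (p) p0 sp => // a p' _ /andP[/andP[]] /=; lia.
case: c3 E3 E4 G3 pc => [[ph3 emp3] G3'] E3 E4 /= eG3 pc.
rewrite eG3 G2 in E4.
have st := frun_segment sp sq epq small prim q0 pc E4.
case: c4 E4 E5 st => [[ph4 emp4] G4] E4 E5 /= st.
have aZ' : all (op_in (s + t) (s + t)) Z.
  by apply: sub_all aZ => -[a|b] /=; lia.
apply: (check_next aZ' _ m0 st E5 F).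
by rewrite /gap_flag; case: (c1.1.1) => [[]|].
Qed.

(** * Canonical words are accepted *)

Definition run_flag (X : seq op) : option bool :=
  if last (Pop 0) X is Push _ then Some false else None.

Definition seg_stack (X0 : seq op) (G0 : seq slot) (a r : nat) : seq slot :=
  drop (a - r) (slots a (run_flag X0) (nilp G0)) ++ G0.

(* [stack_of X G]: [G] is the stack after the prefix [X], split according to the
   pushes that are still partly on it, [r] being the number of arcs left. *)
Inductive stack_of : seq op -> seq slot -> Prop :=
| stack_of_nil X : hrun 0 X = Some 0 -> stack_of X [::]
| stack_of_push X0 G0 a r Y : stack_of X0 G0 -> 0 < r <= a -> hrun (a - r) Y = Some 0 ->
    stack_of (X0 ++ Push a :: Y) (seg_stack X0 G0 a r).

Lemma size_seg_stack X0 G0 a r : r <= a -> size (seg_stack X0 G0 a r) = r + size G0.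
Proof. by move=> ra; rewrite size_cat size_drop size_slots subKn. Qed.

Lemma stack_of_app X G k V : stack_of X G -> k <= size G -> hrun k V = Some 0 ->
  stack_of (X ++ V) (drop k G).
Proof.
move=> st; elim: st k V => {X G} [X hX|X0 G0 a r Y st IH ra hY] k V.
  by rewrite leqn0 => /eqP-> hV; apply: stack_of_nil; rewrite hrun_cat hX.
rewrite size_seg_stack; last by case/andP: ra.
move=> kr hV; have hYV d : hrun (a - r + d) (Y ++ V) = hrun d V.
  by rewrite hrun_cat (hrun_add d hY) /= add0n.
rewrite -catA /=; have [lt|le] := ltnP k r.
  have -> : drop k (seg_stack X0 G0 a r) = seg_stack X0 G0 a (r - k).
    rewrite /seg_stack drop_cat size_drop size_slots (_ : k < a - (a - r)); last lia.
    by rewrite drop_drop; congr (drop _ _ ++ _); lia.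
  apply: stack_of_push => //; first lia.
  by rewrite (_ : a - (r - k) = a - r + k) ?hYV //; lia.
have -> : drop k (seg_stack X0 G0 a r) = drop (k - r) G0.
  rewrite /seg_stack drop_cat size_drop size_slots (_ : k < _ = false); last lia.
  by congr drop; lia.
apply: IH; first lia.
by rewrite /= (_ : k - r + a = a - r + k) ?hYV //; lia.
Qed.

Lemma stack_of_hrun X G : stack_of X G -> hrun 0 X = Some (size G).
Proof.
elim=> {X G} // X0 G0 a r Y st IH ra hY.
rewrite hrun_cat IH /= (_ : size G0 + a = a - r + (size G0 + r)); last lia.
by rewrite (hrun_add _ hY) add0n size_seg_stack 1?addnC //; case/andP: ra.
Qed.

Lemma stack_of_Push X G a : 0 < a -> stack_of X G ->
  stack_of (rcons X (Push a)) (slots a (run_flag X) (nilp G) ++ G).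
Proof.
move=> a0 st; have := stack_of_push (a := a) (r := a) (Y := [::]) st.
by rewrite /seg_stack subnn drop0 -cats1 a0 leqnn; apply.
Qed.

Lemma stack_of_Pop X G k : stack_of X G -> k <= size G ->
  stack_of (rcons X (Pop k)) (drop k G).
Proof.
by move=> st kG; rewrite -cats1; apply: stack_of_app => //=; rewrite leqnn subnn.
Qed.

Lemma seg_stack_head X0 G0 a r : r < a -> exists sl,
  [/\ seg_stack X0 G0 a r.+1 = sl :: seg_stack X0 G0 a r,
      sl.1.1 = (if 0 < r then Some true else run_flag X0),
      sl.1.2 = (r.+1 < a) & sl.2 = nilp (seg_stack X0 G0 a r)].
Proof.
move=> ra; rewrite /seg_stack.
set S := slots a (run_flag X0) (nilp G0).
have szS : size S = a by rewrite size_slots.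
exists (nth (None, true, true) S (a - r.+1)).
rewrite [drop (a - r.+1) S](drop_nth (None, true, true)); last by rewrite szS; lia.
rewrite (_ : (a - r.+1).+1 = a - r); last lia.
rewrite (nth_map 0) ?size_iota ?nth_iota; try lia.
rewrite add0n /=; split=> //; try lia.
- by rewrite (_ : (a - r.+1 == a.-1) = (r == 0)); [case: r ra => [|r] | lia].
- rewrite (_ : (a - r.+1 == a.-1) = (r == 0)); last lia.
  by rewrite /nilp size_cat size_drop szS subKn ?addn_eq0 //; lia.
Qed.

Lemma run_flag_rcons X o : run_flag (rcons X o) = if o is Push _ then Some false else None.
Proof. by rewrite /run_flag last_rcons. Qed.

Definition last_is_pop (X : seq op) : Prop := exists X1 b, X = rcons X1 (Pop b).

Lemma letters_step p q q' : 0 < sumn q < sumn p ->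
  (forall i, i.+1 < sumn q -> unc q' i = unc q i) ->
  letters p q' (sumn q).+1 =
    (unc p (sumn p - (sumn q).+1), unc q' (sumn q).-1) :: letters p q (sumn q).
Proof.
move=> /andP[q0 qp] eq; rewrite /letters; case E: (sumn q) q0 qp eq => [//|j] _ qp eq /=.
congr ((_, unc q' _) :: _); first lia.
rewrite (_ : (sumn p - j.+2).+1 = sumn p - j.+1); last lia.
by apply/eq_in_map => i; rewrite mem_iota => ij; rewrite eq //; lia.
Qed.

Lemma sumn_gt0 b q : sizes_in b q -> q <> [::] -> 0 < sumn q.
Proof. by case: q => // a q /andP[/andP[a0 _] _] _ /=; lia. Qed.

Lemma letters_cons a p q : 0 < a -> letters (a :: p) q (sumn p) = letters p q (sumn p).
Proof.
move=> a0; rewrite /letters /= addnK subnn.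
have -> : iota a (sumn p).-1 = map (addn a) (iota 0 (sumn p).-1) by rewrite -iotaDl addn0.
rewrite -map_comp.
apply: eq_map => i /=; rewrite unc_cons // ltnNge leqW ?leq_addr //=.
rewrite (_ : ((a + i).+1 == a) = false); last lia.
by rewrite addKn; congr (_, unc q _); lia.
Qed.

Lemma unc_rcons k q b i : sizes_in k q -> 0 < b ->
  unc (rcons q b) i = if i.+1 < sumn q then unc q i
                      else (sumn q <= i) && ((i - sumn q).+1 < b).
Proof.
move=> sq b0; rewrite /unc -cats1 uflags_cat nth_cat (size_uflags sq).
case: ltnP => // le; rewrite /uflags /= cats0.
case: (leqP (sumn q) i) => qi; last by rewrite (_ : i.+1 - sumn q = 0) //; lia.
by rewrite subSn //= nth_nseq; case: ltnP; lia.
Qed.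

Lemma pops_cons N (check : seq (bool * bool) -> bool) q one k (ph : phase N) emp sl G :
  pops check q one k.+1 ph emp (sl :: G) =
  obind (fun ph' => pops check true one k ph' sl.2 G) (pop_next check q one ph sl).
Proof. by []. Qed.

Section Completeness.

Variables (s t N : nat) (check : seq (bool * bool) -> bool) (w : seq op).
Hypotheses (al : all (op_in s t) w) (so : sorted red2 w) (hw : hrun 0 w = Some 0).
Hypothesis checked : forall X p Y q Z, w = X ++ map Push p ++ Y ++ map Pop q ++ Z ->
  hrun 0 Y = Some 0 -> Y <> [::] -> p <> [::] -> sumn p = sumn q ->
  check (letters p q (sumn p)).
Notation pop_next := (@pop_next N check).

Definition seg_word X0 a p Y q := X0 ++ map Push (a :: p) ++ Y ++ map Pop q.
Definition seg_flag X0 r := if 0 < r then Some true else run_flag X0.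
(** A segment in progress: after the balanced [Y], the pops [q] have removed the arcs of [p] and all
    but [r] arcs of [Push a], the lowest block reached. The segment is complete for the pushes
    exactly when [r = 0]. *)
Definition seg_cond X0 G0 a p Y q r :=
  [/\ stack_of X0 G0, hrun 0 Y = Some 0 /\ Y <> [::],
      all (op_in s t) X0 /\ sizes_in s (a :: p), sizes_in t q /\ q <> [::]
    & a + sumn p = sumn q + r /\ r < a].

Definition seg_inv (W : seq op) (G : seq slot) (f : option bool) (L : seq (bool * bool)) :=
  exists X0 G0 a p Y q r, [/\ seg_cond X0 G0 a p Y q r, W = seg_word X0 a p Y q,
    G = seg_stack X0 G0 a r, f = seg_flag X0 r & L = letters (a :: p) q (sumn q)].

Definition phase_inv (W : seq op) (G : seq slot) (ph : phase N) : Prop :=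
  match ph with
  | inl (Some b) => exists X a, W = rcons X (Push a) /\ b = (a == 1)
  | inl None => W = [::] \/ last_is_pop W
  | inr (f, g) => last_is_pop W /\ (if g is Some L then seg_inv W G f L else True)
  end.

(** If the top arc is not joined to an arc above it, its push block is entirely on the stack; so
    what follows that push is balanced, and it is nonempty because [X] ends with a pop. *)
Lemma new_seg_inv X sl G : 0 < t -> all (op_in s t) X -> stack_of X (sl :: G) -> last_is_pop X ->
  phase_inv (rcons X (Pop 1)) G (inr (sl.1.1, new_seg N sl)).
Proof.
move=> t0 aX st [X1 [b0 eX]]; split; first by exists X, 1.
rewrite /new_seg; case E: sl.1.2 => //.
case: insubP => [L _ eL|//].
case eG: _ / st eX aX => [//|X0 G0 a r Y st ra hY] eX aX.
case/andP: ra => r0 ra; case: r r0 ra hY eG => // r _ ra hY.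
have [sl' [eh e1 e2 _]] := seg_stack_head X0 G0 ra.
rewrite eh => -[esl eG]; rewrite esl e2 in E; have rE : r.+1 = a by lia.
rewrite rE subnn in hY.
exists X0, G0, a, [::], Y, [:: 1], r; split; rewrite ?esl //.
- split.
  + exact: st.
  + split=> // Y0; move: eX; rewrite Y0 cats1 => /rcons_inj[].
    by [].
  + move: aX; rewrite all_cat /= => /and3P[-> h _]; split=> //.
    by rewrite /sizes_in /= h.
  + by split=> //; rewrite /sizes_in /= t0.
  + by rewrite /= -rE; lia.
- by rewrite /seg_word /= -cats1 -catA.
Qed.

Lemma seg_check X G f L rest : seg_inv X G f L -> f <> Some true -> w = X ++ rest -> check L.
Proof.
move=> [X0 [G0 [a [p [Y [q [r [[_ [hY Y0] _ _ [e _]] -> _ -> ->]]]]]]]].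
rewrite /seg_flag; case: r e => // e _ ew; rewrite addn0 in e.
have -> : sumn q = sumn (a :: p) by [].
by apply: (checked (X := X0) (Z := rest) _ hY Y0) => //; rewrite ew /seg_word -!catA.
Qed.

(** One more arc is popped. The gap [(sumn q).-1] before it is left free: the arc either begins a
    new pop block or lengthens the last one. *)
Definition extends (q q' : seq nat) : Prop :=
  [/\ sumn q' = (sumn q).+1, sizes_in t q' & forall i, i.+1 < sumn q -> unc q' i = unc q i].

Lemma extends_nil q q' : extends q q' -> q' <> [::].
Proof. by case=> e _ _ q0; rewrite q0 in e. Qed.

Lemma seg_inv_inside X0 G0 a p Y q q' r sl G : seg_cond X0 G0 a p Y q r.+1 ->
  extends q q' -> sl :: G = seg_stack X0 G0 a r.+1 ->
  seg_inv (seg_word X0 a p Y q') G sl.1.1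
    ((true, unc q' (sumn q).-1) :: letters (a :: p) q (sumn q)).
Proof.
move=> [c1 c2 c3 [c4 c4'] [c5 c6]] ex; have [e1 e2 e3] := ex.
have ra : r < a by lia.
have [sl' [-> h1 _ _]] := seg_stack_head X0 G0 ra; case=> -> ->.
exists X0, G0, a, p, Y, q', r; split=> //.
  split=> //; first by split=> //; exact: extends_nil ex.
  by rewrite e1; lia.
rewrite e1 letters_step //; last by rewrite (sumn_gt0 c4 c4') /=; lia.
congr ((_, _) :: _); rewrite unc_cons; last lia.
have -> : (sumn (a :: p) - (sumn q).+1).+1 < a by rewrite /=; lia.
by [].
Qed.

Lemma seg_inv_across X0 G0 a p Y q q' sl G : seg_cond X0 G0 a p Y q 0 ->
  extends q q' -> run_flag X0 = Some false -> G0 = sl :: G ->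
  seg_inv (seg_word X0 a p Y q') G sl.1.1
    ((false, unc q' (sumn q).-1) :: letters (a :: p) q (sumn q)).
Proof.
move=> [c1 c2 [c3 c3'] [c4 c4'] [c5 c6]] ex rf eG; have [e1 e2 e3] := ex.
case: X0 G0 / c1 eG rf c3 => // X1 G1 a1 r1 Y1 st ra hY1 eG rf.
rewrite all_cat /= => /and3P[al1 /andP[a10 a1s] alY].
(* The word before the segment ends with a push, and [Y1], which ends at height 0, cannot; so this
   push is [Push a1], still entirely on the stack. *)
have Y10 : Y1 = [::].
  case/lastP: Y1 hY1 rf alY => // Y1 o hY1.
  rewrite /run_flag last_cat /= last_rcons all_rcons; case: o hY1 => // c hY1 _ /andP[/andP[c0 _] _].
  by move: hY1; rewrite -cats1 hrun_cat; case: (hrun _ Y1) => //= h [] /=; lia.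
subst Y1; case: hY1 => hr; have er : r1 = a1 by lia.
subst r1; case: a1 a10 a1s ra eG {hr rf} => // a1 _ a1s ra eG.
have [sl' [eh h1 _ _]] := seg_stack_head X1 G1 (ltnSn a1).
move: eG; rewrite eh => -[<- <-].
exists X1, G1, a1.+1, (a :: p), Y, q', a1; split=> //.
- split=> //; first by split=> //; rewrite /sizes_in /= a1s.
    by split=> //; exact: extends_nil ex.
  by rewrite e1 /=; lia.
- by rewrite /seg_word /= -catA.
- have sq0 := sumn_gt0 c4 c4'.
  have eL : letters (a1.+1 :: a :: p) q (sumn q) = letters (a :: p) q (sumn q).
    by have -> : sumn q = sumn (a :: p) by [rewrite /= c5 addn0]; exact: letters_cons.
  rewrite e1 letters_step //; last by rewrite /=; lia.
  rewrite eL; congr ((_, _) :: _); rewrite unc_cons //.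
  have -> : (sumn [:: a1.+1, a & p] - (sumn q).+1).+1 = a1.+1 by rewrite /=; lia.
  by rewrite ltnn eqxx.
Qed.

Hypothesis t0 : 0 < t.

Lemma extends_rcons q : sizes_in t q -> extends q (rcons q 1).
Proof.
move=> sq; split=> [||i iq]; first by rewrite sumn_rcons addn1.
  by rewrite /sizes_in all_rcons /= t0.
by rewrite (unc_rcons _ sq) // iq.
Qed.

Lemma extends_last q k : sizes_in t q -> 0 < k < t -> extends (rcons q k) (rcons q k.+1).
Proof.
move=> sq /andP[k0 kt]; split=> [||i]; first by rewrite !sumn_rcons addnS.
  by rewrite /sizes_in all_rcons /= kt.
rewrite sumn_rcons => iq; rewrite !(unc_rcons _ sq) //; case: ltnP => // le.
by case: leqP => //= qi; lia.
Qed.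

Lemma seg_add_inv l (L L1 : N.-bseq (bool * bool)) : seg_add l (Some L) = Some L1 ->
  (L1 : seq _) = l :: L.
Proof. by rewrite /seg_add /=; case: insubP => // L' _ e [<-]. Qed.

Lemma phase_inv_close X G ph rest : phase_inv X G ph -> w = X ++ rest -> close_ok check ph.
Proof.
case: ph => [[b|]|[f [L|]]] //= [_ si] ew; last by rewrite orbT.
by case: eqP => // ne; apply: seg_check si ne ew.
Qed.

Lemma pop_first X Z b sl G ph : w = X ++ Pop b :: Z -> stack_of X (sl :: G) ->
  phase_inv X (sl :: G) ph ->
  exists ph1, [/\ pop_next false (b == 1) ph sl = Some ph1,
    phase_inv (rcons X (Pop 1)) G ph1 & b = 1 \/ exists x, ph1 = inr x].
Proof.
move=> ew st pinv.
have aX : all (op_in s t) X by move: al; rewrite ew all_cat => /andP[].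
case: ph pinv => [[e|]|[f g]] /=.
- move=> [X1 [a [eX ->]]].
  have /andP[/eqP-> /eqP->] : (a == 1) && (b == 1).
    have : sorted red2 (X1 ++ Push a :: Pop b :: Z) by rewrite -cat_rcons -eX -ew.
    case: (X1) => [|o X2] /=; first by case/andP.
    by rewrite cat_path /= => /and4P[].
  exists (inl None); split=> //; last by left.
  by right; exists X, 1.
- case=> [eX|lp].
    by have := stack_of_hrun st; rewrite eX.
  eexists; split; first by []; last by right; eexists.
  exact: new_seg_inv.
- move=> [lp si]; case: eqP => [f1|f1].
    eexists; split; first by []; last by right; eexists.
    split; first by exists X, 1.
    case: g si => [L|//] si; case E: (seg_add _ _) => [L1|//].
    rewrite (seg_add_inv E).
    case: si => [X0 [G0 [a [p [Y [q [r [c eX eG ef ->]]]]]]]].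
    move: ef; rewrite f1 /seg_flag; case: r c eG => [|r] c eG ef.
      by move: ef; rewrite /= /run_flag; case: (last _ _).
    have [_ _ _ [sq q0] _] := c.
    have := seg_inv_inside c (extends_rcons sq) eG.
    rewrite (unc_rcons _ sq) // prednK ?(sumn_gt0 sq) // ltnn.
    rewrite (_ : sumn q <= (sumn q).-1 = false) /=; last by have := sumn_gt0 sq q0; lia.
    by rewrite eX /seg_word !map_rcons -!rcons_cat.
  have -> : seg_ok check g.
    case: g si => [L|//] si; exact: seg_check si f1 ew.
  eexists; split; first by []; last by right; eexists.
  exact: new_seg_inv.
Qed.

Lemma pop_more X k f g sl G one : 0 < k < t ->
  phase_inv (rcons X (Pop k)) (sl :: G) (inr (f, g)) ->
  exists x, pop_next true one (inr (f, g)) sl = Some (inr x) /\ phase_inv (rcons X (Pop k.+1)) G (inr x).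
Proof.
move=> kt [_ si].
have lp : last_is_pop (rcons X (Pop k.+1)) by exists X, k.+1.
have split_q X0 a p Y q : q <> [::] -> rcons X (Pop k) = seg_word X0 a p Y q ->
    exists q1, q = rcons q1 k /\ rcons X (Pop k.+1) = seg_word X0 a p Y (rcons q1 k.+1).
  case/lastP: q => // q1 c _; rewrite /seg_word !map_rcons -!rcons_cat => /rcons_inj[-> <-].
  by exists q1; split=> //; rewrite !map_rcons -!rcons_cat.
have flag q1 : sizes_in t (rcons q1 k) -> unc (rcons q1 k.+1) (sumn (rcons q1 k)).-1.
  rewrite /sizes_in all_rcons => /andP[_ sq1]; rewrite (unc_rcons _ sq1) // sumn_rcons.
  rewrite (_ : _ < _ = false) /=; lia.
rewrite /=; case: eqP => [f1|f1].
  eexists; split=> //; split=> //.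
  case: g si => [L|//] si; case E: (seg_add _ _) => [L1|//].
  rewrite (seg_add_inv E).
  case: si => [X0 [G0 [a [p [Y [q [r [c eX eG ef ->]]]]]]]].
  move: ef; rewrite f1 /seg_flag; case: r c eG => [|r] c eG ef.
    by move: ef; rewrite /= /run_flag; case: (last _ _).
  have [_ _ _ [sq q0] _] := c.
  have [q1 [eq eX']] := split_q _ _ _ _ _ q0 eX.
  have sq1 : sizes_in t q1 by move: sq; rewrite eq /sizes_in all_rcons => /andP[].
  have ex : extends q (rcons q1 k.+1) by rewrite eq; exact: extends_last.
  have fl := flag q1; rewrite -eq in fl.
  by have := seg_inv_inside c ex eG; rewrite fl // eX'.
eexists; split=> //; split=> //.
case: eqP => // f2; case: g si => [L|//] si; case E: (seg_add _ _) => [L1|//].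
rewrite (seg_add_inv E).
case: si => [X0 [G0 [a [p [Y [q [r [c eX eG ef ->]]]]]]]].
move: ef; rewrite f2 /seg_flag; case: r c eG => [|r] c eG //= ef.
have [_ _ _ [sq q0] _] := c.
have [q1 [eq eX']] := split_q _ _ _ _ _ q0 eX.
have sq1 : sizes_in t q1 by move: sq; rewrite eq /sizes_in all_rcons => /andP[].
have ex : extends q (rcons q1 k.+1) by rewrite eq; exact: extends_last.
have eG0 : G0 = sl :: G by rewrite eG /seg_stack subn0 drop_oversize ?size_slots.
have fl := flag q1; rewrite -eq in fl.
by have := seg_inv_across c ex (esym ef) eG0; rewrite fl // eX'.
Qed.

(** A pop of size [b] interrupted after [j] arcs is described by the word [rcons X (Pop j)], which
    may fail to be a prefix of [w]; no check takes place at these intermediate stages. *)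
Lemma pops_inv X G b k j x emp : b <= t -> 0 < j -> j + k = b -> b <= size G ->
  phase_inv (rcons X (Pop j)) (drop j G) (inr x) ->
  exists ph' emp', pops check true (b == 1) k (inr x) emp (drop j G) =
    Some (ph', emp', drop b G) /\ phase_inv (rcons X (Pop b)) (drop b G) ph'.
Proof.
move=> bt; elim: k j x emp => [|k IH] j x emp j0 eb bG pinv.
  by rewrite addn0 in eb; subst j; exists (inr x), emp.
have jG : j < size G by lia.
case: x pinv => f g; rewrite (drop_nth (None, true, true) jG) => pinv.
have [|x [E pinv']] := pop_more (b == 1) _ pinv; first lia.
rewrite pops_cons E [obind _ _]/=.
have eb' : j.+1 + k = b by lia.
have := IH j.+1 x (nth (None, true, true) G j).2 isT eb' bG pinv'.
by case=> ph' [emp' [E' p']]; exists ph', emp'; split.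
Qed.

Lemma gap_flagE X G ph : phase_inv X G ph -> gap_flag ph = run_flag X.
Proof.
case: ph => [[b|]|[f g]] /=.
- by case=> X1 [a [-> _]]; rewrite run_flag_rcons.
- by case=> [->|[X1 [b ->]]] //; rewrite run_flag_rcons.
- by case=> -[X1 [b ->]] _; rewrite run_flag_rcons.
Qed.

Lemma frun_complete W X ph emp G : w = X ++ W -> stack_of X G -> phase_inv X G ph ->
  emp = nilp G -> bottoms G ->
  exists c, [/\ frun check (ph, emp, G) W = Some c, phase_inv w c.2 c.1.1,
    c.1.2 = nilp c.2 & stack_of w c.2].
Proof.
elim: W X ph emp G => [|o W IH] X ph emp G ew st pinv eemp bG.
  by rewrite cats0 in ew; subst X; exists (ph, emp, G).
have ew' : w = rcons X o ++ W by rewrite cat_rcons.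
have ho : op_in s t o by move: al; rewrite ew all_cat /= => /and3P[].
case: o ho ew ew' => [a|b] /= /andP[p0 ps] ew ew'.
  rewrite /push_next (phase_inv_close pinv ew) /=.
  rewrite (gap_flagE pinv) eemp; apply: (IH (rcons X (Push a))) => //.
  - exact: stack_of_Push.
  - by exists X, a.
  - by case: (a) p0.
  - exact: bottoms_slots.
have bG' : b <= size G.
  by move: hw; rewrite ew hrun_cat (stack_of_hrun st) /=; case: ifP.
suff [ph' [emp' [E pinv']]] : exists ph' emp', pops check false (b == 1) b ph emp G =
    Some (ph', emp', drop b G) /\ phase_inv (rcons X (Pop b)) (drop b G) ph'.
  have [e' b'] := pops_bottoms E eemp bG.
  rewrite E /=; apply: IH ew' _ pinv' e' b'; exact: stack_of_Pop.
case: b p0 ps ew ew' bG' => // b _ ps ew ew' bG'.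
case: G st pinv eemp bG bG' => // sl G st pinv eemp bG bG'.
have [ph1 [E pinv1 hb]] := pop_first ew st pinv.
rewrite pops_cons E [obind _ _]/=; case: hb => [[b0]|[x ex]].
  by subst b; exists ph1, sl.2; rewrite /= drop0.
rewrite ex in pinv1 *.
have := @pops_inv X (sl :: G) b.+1 b 1 x sl.2 ps isT (add1n b) bG'.
by rewrite /= drop0 => /(_ pinv1) [ph' [emp' [E' p']]]; exists ph', emp'; split.
Qed.

Lemma canonical_faccepts : faccepts N check w.
Proof.
have [c [E pinv e st]] := @frun_complete w [::] (inl None) true [::] erefl
  (@stack_of_nil [::] erefl) (or_introl erefl) erefl isT.
exists c; split=> //.
have G0 : c.2 = [::].
  by have := stack_of_hrun st; rewrite hw => -[] /esym /size0nil.
apply/and3P; split.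
- by rewrite e G0.
- exact: phase_inv_close pinv (esym (cats0 w)).
- case: c.1.1 pinv => [[b|]|] //= [X [a [ew _]]].
  move: hw; rewrite ew -cats1 hrun_cat; case: (hrun 0 X) => //= h [].
  by move: al; rewrite ew all_rcons /= => /andP[/andP[a0 _] _]; lia.
Qed.

End Completeness.

(** * Uniqueness *)

(** The automaton consults this predicate only on the finite type of sequences of length at most
    [N], so a classical decision still yields a finite transition table. The pop gaps run against
    the order of the ups, hence [rev]. *)
Definition check_good (s t : nat) (L : seq (bool * bool)) : bool :=
  if excluded_middle_informative
       (good s t (block_sizes (unzip1 L)) (block_sizes (rev (unzip2 L))))
  then true else false.

Lemma letters_sizes s t p q : sizes_in s p -> sizes_in t q -> p <> [::] -> sumn p = sumn q ->
  block_sizes (unzip1 (letters p q (sumn p))) = p /\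
  block_sizes (rev (unzip2 (letters p q (sumn p)))) = q.
Proof.
move=> sp sq p0 e; have m0 := sumn_gt0 sp p0.
have q0 : q != [::] by apply/eqP => q0; rewrite q0 /= in e; lia.
rewrite /letters subnn; split.
  rewrite -[RHS](uflagsK sp); last exact/eqP.
  congr block_sizes; apply: (@eq_from_nth _ false).
    by rewrite !size_map size_iota size_behead (size_uflags sp).
  move=> i; rewrite !size_map size_iota => im.
  by rewrite /unzip1 -map_comp (nth_map 0) ?size_iota //= nth_iota // nth_behead.
rewrite -[RHS](uflagsK sq) //; congr block_sizes; apply: (@eq_from_nth _ false).
  by rewrite size_rev !size_map size_iota size_behead (size_uflags sq) e.
move=> i; rewrite size_rev !size_map size_iota => im.
rewrite nth_rev !size_map size_iota // /unzip2 -map_comp (nth_map 0) ?size_iota /=; last lia.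
rewrite nth_iota; last lia.
by rewrite nth_behead /unc; congr nth; lia.
Qed.

Lemma check_goodP s t p q : sizes_in s p -> sizes_in t q -> p <> [::] -> sumn p = sumn q ->
  check_good s t (letters p q (sumn p)) <-> good s t p q.
Proof.
move=> sp sq p0 e; rewrite /check_good; have [-> ->] := letters_sizes sp sq p0 e.
by case: excluded_middle_informative.
Qed.

Lemma brev_ones m i : brev (nseq m 1) i = i.
Proof.
elim: m i => [|m IH] i //=; case: ltnP => h; first by case: i h.
by rewrite IH; lia.
Qed.

(** A double block and a segment cut into units both send rank [j] to label [m.-1 - j], and the
    units are lexicographically smaller. *)
Lemma good_not_double s t m : 0 < s -> 0 < t -> 1 < m -> ~ good s t [:: m] [:: m].
Proof.
move=> s0 t0 m1 /(_ (nseq m 1) (nseq m 1)) H.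
suff : ~~ lexlt (nseq m 1 ++ nseq m 1) ([:: m] ++ [:: m]) by case: m m1 {H} => [|[|m]].
apply: H; rewrite /= ?sumn_nseq ?mul1n ?addn0 //.
- by rewrite /sizes_in all_nseq s0 orbT.
- by rewrite /sizes_in all_nseq t0 orbT.
- by move=> j; rewrite /pair_equiv /= addn0 => jm; rewrite !brev_ones jm (_ : _ - _ < m); lia.
Qed.

Lemma unc_all_single b p m : sizes_in b p -> sumn p = m.+1 ->
  (forall i, i < m -> unc p i) -> p = [:: m.+1].
Proof.
move=> sp e u; apply: (unc_inj (b' := m.+1) sp) => /=; rewrite ?leqnn ?addn0 //.
by move=> c cm; rewrite u ?unc_cons //; [case: ifP => //; lia | lia].
Qed.

(* In a reduced word the segment around a peak is cut off from its parents. *)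
Lemma segment_nonempty X p Y q Z s t : sorted red2 (X ++ map Push p ++ Y ++ map Pop q ++ Z) ->
  sizes_in s p -> sizes_in t q -> sumn p = sumn q -> 1 < sumn p ->
  (forall i, i < (sumn p).-1 -> unc p i || unc q (sumn p - 2 - i)) -> Y <> [::].
Proof.
move=> so sp sq e m1 prim Y0; subst Y.
case/lastP: p sp e m1 so prim => // p a sp e m1 so prim.
case: q sq e so prim => [|b q] sq e so prim; first by rewrite /= in e; lia.
have : (a == 1) && (b == 1).
  move: so; rewrite map_rcons cat_rcons /= catA.
  case: (X ++ map Push p) => [|o W] /=; first by case/andP.
  by rewrite cat_path /= => /and4P[].
case/andP=> /eqP a1 /eqP b1; subst a b.
have sp' : sizes_in s p by move: sp; rewrite /sizes_in all_rcons => /andP[].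
rewrite sumn_rcons in m1.
have u1 : unc (rcons p 1) (sumn p).-1 = false.
  by rewrite (unc_rcons _ sp') // ifF; lia.
have := prim (sumn p).-1; rewrite u1 sumn_rcons (_ : _ - _ - _ = 0); last lia.
by rewrite unc_cons // => H; have : false by [apply: H; lia].
Qed.

Lemma class_chain n ru rd e x y :
  (forall c, x <= c < y -> up_class n ru rd e c) ->
  (forall c, up_class n ru rd e c -> e c = (e c.+1).+1) ->
  forall k, x <= k <= y -> [/\ ru k = ru y, rd (e k) = rd (e y) & e k = e y + (y - k)].
Proof.
move=> K adj k; move: {2}(y - k) (leqnn (y - k)) => i; elim: i k => [|i IH] k ik xk.
  by have -> : k = y by [lia]; rewrite subnn addn0.
have [->|ne] := eqVneq k y; first by rewrite subnn addn0.
have Kk : up_class n ru rd e k by apply: K; lia.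
have [|| h1 h2 h3] := IH k.+1; try lia.
have /and3P[_ /eqP e1 /eqP e2] := Kk.
by split; [rewrite e1 | rewrite e2 | rewrite (adj _ Kk) h3; lia].
Qed.

Definition up_of (w : seq op) (j : nat) : nat := nth 0 (matched_ups (run w)) j.
Definition down_of (w : seq op) (i : nat) : nat := index i (matched_ups (run w)).
Definition up_run (w : seq op) (c : nat) : nat := nth 0 (downs_before 0 w) c.
Definition down_run (w : seq op) (j : nat) : nat := nth 0 (ups_before 0 w) j.

Definition closed_in (w : seq op) : nat -> nat -> Prop :=
  closed_seg (sumn (push_sizes w)) (up_run w) (down_run w) (down_of w)
    (unc (push_sizes w)) (unc (pop_sizes w)).

Lemma closed_chain w x y : hrun 0 w = Some 0 -> closed_in w x y ->
  forall k, x <= k <= y -> [/\ up_run w k = up_run w y,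
    down_run w (down_of w k) = down_run w (down_of w y)
    & down_of w k = down_of w y + (y - k)].
Proof.
move=> hw [_ K _ _ _]; have [[F1 F2 F3 F4] [F5 F6 F7 F8]] := matching_facts hw.
by apply: class_chain K _ => c; apply: (up_class_adj F1 F2 F3 F4 F5 F6 F7 F8).
Qed.

Lemma closed_segment_good s t w x y : 0 < s -> 0 < t -> all (op_in s t) w ->
  faccepts (s + t).*2 (check_good s t) w -> x < y -> y - x <= (s + t).*2 -> closed_in w x y ->
  (forall c, x <= c < y -> unc (push_sizes w) c || unc (pop_sizes w) (down_of w c.+1)) ->
  exists p q, [/\ sizes_in s p, sizes_in t q,
    sumn p = (y - x).+1 /\ sumn q = (y - x).+1, good s t p q
    & (forall i, i < y - x -> unc p i = unc (push_sizes w) (x + i)) /\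
      (forall i, i < y - x -> unc q i = unc (pop_sizes w) (down_of w y + i))].
Proof.
move=> s0 t0 al acc xy yxN C cov.
have [hw so] := faccepts_wf al acc.
have chain := closed_chain hw C.
have [xyn _ cx cy /andP[cex cey]] := C.
have [|h1 h2 h3] := chain x; first by rewrite leqnn ltnW.
have [X [p [Y [q [Z [eV hY [ep eq] up uq]]]]]] :=
  extract_segment hw al xyn (esym h1) h2 h3 cx cy cex cey.
have [sp sq] : sizes_in s p /\ sizes_in t q.
  by move: al; rewrite eV !all_cat op_in_Push op_in_Pop => /and5P[].
have epq : sumn p = sumn q by rewrite ep eq.
have p0 : p <> [::] by move=> p0; rewrite p0 in ep.
have prim i : i < (sumn p).-1 -> unc p i || unc q (sumn p - 2 - i).
  rewrite ep /= => im.
  have im2 : (y - x).+1 - 2 - i < y - x by clear -im; lia.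
  rewrite up // uq //.
  have xi : x <= x + i < y by clear -im; lia.
  have xi1 : x <= (x + i).+1 <= y by clear -im; lia.
  have := cov (x + i) xi; have [_ _ ->] := chain (x + i).+1 xi1.
  by rewrite (_ : y - (x + i).+1 = (y - x).+1 - 2 - i) //; clear; lia.
exists p, q; split=> //.
apply/(check_goodP sp sq p0 epq).
rewrite eV in al acc so.
apply: (faccepts_good al acc hY _ p0 epq) => //; last by rewrite ep.
by apply: (segment_nonempty so sp sq epq) => //; rewrite ep; clear -xy; lia.
Qed.

(** A double block is a single push block, of size at most [s], so it is within the range of the
    check, which rejects it by [good_not_double]. *)
Lemma closed_segment_not_double s t w x y : 0 < s -> 0 < t -> all (op_in s t) w ->
  faccepts (s + t).*2 (check_good s t) w -> x < y -> closed_in w x y ->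
  ~ (forall c, x <= c < y -> unc (push_sizes w) c && unc (pop_sizes w) (down_of w c.+1)).
Proof.
move=> s0 t0 al acc xy C H; have [xyn K cx cy _] := C.
have b : block (unc (push_sizes w)) x y by split; [exact: ltnW|..|move=> c /H /andP[]].
have [_ _ sz] := reversal_brev s0 (sizes_in_push al); have yxs := sz _ _ b.
have [hw so] := faccepts_wf al acc.
have yxN : y - x <= (s + t).*2 by clear -yxs; lia.
have cov c : x <= c < y -> unc (push_sizes w) c || unc (pop_sizes w) (down_of w c.+1).
  by move/H/andP => [->].
have [p [q [sp sq [ep eq] g [up uq]]]] := closed_segment_good s0 t0 al acc xy yxN C cov.
have p1 : p = [:: (y - x).+1].
  apply: (unc_all_single sp ep) => i im; rewrite up //.
  have xi : x <= x + i < y by clear -im; lia.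
  by have /andP[] := H (x + i) xi.
have q1 : q = [:: (y - x).+1].
  apply: (unc_all_single sq eq) => i im; rewrite uq //.
  have yi : x <= y - i <= y by clear -im; lia.
  have yi1 : x <= (y - i).-1 < y by clear -im; lia.
  have yi0 : 0 < y - i by clear -im; lia.
  have iy : i <= y by clear -im; lia.
  have [_ _ h3] := closed_chain hw C yi.
  by have /andP[_] := H (y - i).-1 yi1; rewrite prednK // h3 subKn.
by move: g; rewrite p1 q1; apply: good_not_double => //; clear -xy; lia.
Qed.

(** A closed segment is a union of blocks on both sides, so the labels at its ranks depend only on
    its own blocks. Equality of outputs thus becomes [pair_equiv] on the segment. *)
Lemma output_segment s t w x y p q j : 0 < s -> 0 < t -> all (op_in s t) w ->
  hrun 0 w = Some 0 -> x < y -> closed_in w x y -> sizes_in s p -> sizes_in t q ->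
  sumn p = (y - x).+1 -> sumn q = (y - x).+1 ->
  (forall i, i < y - x -> unc p i = unc (push_sizes w) (x + i)) ->
  (forall i, i < y - x -> unc q i = unc (pop_sizes w) (down_of w y + i)) ->
  j < (y - x).+1 ->
  brev (push_sizes w) (up_of w (brev (pop_sizes w) (down_of w y + j))) =
  x + brev p (y - x - brev q j).
Proof.
move=> s0 t0 al hw xy C sp sq ep eq up uq jm.
have [[F1 F2 F3 F4] _] := matching_facts hw.
have [xyn _ cx cy /andP[cex cey]] := C.
have xx : x <= x <= y by clear -xy; lia.
have [_ _ ex] := closed_chain hw C xx.
have RP := reversal_brev s0 (sizes_in_push al).
have RQ := reversal_brev t0 (sizes_in_pop al).
have R1 := reversal_brev s0 sp; have R2 := reversal_brev t0 sq.
rewrite ep in R1; rewrite eq in R2.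
have eQ : brev (pop_sizes w) (down_of w y + j) = down_of w y + brev q j.
  by apply: (reversal_shift RQ R2) => //; rewrite -?ex.
have lt_q : brev q j < (y - x).+1 by rewrite -eq; apply: brev_lt; rewrite eq.
have yk : x <= y - brev q j <= y by clear -lt_q xy; lia.
have [_ _ h] := closed_chain hw C yk.
have -> : up_of w (brev (pop_sizes w) (down_of w y + j)) = y - brev q j.
  rewrite eQ; have ky : brev q j <= y by clear -lt_q xy; lia.
  rewrite subKn // in h; rewrite -h; apply: F4.
  by clear -yk xyn; lia.
rewrite (_ : y - brev q j = x + (y - x - brev q j)); last by clear -lt_q xy; lia.
apply: (reversal_shift RP R1) => //; last by clear; lia.
by rewrite /= subnKC // ltnW.
Qed.

Lemma good_pair_uniq s t p q p' q' : sizes_in s p -> sizes_in t q ->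
  sizes_in s p' -> sizes_in t q' -> sumn p' = sumn p -> sumn q' = sumn q ->
  good s t p q -> good s t p' q' -> pair_equiv p q p' q' -> p' = p /\ q' = q.
Proof.
move=> sp sq sp' sq' sumP sumQ g g' pe.
have pe' : pair_equiv p' q' p q by move=> j; rewrite sumP => jm; rewrite -pe.
have n1 := g p' q' sp' sq' sumP sumQ pe.
have n2 := g' p q sp sq (esym sumP) (esym sumQ) pe'.
have epp : p' = p.
  by apply: (lexlt_total sp' sp sumP); [apply: contra n1 | apply: contra n2]; exact: lexlt_cat.
split=> //; rewrite epp in n1 n2.
by apply: (lexlt_total sq' sq sumQ); [apply: contra n1 | apply: contra n2]; exact: lexlt_prefix.
Qed.

Lemma faccepts_uniq s t W W' : 0 < s -> 0 < t -> all (op_in s t) W -> all (op_in s t) W' ->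
  faccepts (s + t).*2 (check_good s t) W -> faccepts (s + t).*2 (check_good s t) W' ->
  equivalent W W' -> W = W'.
Proof.
move=> s0 t0 al al' acc acc' [en eo].
have [hw so] := faccepts_wf al acc; have [hw' so'] := faccepts_wf al' acc'.
(* A common shape gives both words the same matching and the same runs, so all positions below refer
   to one path. *)
have esh : shape W = shape W' by rewrite (shape_output al) // (shape_output al') // eo.
have er : run W' = run W by rewrite /run esh.
have [eru erd] : downs_before 0 W' = downs_before 0 W /\ ups_before 0 W' = ups_before 0 W.
  by have [E _] := run_total hw; have [E' _] := run_total hw'; move: E'; rewrite er E => -[].
have eP : sumn (push_sizes W') = sumn (push_sizes W) by rewrite -!total_pushE.
have eQP : sumn (pop_sizes W) = sumn (push_sizes W) by have := hrun_total hw.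
have eQ : sumn (pop_sizes W') = sumn (push_sizes W) by have := hrun_total hw'; rewrite -eP.
have [[F1 F2 F3 F4] [F5 F6 F7 F8]] := matching_facts hw.
have sP := sizes_in_push al; have sP' := sizes_in_push al'.
have sQ := sizes_in_pop al; have sQ' := sizes_in_pop al'.
have RP := reversal_brev s0 sP; have RP' := reversal_brev s0 sP'.
have RQ := reversal_brev t0 sQ; have RQ' := reversal_brev t0 sQ'.
rewrite eP in RP'; rewrite eQ in RQ'; rewrite eQP in RQ.
have closedE x y : closed_in W' x y = closed_seg (sumn (push_sizes W)) (up_run W)
    (down_run W) (down_of W) (unc (push_sizes W')) (unc (pop_sizes W')) x y.
  by rewrite /closed_in /up_run /down_run /down_of eP eru erd er.
have downE : down_of W' = down_of W by rewrite /down_of er.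
have upE : up_of W' = up_of W by rewrite /up_of er.
have O j : j < sumn (push_sizes W) -> brev (push_sizes W) (up_of W (brev (pop_sizes W) j)) =
    brev (push_sizes W') (up_of W' (brev (pop_sizes W') j)).
  rewrite -total_pushE -/(op_size W) => jn.
  have := congr1 rev eo; rewrite (output_slots al hw) (output_slots al' hw').
  rewrite -en => /(congr1 (nth 0 ^~ j)).
  by rewrite !(nth_map 0) ?size_iota // !nth_iota // add0n => -[].
(* Equality of outputs [O] is read at the rank that [W] gives to slot [i]; the push reversal of
   [W'], an involution, is then moved to the other side. *)
have EE i : i < sumn (push_sizes W) -> brev (push_sizes W') (brev (push_sizes W) i) =
    up_of W (brev (pop_sizes W') (brev (pop_sizes W) (down_of W i))).
  move=> i_n; have jn := reversal_lt RQ (F2 _ i_n).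
  have := O _ jn; rewrite (reversalK _ RQ) {1}/up_of F4 // upE => ->.
  by rewrite (reversalK _ RP').
have PU c : unc (push_sizes W) c -> up_run W c = up_run W c.+1.
  by apply: unc_downs_before sP.
have PU' c : unc (push_sizes W') c -> up_run W c = up_run W c.+1.
  by rewrite /up_run -eru; apply: unc_downs_before sP'.
have QD j : unc (pop_sizes W) j -> down_run W j = down_run W j.+1.
  by apply: unc_ups_before sQ.
have QD' j : unc (pop_sizes W') j -> down_run W j = down_run W j.+1.
  by rewrite /down_run -erd; apply: unc_ups_before sQ'.
have [|||uP uQ] := @index_uniqueness _ (up_run W) (down_run W) (up_of W) (down_of W)
  F1 F2 F3 F4 F5 F6 F7 F8 s t _ _ _ _ _ _ _ _ t0 RP RP' RQ RQ' PU PU' QD QD' EE.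
- by move=> x y; apply: closed_segment_not_double al acc.
- by move=> x y; rewrite -closedE -downE; apply: closed_segment_not_double al' acc'.
- move=> x y xy yxN C; rewrite -closedE -downE => C' cov cov' c xc; rewrite downE in cov.
  have [p [q [sp sq [ep eq] g [up uq]]]] :=
    closed_segment_good s0 t0 al acc xy (ltnW yxN) C cov.
  have [p' [q' [sp' sq' [ep' eq'] g' [up' uq']]]] :=
    closed_segment_good s0 t0 al' acc' xy (ltnW yxN) C' cov'.
  have [/andP[_ yn] _ _ _ _] := C.
  have sumP : sumn p' = sumn p by rewrite ep ep'.
  have sumQ : sumn q' = sumn q by rewrite eq eq'.
  have xx : x <= x <= y by rewrite leqnn ltnW.
  have [_ _ ex] := closed_chain hw C xx.
  have exn := F2 _ (ltn_trans xy yn).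
  rewrite -/(down_of W x) ex in exn.
  have pe : pair_equiv p q p' q'.
    move=> j; rewrite ep /= => jm; apply: (@addnI x).
    rewrite -(output_segment s0 t0 al hw xy C sp sq ep eq up uq jm).
    rewrite -(output_segment s0 t0 al' hw' xy C' sp' sq' ep' eq' up' uq' jm) downE.
    by apply: O; apply: leq_ltn_trans exn; rewrite leq_add2l -ltnS.
  have [epp eqq] := good_pair_uniq sp sq sp' sq' sumP sumQ g g' pe.
  have c1 : c - x < y - x by clear -xc; lia.
  have c2 : y - c.+1 < y - x by clear -xc; lia.
  have xc1 : x <= c.+1 <= y by clear -xc; lia.
  have [_ _ h3] := closed_chain hw C xc1.
  have xlec : x <= c by case/andP: xc.
  rewrite downE h3 -uq // -[down_of W y]/(down_of W y) -downE -uq' // eqq.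
  by split=> //; rewrite -(subnKC xlec) -up // -up' // epp.
apply: (word_of_shape al al' esh).
  by apply: (unc_inj sP sP').
by apply: (unc_inj sQ sQ') => //; rewrite eQP eQ.
Qed.

Lemma map_to_op s t W : all (op_in s t) W -> exists w : seq (sym s t), map (@to_op s t) w = W.
Proof.
elim: W => [|o W IH] /=; first by exists [::].
case/andP=> ho /IH[w <-]; case: o ho => [[|a]|[|b]] //= lt.
- by exists (inl (Ordinal lt) :: w).
- by exists (inr (Ordinal lt) :: w).
Qed.

Lemma to_op_in s t (w : seq (sym s t)) : all (op_in s t) (map (@to_op s t) w).
Proof. by elim: w => //= -[i|i] w ->; rewrite /= ltn_ord. Qed.

Lemma to_op_inj s t : injective (@to_op s t).
Proof. by move=> [i|i] [j|j] //= [/val_inj->]. Qed.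

Unset Implicit Arguments.

Theorem mainTheorem14 (s t : nat) : 0 < s -> 0 < t ->
  exists M : DPDA (sym s t),
    (forall w, accepts M w ->
       well_formed (map (@to_op s t) w) /\ reduced (map (@to_op s t) w)) /\
    (forall w : seq (sym s t), well_formed (map (@to_op s t) w) ->
       exists! w', accepts M w' /\
         equivalent (map (@to_op s t) w) (map (@to_op s t) w')).
Proof.
move=> s0 t0; exists (automaton s t (s + t).*2 (check_good s t)); split=> [w acc|w wf].
  have [hw so] := faccepts_wf (to_op_in w) (accepts_faccepts acc).
  by split; [apply/(well_formedP (to_op_in w)) | apply/reducedP].
have hw : hrun 0 (map (@to_op s t) w) = Some 0 by apply/(well_formedP (to_op_in w)).
have [W [al so hW eqv can]] := canonical_exists s0 t0 (to_op_in w) hw.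
have [w' ew'] := map_to_op al.
have acc : faccepts (s + t).*2 (check_good s t) W.
  apply: (canonical_faccepts _ al so hW _ t0) => X p Y q Z eW hY Y0 p0 epq.
  have := al; rewrite eW !all_cat op_in_Push op_in_Pop => /and5P[_ sp _ sq _].
  by apply/(check_goodP sp sq p0 epq); exact: can eW hY Y0 epq.
exists w'; split; first by split; [apply: faccepts_accepts; rewrite ew' | rewrite ew'].
move=> v [accv eqv']; apply: (inj_map (@to_op_inj s t)); rewrite ew'.
apply: (faccepts_uniq s0 t0 al (to_op_in v) acc (accepts_faccepts accv)).
case: eqv eqv' => e1 e2 [e3 e4]; split; first by rewrite -e1.
by rewrite -e2.
Qed.
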